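(* Let $H=H_\omega$ be a weighted analytic Hilbert space and let $\varphi\colon\mathbb{D}\to\mathbb{D}$ be an analytic map inducing a bounded composition operator $C_\varphi\colon H\to H$, $C_\varphi f=f\circ\varphi$, with $\overline{\varphi(\mathbb{D})}\subseteq\mathbb{D}$. Then the limit $\beta(C_\varphi):=\lim_{n\to\infty}[a_n(C_\varphi)]^{1/n}$ exists and $$\beta(C_\varphi)=\exp\big(-1/\operatorname{Cap}[\varphi(\mathbb{D})]\big),$$ where $\operatorname{Cap}$ denotes the Green capacity in $\mathbb{D}$.
   Context: Weighted analytic Hilbert space: let $\omega\colon[0,1)\to(0,\infty)$ be continuous, positive and Lebesgue integrable, extended radially by $\omega(z)=\omega(|z|)$. $H_\omega$ is the space of analytic $f$ on the unit disk $\mathbb{D}$ with $\|f\|_\omega^2:=|f(0)|^2+\int_{\mathbb{D}}|f'(z)|^2\omega(z)\,dA(z)<\infty$, $dA$ the normalized area measure. Approximation numbers: for a bounded operator $T$ between Banach spaces, $a_n(T)=\inf\{\|T-R\| : \operatorname{rank}R<n\}$, $n\ge1$. Green capacity: $g(z,w)=\log\left|\frac{1-\bar w z}{z-w}\right|$ is the Green function of $\mathbb{D}$; for a finite positive Borel measure $\mu$ with compact support in $\mathbb{D}$, its energy is $I(\mu)=\iint g(z,w)\,d\mu(z)\,d\mu(w)$. For $E\subseteq\mathbb{D}$, $V(E)=\inf I(\mu)$ over probability measures $\mu$ supported by a compact subset of $E$, and $\operatorname{Cap}(E)=1/V(E)$ (so $\operatorname{Cap}(E)=\sup\{\operatorname{Cap}(K):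 K\subseteq E \text{ compact}\}$), with conventions $1/\infty=0$, $1/0=\infty$. *)

(* Defs.v *)
(* The complex plane is modelled as
   R * R (z = (Re z, Im z)) for an arbitrary realType R (all realTypes are
   isomorphic to the reals).  Complex arithmetic is defined by hand below. *)
From HB Require Import structures.
From mathcomp Require Import all_boot all_order all_algebra.
From mathcomp Require Import all_classical all_reals all_analysis.
Set Implicit Arguments. Unset Strict Implicit. Unset Printing Implicit Defensive.
Import Order.TTheory GRing.Theory Num.Theory.
Import numFieldNormedType.Exports.
Local Open Scope classical_set_scope.
Local Open Scope ring_scope.

Section Complex.
Variable R : realType.
Notation C := (R * R)%type.

(* complex arithmetic on C = R * R ; addition, opposite, 0 come from the
   product zmodType *)
Definition cmul (z w : C) : C := (z.1 * w.1 - z.2 * w.2, z.1 * w.2 + z.2 * w.1).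
Definition cconj (z : C) : C := (z.1, - z.2).
Definition cmod (z : C) : R := Num.sqrt (z.1 ^+ 2 + z.2 ^+ 2).
Definition cinv (z : C) : C := (z.1 / cmod z ^+ 2, - z.2 / cmod z ^+ 2).
Definition cdiv (z w : C) : C := cmul z (cinv w).
Definition cone : C := (1, 0).

Definition disk : set C := [set z | cmod z < 1].

Definition cdq (f : C -> C) (z : C) : C -> C := fun w => cdiv (f w - f z) (w - z).

Definition is_cderiv (f : C -> C) (z l : C) : Prop :=
  forall e : R, 0 < e -> exists2 d : R, 0 < d &
    forall w : C, 0 < cmod (w - z) < d -> cmod (cdq f z w - l) < e.

Definition analytic_on_disk (f : C -> C) : Prop :=
  forall z, disk z -> exists l, is_cderiv f z l.

(* the complex derivative (meaningful where f is complex differentiable) *)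
Definition cderiv (f : C -> C) (z : C) : C := xget 0 [set l | is_cderiv f z l].

(* normalized area measure dA = dx dy / pi on C = R * R : we integrate with
   respect to Lebesgue measure on R x R and divide by pi *)
Definition Dirichlet_integral (omega : R -> R) (f : C -> C) : \bar R :=
  (\int[(@lebesgue_measure R) \x (@lebesgue_measure R)]_(z in disk)
      ((cmod (cderiv f z)) ^+ 2 * omega (cmod z))%:E)%E.

Definition in_H (omega : R -> R) (f : C -> C) : Prop :=
  analytic_on_disk f /\ (Dirichlet_integral omega f < +oo)%E.

Definition Hnorm2 (omega : R -> R) (f : C -> C) : R :=
  cmod (f 0) ^+ 2 + fine (Dirichlet_integral omega f) / pi.

Definition Hnorm (omega : R -> R) (f : C -> C) : R := Num.sqrt (Hnorm2 omega f).

Definition eq_on_disk (f g : C -> C) : Prop := forall z, disk z -> f z = g z.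

Definition cscale (a : C) (f : C -> C) : C -> C := fun z => cmul a (f z).

(* T is a bounded (complex-)linear operator H_omega -> H_omega
   (operators act on representatives; they must respect equality on the disk) *)
Definition bounded_op (omega : R -> R) (T : (C -> C) -> (C -> C)) : Prop :=
  [/\ (forall f, in_H omega f -> in_H omega (T f)),
      (forall f g, in_H omega f -> in_H omega g -> eq_on_disk f g ->
                   eq_on_disk (T f) (T g)),
      (forall a f g, in_H omega f -> in_H omega g ->
          eq_on_disk (T (fun z => cmul a (f z) + g z))
                     (fun z => cmul a (T f z) + T g z)) &
      (exists M : R, forall f, in_H omega f ->
          Hnorm omega (T f) <= M * Hnorm omega f)].

Definition rank_lt (omega : R -> R) (T : (C -> C) -> (C -> C)) (n : nat) : Prop :=
  exists k : nat, (k < n)%N /\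
  exists g : 'I_k -> (C -> C), (forall i, in_H omega (g i)) /\
    forall f, in_H omega f -> exists c : 'I_k -> C,
      eq_on_disk (T f) (fun z => \sum_(i < k) cmul (c i) (g i z)).

Definition op_norm (omega : R -> R) (T : (C -> C) -> (C -> C)) : R :=
  sup [set Hnorm omega (T f) | f in [set f | in_H omega f /\ Hnorm omega f <= 1]].

Definition Comp (phi : C -> C) : (C -> C) -> (C -> C) := fun f => f \o phi.

(* approximation numbers a_n(T) = inf { ||T - S|| : rank S < n }, n >= 1 *)
Definition approx_number (omega : R -> R) (T : (C -> C) -> (C -> C)) (n : nat) : R :=
  inf [set op_norm omega (fun f => T f - S f) |
        S in [set S | bounded_op omega S /\ rank_lt omega S n]].

Definition green (z w : C) : \bar R :=
  if z == w then +oo%E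
  else (ln (cmod (cone - cmul (cconj w) z) / cmod (z - w)))%:E.

Definition green_energy (mu : probability C R) : \bar R :=
  (\int[mu]_z \int[mu]_w green z w)%E.

Definition green_V (E : set C) : \bar R :=
  ereal_inf [set green_energy mu | mu in
     [set mu : probability C R | exists K : set C,
         [/\ compact K, K `<=` E & mu (~` K) = 0%E]]].

(* Cap(E) = 1 / V(E) with 1/+oo = 0, 1/0 = +oo *)
Definition green_cap (E : set C) : \bar R := ((green_V E)^-1)%E.

End Complex.

Arguments disk {R}.
Arguments cone {R}.

(* Main.v *)
Require Import Defs.
From HB Require Import structures.
From mathcomp Require Import all_boot all_order all_algebra.
From mathcomp Require Import all_classical all_reals all_analysis.
From mathcomp Require Import measurable_realfun ring lra.
Set Implicit Arguments. Unset Strict Implicit. Unset Printing Implicit Defensive.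
Import Order.TTheory GRing.Theory Num.Theory.
Import numFieldNormedType.Exports.
Local Open Scope classical_set_scope.
Local Open Scope ring_scope.

(**
Write E = phi(D) and V for the minimal Green energy of E, so that 1 / Cap(E) = V.

Upper bound. If z_1, ..., z_n almost minimize the discrete Green energy in a small neighbourhood K of E,
their Blaschke product B satisfies |B| <= C exp(- n (V - eta)) on K. The reason is that every point of K can
be smeared along an arc of E (the image of a segment) into a measure whose Green potential exceeds that of the
point mass by at most eta off the diagonal and stays bounded, so that averaging the smeared points gives a
competitor for V. Interpolating f at the zeros of B by means of the kernel (1 - B(z)/B(w)) / (w - z)
on a circle |w| = rho close to 1, where |B| >= exp(- eta n), and composing with phi gives an operator of rank n
at distance at most C exp(- n (V - 2 eta)) from the composition operator.

Lower bound. Almost minimizing N points in phi(|z| <= rho), all their reduced potentials are at most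
N (V + eta) + C: integrating the variables one at a time against a nearly optimal measure bounds the energy,
and smearing shows that the potentials of any two points differ by at most eta N + C. An operator of rank less
than N kills the image of some nontrivial combination of the Lagrange-Blaschke functions at these points, while
evaluation at their preimages is bounded, whence a_N >= c N^-2 exp(- N (V + eta)).

Evaluation bounds and derivative estimates rest on Cauchy's formula, obtained from Goursat's lemma.
*)

(** The image need be neither closed nor regular, so no equilibrium measure is at hand and every
    infimum is only approached. Smearing stands in for the usual continuity and maximum principles.
    An arc leaving [w] meets every circle of radius [d * expR (- (M ^+ 2 * t))] about [w]; choosing
    one point on each and taking [t] uniform in [[0, 1]] compares distances to [w] only, whatever
    the shape of the arc. On this logarithmic scale the excess over the point potential is an
    integrable singularity of total size [O(1 / M)].

    A neighbourhood of the image, rather than the image, is needed because the norm involves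
    derivatives: the derivative of the interpolation error at [phi z] comes from its size on a disc
    of radius [delta], and the chain rule leaves the Dirichlet integral of [phi], finite since [phi]
    is the image of the identity function under the operator.

    Slacks of size 1, factors [N ^- 2] and all multiplicative constants disappear under the n-th
    root. A constant [phi] has no arcs and is treated apart: then [V] is infinite and the
    approximation numbers vanish from the second on. *)

(** * Complex numbers *)

(* [R * R] already carries the componentwise product, so the field structure lives on an alias. *)
Definition cplx (R : realType) : Type := (R * R)%type.

HB.instance Definition _ (R : realType) := GRing.Zmodule.copy (cplx R) (R * R)%type.

Section CplxRing.
Variable R : realType.

Lemma cplx_eq (z w : cplx R) : z.1 = w.1 -> z.2 = w.2 -> z = w.
Proof. by case: z => a b; case: w => c d /= -> ->. Qed.

Lemma cplxD1 (z w : cplx R) : (z + w).1 = z.1 + w.1. Proof. by []. Qed.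

Lemma cplxD2 (z w : cplx R) : (z + w).2 = z.2 + w.2. Proof. by []. Qed.

Lemma cplxN1 (z : cplx R) : (- z).1 = - z.1. Proof. by []. Qed.

Lemma cplxN2 (z : cplx R) : (- z).2 = - z.2. Proof. by []. Qed.

Lemma cplx_mulA : associative (@cmul R : cplx R -> cplx R -> cplx R).
Proof. by move=> x y z; apply: cplx_eq; rewrite /cmul /=; ring. Qed.

Lemma cplx_mulC : commutative (@cmul R : cplx R -> cplx R -> cplx R).
Proof. by move=> x y; apply: cplx_eq; rewrite /cmul /=; ring. Qed.

Lemma cplx_mul1 : left_id (cone : cplx R) (@cmul R : cplx R -> cplx R -> cplx R).
Proof. by move=> x; apply: cplx_eq; rewrite /cmul /=; ring. Qed.

Lemma cplx_mulDl : left_distributive (@cmul R : cplx R -> cplx R -> cplx R) +%R.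
Proof. by move=> x y z; apply: cplx_eq; rewrite /cmul /= ?cplxD1 ?cplxD2; ring. Qed.

Lemma cplx_one_neq0 : (cone : cplx R) != 0.
Proof. by apply/eqP => -[]/eqP; rewrite oner_eq0. Qed.

End CplxRing.

HB.instance Definition _ (R : realType) := GRing.Zmodule_isComNzRing.Build (cplx R)
  (@cplx_mulA R) (@cplx_mulC R) (@cplx_mul1 R) (@cplx_mulDl R) (cplx_one_neq0 R).

Section CplxField.
Variable R : realType.
Implicit Types z w : cplx R.

Lemma cmod_sqr z : cmod z ^+ 2 = z.1 ^+ 2 + z.2 ^+ 2.
Proof. by rewrite sqr_sqrtr // addr_ge0 // sqr_ge0. Qed.

Lemma cmod_ge0 z : 0 <= cmod z. Proof. exact: sqrtr_ge0. Qed.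

Lemma cmod_eq0 z : (cmod z == 0) = (z == 0).
Proof.
apply/idP/eqP => [|->]; last by rewrite /cmod /= expr0n /= addr0 sqrtr0.
rewrite sqrtr_eq0 => h.
have h1 : z.1 ^+ 2 = 0 by apply/eqP; rewrite eq_le sqr_ge0 andbT; have := sqr_ge0 z.2; lra.
have h2 : z.2 ^+ 2 = 0 by apply/eqP; rewrite eq_le sqr_ge0 andbT; have := sqr_ge0 z.1; lra.
by apply: cplx_eq; apply/eqP; rewrite -sqrf_eq0; apply/eqP.
Qed.

Lemma cmod_gt0 z : (0 < cmod z) = (z != 0).
Proof. by rewrite lt_neqAle cmod_ge0 andbT eq_sym cmod_eq0. Qed.

Lemma cplx_mulVf z : z != 0 -> (cinv z : cplx R) * z = 1.
Proof.
rewrite -cmod_eq0 => nz; have nz2 : cmod z ^+ 2 != 0 by rewrite sqrf_eq0.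
change (cmul (cinv z) z = cone); rewrite /cmul /cinv /cone /=.
congr pair; last by field.
transitivity ((z.1 ^+ 2 + z.2 ^+ 2) / cmod z ^+ 2); first by field.
by rewrite -cmod_sqr divff.
Qed.

Lemma cplx_inv0 : (cinv (0 : cplx R) : cplx R) = 0.
Proof. by apply: cplx_eq; rewrite /cinv /= ?mul0r ?oppr0 ?mul0r. Qed.

End CplxField.

HB.instance Definition _ (R : realType) := GRing.ComNzRing_isField.Build (cplx R)
  (@cplx_mulVf R) (@cplx_inv0 R).

Section CplxMod.
Variable R : realType.
Implicit Types (z w : cplx R) (x : R).

Definition rc x : cplx R := (x, 0).

Definition ci : cplx R := (0, 1).

(** The ring and field instances are built on [cmul] and [cinv] themselves, so the hand-made
    arithmetic of the statement is convertible to field notation and [ring] and [field] apply to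
    it. *)
Lemma cmulE z w : cmul z w = z * w. Proof. by []. Qed.

Lemma cplxM1 z w : (z * w).1 = z.1 * w.1 - z.2 * w.2. Proof. by []. Qed.

Lemma cplxM2 z w : (z * w).2 = z.1 * w.2 + z.2 * w.1. Proof. by []. Qed.

Lemma cmod0 : cmod (0 : cplx R) = 0. Proof. by apply/eqP; rewrite cmod_eq0. Qed.

Lemma cmod1 : cmod (1 : cplx R) = 1.
Proof. by rewrite /cmod /= expr1n expr0n addr0 sqrtr1. Qed.

Lemma cmodM z w : cmod (z * w) = cmod z * cmod w.
Proof.
rewrite -sqrtrM ?addr_ge0 ?sqr_ge0 //; congr Num.sqrt.
by rewrite cplxM1 cplxM2; ring.
Qed.

Lemma cmodN z : cmod (- z) = cmod z.
Proof. by rewrite /cmod /= !sqrrN. Qed.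

Lemma cmodBC z w : cmod (z - w) = cmod (w - z).
Proof. by rewrite -cmodN opprB. Qed.

Lemma cmod_rc x : cmod (rc x) = `|x|.
Proof. by rewrite /cmod /= expr0n addr0 sqrtr_sqr. Qed.

Lemma cmod_ci : cmod ci = 1.
Proof. by rewrite /cmod /= expr0n expr1n add0r sqrtr1. Qed.

Lemma cmod_conj z : cmod (cconj z) = cmod z.
Proof. by rewrite /cmod /= sqrrN. Qed.

Lemma cmul_conj z : z * (cconj z : cplx R) = rc (cmod z ^+ 2).
Proof. by apply: cplx_eq; rewrite ?cplxM1 ?cplxM2 /= ?cmod_sqr; ring. Qed.

Lemma re_le_cmod z : `|z.1| <= cmod z.
Proof.
by rewrite -sqrtr_sqr ler_sqrt ?addr_ge0 ?sqr_ge0 // lerDl sqr_ge0.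
Qed.

Lemma im_le_cmod z : `|z.2| <= cmod z.
Proof.
by rewrite -sqrtr_sqr ler_sqrt ?addr_ge0 ?sqr_ge0 // lerDr sqr_ge0.
Qed.

Lemma ler_cmodD z w : cmod (z + w) <= cmod z + cmod w.
Proof.
rewrite -(@ler_pXn2r _ 2) ?nnegrE ?addr_ge0 ?cmod_ge0 //.
rewrite [(cmod z + _) ^+ 2]sqrrD !cmod_sqr cplxD1 cplxD2.
have : z.1 * w.1 + z.2 * w.2 <= cmod z * cmod w; last by lra.
apply: le_trans (ler_norm _) _; rewrite -sqrtr_sqr.
rewrite -sqrtrM ?addr_ge0 ?sqr_ge0 // ler_sqrt; last by rewrite mulr_ge0 ?addr_ge0 ?sqr_ge0.
have := sqr_ge0 (z.1 * w.2 - z.2 * w.1); lra.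
Qed.

Lemma cmod_le_sum z : cmod z <= `|z.1| + `|z.2|.
Proof.
have -> : z = rc z.1 + ci * rc z.2 by apply: cplx_eq; rewrite ?cplxD1 ?cplxD2 ?cplxM1 ?cplxM2 /=; ring.
apply: le_trans (ler_cmodD _ _) _.
by rewrite cmodM cmod_ci mul1r !cmod_rc cplxD1 cplxD2 cplxM1 cplxM2 /= !(mul0r, mul1r, mulr0, addr0, add0r, subr0).
Qed.

Lemma ler_cmodB z w : cmod z - cmod w <= cmod (z - w).
Proof. by rewrite lerBlDr; apply: le_trans (ler_cmodD _ _); rewrite subrK. Qed.

Lemma ler_cmodB' z w : cmod (z - w) <= cmod z + cmod w.
Proof. by apply: le_trans (ler_cmodD _ _) _; rewrite cmodN. Qed.

Lemma cmodV z : cmod (z^-1) = (cmod z)^-1.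
Proof.
have [->|nz] := eqVneq z 0; first by rewrite invr0 cmod0 invr0.
have h : cmod z != 0 by rewrite cmod_eq0.
by apply: (mulfI h); rewrite -cmodM !divff // cmod1.
Qed.

Lemma cmod_div z w : cmod (z / w) = cmod z / cmod w.
Proof. by rewrite cmodM cmodV. Qed.

Lemma cmodX z n : cmod (z ^+ n) = cmod z ^+ n.
Proof. by elim: n => [|n IH]; rewrite ?expr0 ?cmod1 // !exprS cmodM IH. Qed.

Lemma rcD (x y : R) : rc (x + y) = rc x + rc y.
Proof. by apply: cplx_eq; rewrite /= ?cplxD2 /= ?addr0. Qed.

Lemma rcN (x : R) : rc (- x) = - rc x.
Proof. by apply: cplx_eq; rewrite /= ?cplxN2 /= ?oppr0. Qed.

Lemma rcB (x y : R) : rc (x - y) = rc x - rc y.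
Proof. by rewrite rcD rcN. Qed.

Lemma rcM (x y : R) : rc (x * y) = rc x * rc y.
Proof. by apply: cplx_eq; rewrite ?cplxM1 ?cplxM2 /=; ring. Qed.

Lemma rcM1 x z : (rc x * z).1 = x * z.1.
Proof. by rewrite cplxM1 /=; ring. Qed.

Lemma rcM2 x z : (rc x * z).2 = x * z.2.
Proof. by rewrite cplxM2 /=; ring. Qed.

Lemma rc_eq0 x : (rc x == 0) = (x == 0).
Proof. by rewrite -cmod_eq0 cmod_rc normr_eq0. Qed.

Lemma rcV (x : R) : rc x^-1 = (rc x)^-1.
Proof.
have [->|nz] := eqVneq x 0; first by rewrite !invr0.
have h : rc x != 0 by rewrite rc_eq0.
by apply: (mulfI h); rewrite -rcM !divff.
Qed.

Lemma cmod_sum I (r : seq I) (P : pred I) (F : I -> cplx R) :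
  cmod (\sum_(i <- r | P i) F i) <= \sum_(i <- r | P i) cmod (F i).
Proof.
elim/big_rec2: _ => [|i y1 y2 _ h]; first by rewrite cmod0.
by apply: le_trans (ler_cmodD _ _) _; rewrite lerD2l.
Qed.

Lemma cmod_prod I (r : seq I) (P : pred I) (F : I -> cplx R) :
  cmod (\prod_(i <- r | P i) F i) = \prod_(i <- r | P i) cmod (F i).
Proof.
elim/big_rec2: _ => [|i y1 y2 _ h]; first by rewrite cmod1.
by rewrite cmodM h.
Qed.

End CplxMod.

(** * Complex differentiation in little-o form *)

Section CDeriv.
Variable R : realType.
Implicit Types (f g : cplx R -> cplx R) (z w l m : cplx R).

(** Clearing the denominator admits [w = z], so the rules for products and composition need no case
    distinction on vanishing increments. *)
Lemma is_cderivP f z l : is_cderiv f z l <->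
  forall e : R, 0 < e -> exists2 d : R, 0 < d &
    forall w, cmod (w - z) < d -> cmod (f w - f z - l * (w - z)) <= e * cmod (w - z).
Proof.
split=> h e e0.
  have [d d0 hd] := h e e0; exists d => // w wd.
  have [->|nwz] := eqVneq w z; first by rewrite !subrr mulr0 subr0 cmod0 mulr0.
  have nz : w - z != 0 by rewrite subr_eq0.
  have := hd w; rewrite cmod_gt0 nz wd => /(_ isT)/ltW hh.
  have -> : f w - f z - l * (w - z) = ((f w - f z) / (w - z) - l) * (w - z) by field.
  by rewrite cmodM ler_wpM2r ?cmod_ge0.
have [d d0 hd] := h (e / 2) (divr_gt0 e0 (ltr0n _ 2)); exists d => //.
change (forall w : cplx R, 0 < cmod (w - z) < d -> cmod ((f w - f z) / (w - z) - l) < e).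
move=> w /andP[w0 wd]; have nz : w - z != 0 by rewrite -cmod_gt0.
have -> : (f w - f z) / (w - z) - l = (f w - f z - l * (w - z)) / (w - z) by field.
rewrite cmod_div ltr_pdivrMr //; apply: le_lt_trans (hd w wd) _.
by rewrite ltr_pM2r //; lra.
Qed.

Lemma is_cderiv_lip f z l : is_cderiv f z l -> exists2 d : R, 0 < d &
  forall w, cmod (w - z) < d -> cmod (f w - f z) <= (cmod l + 1) * cmod (w - z).
Proof.
move=> /is_cderivP/(_ 1 ltr01)[d d0 hd]; exists d => // w /hd h.
have -> : f w - f z = l * (w - z) + (f w - f z - l * (w - z)) by ring.
by apply: le_trans (ler_cmodD _ _) _; rewrite cmodM mulrDl lerD2l.
Qed.

Lemma is_cderiv_unique f z l m : is_cderiv f z l -> is_cderiv f z m -> l = m.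
Proof.
move=> hl hm; apply/eqP; rewrite -subr_eq0 -cmod_eq0; apply/eqP/le_anti.
rewrite cmod_ge0 andbT; apply/ler_addgt0Pr => e e0; rewrite add0r.
have [d d0 hd] := hl (e / 2) (divr_gt0 e0 (ltr0n _ 2)).
have [d' d'0 hd'] := hm (e / 2) (divr_gt0 e0 (ltr0n _ 2)).
pose k := Num.min d d' / 2; have k0 : 0 < k by rewrite divr_gt0 // lt_min d0.
have km : k < Num.min d d' by rewrite /k ltr_pdivrMr // ltr_pMr ?ltr1n // lt_min d0.
move: km; rewrite lt_min => /andP[kd kd'].
have kk : cmod (z + rc k - z) = k by rewrite addrAC subrr add0r cmod_rc gtr0_norm.
have := hd (z + rc k); have := hd' (z + rc k); rewrite kk k0 kd kd' => /(_ isT) h1 /(_ isT) h2.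
set q := cdq _ _ _ in h1 h2; have -> : l - m = (q - m) - (q - l) by ring.
apply: le_trans (ler_cmodB' _ _) _; apply: ltW; move: h1 h2.
rewrite -/(GRing.add q _); set a := cmod _; set b := cmod _; lra.
Qed.

Lemma cderivE f z l : is_cderiv f z l -> cderiv f z = l.
Proof. by move=> h; apply: xget_unique => // m hm; apply: is_cderiv_unique hm h. Qed.

Lemma is_cderiv_near f g z l (d : R) : 0 < d ->
  (forall w, cmod (w - z) < d -> f w = g w) -> is_cderiv f z l -> is_cderiv g z l.
Proof.
move=> d0 fg /is_cderivP h; apply/is_cderivP => e /h[d' d'0 hd'].
exists (Num.min d d'); first by rewrite lt_min d0.
move=> w; rewrite lt_min => /andP[w1 w2]; rewrite -!fg //; first exact: hd'.
by rewrite subrr cmod0.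
Qed.

Lemma is_cderiv_cst (c : cplx R) z : is_cderiv (fun=> c : R * R) z 0.
Proof.
by apply/is_cderivP => e e0; exists 1 => // w _; rewrite subrr mul0r subr0 cmod0 mulr_ge0 ?cmod_ge0 // ltW.
Qed.

Lemma is_cderiv_id z : is_cderiv (fun w => w : R * R) z (1 : cplx R).
Proof.
by apply/is_cderivP => e e0; exists 1 => // w _; rewrite mul1r subrr cmod0 mulr_ge0 ?cmod_ge0 // ltW.
Qed.

Lemma is_cderivD f g z l m : is_cderiv f z l -> is_cderiv g z m ->
  is_cderiv (fun w => f w + g w) z (l + m).
Proof.
move=> /is_cderivP hf /is_cderivP hg; apply/is_cderivP => e e0.
have [d d0 hd] := hf (e / 2) (divr_gt0 e0 (ltr0n _ 2)).
have [d' d'0 hd'] := hg (e / 2) (divr_gt0 e0 (ltr0n _ 2)).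
exists (Num.min d d'); first by rewrite lt_min d0.
move=> w; rewrite lt_min => /andP[/hd h1 /hd' h2].
have -> : f w + g w - (f z + g z) - (l + m) * (w - z) =
  (f w - f z - l * (w - z)) + (g w - g z - m * (w - z)) by ring.
by apply: le_trans (ler_cmodD _ _) _; lra.
Qed.

Lemma is_cderivM f g z l m : is_cderiv f z l -> is_cderiv g z m ->
  is_cderiv (fun w => f w * g w) z (l * g z + f z * m).
Proof.
move=> hf hg; have [d1 d10 L1] := is_cderiv_lip hf; have [d2 d20 L2] := is_cderiv_lip hg.
move: hf hg => /is_cderivP hf /is_cderivP hg; apply/is_cderivP => e e0.
pose M := cmod (g z) + cmod (f z) + 1.
have M0 : 0 < M by rewrite ltr_wpDl // addr_ge0 ?cmod_ge0.
pose N := (cmod l + 1) * (cmod m + 1).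
have N0 : 0 < N by rewrite mulr_gt0 // ltr_wpDl ?cmod_ge0.
have e1 : 0 < e / 2 / M by rewrite !divr_gt0.
have [d d0 hd] := hf _ e1; have [d' d'0 hd'] := hg _ e1.
have d30 : 0 < e / 2 / N by rewrite !divr_gt0.
exists (Num.min (Num.min d d') (Num.min (Num.min d1 d2) (e / 2 / N))).
  by rewrite !lt_min d0 d'0 d10 d20.
move=> w; rewrite !lt_min => /andP[/andP[/hd h1 /hd' h2] /andP[/andP[/L1 l1 /L2 l2] h3]].
have -> : f w * g w - f z * g z - (l * g z + f z * m) * (w - z) =
  (f w - f z - l * (w - z)) * g z + f z * (g w - g z - m * (w - z))
   + (f w - f z) * (g w - g z) by ring.
apply: le_trans (ler_cmodD _ _) _.
apply: le_trans (_ : (e / 2) * cmod (w - z) + (e / 2) * cmod (w - z) <= _); last by lra.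
apply: lerD.
  apply: le_trans (ler_cmodD _ _) _; rewrite !cmodM.
  apply: le_trans (_ : e / 2 / M * cmod (w - z) * (cmod (g z) + cmod (f z)) <= _).
    by rewrite [leRHS]mulrDr; apply: lerD; [|rewrite mulrC]; rewrite ler_wpM2r ?cmod_ge0.
  rewrite mulrAC ler_wpM2r ?cmod_ge0 // mulrAC ler_pdivrMr //.
  by rewrite ler_wpM2l ?divr_ge0 // ?ltW // /M ltrDl.
rewrite cmodM; apply: le_trans (ler_pM (cmod_ge0 _) (cmod_ge0 _) l1 l2) _.
rewrite mulrACA -/N mulrA ler_wpM2r ?cmod_ge0 // mulrC -ler_pdivlMr //.
exact: ltW.
Qed.

Lemma is_cderivZ (c : cplx R) f z l : is_cderiv f z l ->
  is_cderiv (fun w => c * f w) z (c * l).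
Proof.
by move=> /(is_cderivM (is_cderiv_cst c z)); rewrite mul0r add0r.
Qed.

Lemma is_cderivN f z l : is_cderiv f z l -> is_cderiv (fun w => - f w) z (- l).
Proof.
move=> /(is_cderivZ (-1)); rewrite mulN1r; apply: (@is_cderiv_near _ _ _ _ 1) => // w _.
by rewrite mulN1r.
Qed.

Lemma is_cderivB f g z l m : is_cderiv f z l -> is_cderiv g z m ->
  is_cderiv (fun w => f w - g w) z (l - m).
Proof. by move=> hf /is_cderivN; apply: is_cderivD. Qed.

Lemma is_cderiv_comp f g z l m : is_cderiv f z l -> is_cderiv g (f z) m ->
  is_cderiv (fun w => g (f w)) z (m * l).
Proof.
move=> hf hg; have [d1 d10 L1] := is_cderiv_lip hf.
move: hf hg => /is_cderivP hf /is_cderivP hg; apply/is_cderivP => e e0.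
have l0 : 0 < cmod l + 1 by rewrite ltr_wpDl ?cmod_ge0.
have m0 : 0 < cmod m + 1 by rewrite ltr_wpDl ?cmod_ge0.
have e1 : 0 < e / 2 / (cmod l + 1) by rewrite !divr_gt0.
have e2 : 0 < e / 2 / (cmod m + 1) by rewrite !divr_gt0.
have [d d0 hd] := hf _ e2; have [d' d'0 hd'] := hg _ e1.
exists (Num.min (Num.min d d1) (d' / (cmod l + 1))).
  by rewrite !lt_min d0 d10 divr_gt0.
move=> w; rewrite !lt_min => /andP[/andP[/hd h1 /L1 l1]].
rewrite ltr_pdivlMr // mulrC => h3.
have /hd' h2 : cmod (f w - f z) < d' by apply: le_lt_trans h3.
have -> : g (f w) - g (f z) - m * l * (w - z) =
  (g (f w) - g (f z) - m * (f w - f z)) + m * (f w - f z - l * (w - z)) by ring.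
apply: le_trans (ler_cmodD _ _) _.
apply: le_trans (_ : (e / 2) * cmod (w - z) + (e / 2) * cmod (w - z) <= _); last by lra.
apply: lerD.
  apply: le_trans h2 _; apply: le_trans (ler_wpM2l (ltW e1) l1) _.
  by rewrite mulrA divfK // gt_eqF.
rewrite cmodM; apply: le_trans (_ : (cmod m + 1) * (e / 2 / (cmod m + 1) * cmod (w - z)) <= _).
  by apply: ler_pM; rewrite ?cmod_ge0 // lerDl.
by rewrite mulrA mulrCA divff ?mulr1 // gt_eqF.
Qed.

Lemma is_cderivV z : z != 0 -> is_cderiv (fun w : cplx R => w^-1 : R * R) z (- z ^- 2).
Proof.
move=> z0; apply/is_cderivP => e e0.
have cz : 0 < cmod z by rewrite cmod_gt0.
exists (Num.min (cmod z / 2) (e * cmod z ^+ 3 / 2)).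
  by rewrite lt_min !divr_gt0 // ?mulr_gt0 // exprn_gt0.
move=> w; rewrite lt_min => /andP[h1 h2].
have hw : cmod z / 2 < cmod w by have := ler_cmodB z w; rewrite cmodBC; lra.
have w0 : w != 0 by rewrite -cmod_gt0; apply: lt_trans hw; rewrite divr_gt0.
have -> : w^-1 - z^-1 - (- z ^- 2) * (w - z) = (w - z) ^+ 2 / (z ^+ 2 * w) by field; rewrite ?z0 ?w0.
rewrite cmod_div cmodM !cmodX ler_pdivrMr ?mulr_gt0 ?exprn_gt0 ?cmod_gt0 //.
rewrite expr2 -mulrA mulrCA ler_wpM2l ?cmod_ge0 //.
apply: ltW; apply: lt_trans h2 _; rewrite -mulrA ltr_pM2l //.
by rewrite exprSr -mulrA ltr_pM2l ?exprn_gt0.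
Qed.

Lemma is_cderiv_inv f z l : f z != 0 -> is_cderiv f z l ->
  is_cderiv (fun w => (f w)^-1) z (- (f z) ^- 2 * l).
Proof. by move=> fz hf; apply: (is_cderiv_comp hf); apply: is_cderivV. Qed.

(** Continuity measured by [cmod], whereas [R * R] carries the maximum norm; [nbhs_cmodP] reconciles
    the two. *)
Definition ccontpt f z := forall e : R, 0 < e -> exists2 d : R, 0 < d &
  forall w, cmod (w - z) < d -> cmod (f w - f z) < e.

Lemma is_cderiv_cont f z l : is_cderiv f z l -> ccontpt f z.
Proof.
move=> /is_cderiv_lip[d d0 hd] e e0.
have l0 : 0 < cmod l + 1 by rewrite ltr_wpDl ?cmod_ge0.
exists (Num.min d (e / (cmod l + 1))); first by rewrite lt_min d0 divr_gt0.
move=> w; rewrite lt_min => /andP[/hd h]; rewrite ltr_pdivlMr // mulrC.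
exact: le_lt_trans.
Qed.

End CDeriv.

Section RDeriv.
Variable R : realType.
Implicit Types (u : R -> R).

(** The real counterpart of [is_cderivP], through which componentwise derivatives of paths reach
    [is_derive] and the fundamental theorem of calculus. *)
Definition rdif u (t l : R) := forall e : R, 0 < e -> exists2 d : R, 0 < d &
  forall s, `|s - t| < d -> `|u s - u t - l * (s - t)| <= e * `|s - t|.

Lemma rdif_cvgP u t l :
  rdif u t l <-> (h^-1 *: ((u \o shift t) (h *: 1) - u t) @[h --> 0^'] --> (l : R^o)).
Proof.
split=> [H|H].
  apply/cvgrPdist_le => e e0; have [d d0 hd] := H e e0.
  near=> h; have h0 : h != 0 by near: h; exact: nbhs_dnbhs_neq.
  have hh : `|h| < d by near: h; apply: dnbhs0_lt.
  rewrite /= /shift /= scaler1.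
  have := hd (h + t); rewrite addrK => /(_ hh) h1.
  have -> : l - h^-1 *: (u (h + t) - u t) = - h^-1 * (u (h + t) - u t - l * h).
    by rewrite /GRing.scale /=; field.
  by rewrite normrM normrN normfV mulrC ler_pdivrMr ?normr_gt0.
move=> e e0; move/cvgrPdist_le : H => /(_ e e0) [d /= d0 hd].
exists d => // s hs; have [->|st] := eqVneq s t; first by rewrite !subrr mulr0 subr0 normr0 mulr0.
have st0 : s - t != 0 by rewrite subr_eq0.
have := hd (s - t); rewrite /ball_ /= sub0r normrN => /(_ hs st0).
rewrite /= /shift /= scaler1 subrK.
have -> : l - (s - t)^-1 *: (u s - u t) = - (s - t)^-1 * (u s - u t - l * (s - t)).
  by rewrite /GRing.scale /=; field.
by rewrite normrM normrN normfV mulrC ler_pdivrMr ?normr_gt0.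
Unshelve. all: by end_near. Qed.

Lemma rdif_is_derive u (t l : R) : rdif u t l -> is_derive t (1 : R) u l.
Proof.
move=> /rdif_cvgP h; apply: DeriveDef; first by apply/cvg_ex; exists l.
exact: cvg_lim h.
Qed.

Lemma is_derive_rdif u (t l : R) : is_derive t (1 : R) u l -> rdif u t l.
Proof.
move=> [h1 h2]; apply/rdif_cvgP; rewrite -h2; exact: h1.
Qed.

End RDeriv.

(** * Integrals of complex functions over oriented intervals *)

Section CInt.
Variable R : realType.
Implicit Types (f g w : R -> cplx R) (F : cplx R -> cplx R) (a b t : R).

Definition rderiv w t (l : cplx R) := forall e : R, 0 < e -> exists2 d : R, 0 < d &
  forall s, `|s - t| < d -> cmod (w s - w t - rc (s - t) * l) <= e * `|s - t|.

Lemma rderiv1 w t (l : cplx R) : rderiv w t l -> rdif (fun t => (w t).1) t l.1.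
Proof.
move=> h e /h[d d0 hd]; exists d => // s /hd; apply: le_trans.
by apply: le_trans (re_le_cmod _); rewrite !cplxD1 !cplxN1 rcM1 mulrC.
Qed.

Lemma rderiv2 w t (l : cplx R) : rderiv w t l -> rdif (fun t => (w t).2) t l.2.
Proof.
move=> h e /h[d d0 hd]; exists d => // s /hd; apply: le_trans.
by apply: le_trans (im_le_cmod _); rewrite !cplxD2 !cplxN2 rcM2 mulrC.
Qed.

Lemma rderiv_pair w t (l : cplx R) : rdif (fun t => (w t).1) t l.1 ->
  rdif (fun t => (w t).2) t l.2 -> rderiv w t l.
Proof.
move=> h1 h2 e e0; have e2 : 0 < e / 2 by rewrite divr_gt0.
have [d1 d10 k1] := h1 _ e2; have [d2 d20 k2] := h2 _ e2.
exists (Num.min d1 d2); first by rewrite lt_min d10.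
move=> s; rewrite lt_min => /andP[/k1 h /k2 h']; apply: le_trans (cmod_le_sum _) _.
rewrite !cplxD1 !cplxN1 rcM1 !cplxD2 !cplxN2 rcM2 (mulrC (s - t)) (mulrC _ l.2); lra.
Qed.

Lemma rderiv_lip w t l : rderiv w t l -> exists2 d : R, 0 < d &
  forall s, `|s - t| < d -> cmod (w s - w t) <= (cmod l + 1) * `|s - t|.
Proof.
move=> /(_ 1 ltr01)[d d0 hd]; exists d => // s /hd h.
have -> : w s - w t = rc (s - t) * l + (w s - w t - rc (s - t) * l) by ring.
by apply: le_trans (ler_cmodD _ _) _; rewrite cmodM cmod_rc mulrDl mulrC lerD2l.
Qed.

Lemma rderiv_comp F w t (l m : cplx R) : rderiv w t l -> is_cderiv F (w t) m ->
  rderiv (fun s => F (w s)) t (m * l).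
Proof.
move=> hf hg; have [d1 d10 L1] := rderiv_lip hf.
move: hg => /is_cderivP hg => e e0.
have l0 : 0 < cmod l + 1 by rewrite ltr_wpDl ?cmod_ge0.
have m0 : 0 < cmod m + 1 by rewrite ltr_wpDl ?cmod_ge0.
have e1 : 0 < e / 2 / (cmod l + 1) by rewrite !divr_gt0.
have e2 : 0 < e / 2 / (cmod m + 1) by rewrite !divr_gt0.
have [d d0 hd] := hf _ e2; have [d' d'0 hd'] := hg _ e1.
exists (Num.min (Num.min d d1) (d' / (cmod l + 1))).
  by rewrite !lt_min d0 d10 divr_gt0.
move=> s; rewrite !lt_min => /andP[/andP[/hd h1 /L1 l1]].
rewrite ltr_pdivlMr // mulrC => h3.
have /hd' h2 : cmod (w s - w t) < d' by apply: le_lt_trans h3.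
have -> : F (w s) - F (w t) - rc (s - t) * (m * l) =
  (F (w s) - F (w t) - m * (w s - w t)) + m * (w s - w t - rc (s - t) * l) by ring.
apply: le_trans (ler_cmodD _ _) _.
apply: le_trans (_ : (e / 2) * `|s - t| + (e / 2) * `|s - t| <= _); last by lra.
apply: lerD.
  apply: le_trans h2 _; apply: le_trans (ler_wpM2l (ltW e1) l1) _.
  by rewrite mulrA divfK // gt_eqF.
rewrite cmodM; apply: le_trans (_ : (cmod m + 1) * (e / 2 / (cmod m + 1) * `|s - t|) <= _).
  by apply: ler_pM; rewrite ?cmod_ge0 // lerDl.
by rewrite mulrA mulrCA divff ?mulr1 // gt_eqF.
Qed.

Definition ccont a b f := forall t, a <= t <= b -> forall e : R, 0 < e ->
  exists2 d : R, 0 < d & forall s, a <= s <= b -> `|s - t| < d -> cmod (f s - f t) < e.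

Lemma ccont_sub a b a' b' f : a <= a' -> b' <= b -> ccont a b f -> ccont a' b' f.
Proof.
move=> aa bb h t /andP[h1 h2] e e0.
have [|d d0 hd] := h t _ e e0; first by rewrite (le_trans aa h1) (le_trans h2 bb).
exists d => // s /andP[s1 s2]; apply: hd.
by rewrite (le_trans aa s1) (le_trans s2 bb).
Qed.

Lemma rderiv_ccont a b w (dw : R -> cplx R) :
  (forall t, a <= t <= b -> rderiv w t (dw t)) -> ccont a b w.
Proof.
move=> h t /h /rderiv_lip[d d0 hd] e e0.
have l0 : 0 < cmod (dw t) + 1 by rewrite ltr_wpDl ?cmod_ge0.
exists (Num.min d (e / (cmod (dw t) + 1))); first by rewrite lt_min d0 divr_gt0.
move=> s _; rewrite lt_min => /andP[/hd hs]; rewrite ltr_pdivlMr // mulrC.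
exact: le_lt_trans.
Qed.

Lemma ccont_ext a b f g : (forall t, a <= t <= b -> f t = g t) ->
  ccont a b f -> ccont a b g.
Proof.
move=> fg h t tab e e0; have [d d0 hd] := h t tab e e0; exists d => // s sab st.
by rewrite -!fg //; apply: hd.
Qed.

Lemma ccont_cst a b (c : cplx R) : ccont a b (fun=> c).
Proof. by move=> t _ e e0; exists 1 => // s _ _; rewrite subrr cmod0. Qed.

Lemma ccontD a b f g : ccont a b f -> ccont a b g -> ccont a b (fun t => f t + g t).
Proof.
move=> hf hg t tab e e0; have e2 : 0 < e / 2 by rewrite divr_gt0.
have [d1 d10 k1] := hf _ tab _ e2; have [d2 d20 k2] := hg _ tab _ e2.
exists (Num.min d1 d2); first by rewrite lt_min d10.
move=> s sab; rewrite lt_min => /andP[/(k1 _ sab) h /(k2 _ sab) h'].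
have -> : f s + g s - (f t + g t) = (f s - f t) + (g s - g t) by ring.
by apply: le_lt_trans (ler_cmodD _ _) _; lra.
Qed.

Lemma ccontM a b f g : ccont a b f -> ccont a b g -> ccont a b (fun t => f t * g t).
Proof.
move=> hf hg t tab e e0.
have f0 : 0 < cmod (f t) + 1 by rewrite ltr_wpDl ?cmod_ge0.
have g0 : 0 < cmod (g t) + 1 by rewrite ltr_wpDl ?cmod_ge0.
have e1 : 0 < e / 2 / (cmod (f t) + 1) by rewrite !divr_gt0.
have e2 : 0 < e / 2 / (cmod (g t) + 1) by rewrite !divr_gt0.
have [d1 d10 k1] := hf _ tab _ e2; have [d2 d20 k2] := hg _ tab _ e1.
have [d3 d30 k3] := hg _ tab _ ltr01.
exists (Num.min (Num.min d1 d2) d3); first by rewrite !lt_min d10 d20.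
move=> s sab; rewrite !lt_min => /andP[/andP[/(k1 _ sab) h /(k2 _ sab) h'] /(k3 _ sab) h''].
have -> : f s * g s - f t * g t = (f s - f t) * g s + f t * (g s - g t) by ring.
apply: le_lt_trans (ler_cmodD _ _) _; rewrite !cmodM.
have gs : cmod (g s) <= cmod (g t) + 1.
  by have := ler_cmodD (g t) (g s - g t); rewrite addrC subrK; lra.
rewrite [ltRHS](_ : e = e / 2 + e / 2); last by lra.
apply: ltr_leD.
  apply: le_lt_trans (ler_wpM2l (cmod_ge0 _) gs) _.
  by rewrite -ltr_pdivlMr.
apply: le_trans (ler_wpM2r (cmod_ge0 _) (_ : _ <= cmod (f t) + 1)) _; first by rewrite lerDl.
by rewrite mulrC -ler_pdivlMr // ltW.
Qed.

Lemma ccontN a b f : ccont a b f -> ccont a b (fun t => - f t).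
Proof.
move=> /(ccontM (@ccont_cst a b (-1 : cplx R))); apply: ccont_ext => t _.
by rewrite mulN1r.
Qed.

Lemma ccontB a b f g : ccont a b f -> ccont a b g -> ccont a b (fun t => f t - g t).
Proof. by move=> hf /ccontN; apply: ccontD. Qed.

Lemma ccont_comp a b F f : (forall t, a <= t <= b -> ccontpt F (f t)) -> ccont a b f ->
  ccont a b (fun t => F (f t)).
Proof.
move=> hF hf t tab e e0; have [d d0 hd] := hF t tab e e0.
have [d' d'0 hd'] := hf t tab d d0; exists d' => // s sab st.
exact: hd (hd' _ sab st).
Qed.

Lemma ccontV a b f : (forall t, a <= t <= b -> f t != 0) -> ccont a b f ->
  ccont a b (fun t => (f t)^-1).
Proof.
move=> h; apply: (@ccont_comp _ _ (fun z => z^-1)) => t tab.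
exact: is_cderiv_cont (is_cderivV (h t tab)).
Qed.

Lemma ccont_within1 a b f : ccont a b f -> {within `[a, b], continuous (fun t => (f t).1)}.
Proof.
move=> h; apply/subspace_continuousP => t /=; rewrite in_itv /= => tab.
apply/cvgrPdist_lt => e e0; have [d d0 hd] := h t tab e e0.
exists d => //= s; rewrite /= distrC => st; rewrite in_itv /= => sab.
rewrite distrC; apply: le_lt_trans (hd s sab st).
by apply: le_trans (re_le_cmod _); rewrite cplxD1.
Qed.

Lemma ccont_within2 a b f : ccont a b f -> {within `[a, b], continuous (fun t => (f t).2)}.
Proof.
move=> h; apply/subspace_continuousP => t /=; rewrite in_itv /= => tab.
apply/cvgrPdist_lt => e e0; have [d d0 hd] := h t tab e e0.
exists d => //= s; rewrite /= distrC => st; rewrite in_itv /= => sab.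
rewrite distrC; apply: le_lt_trans (hd s sab st).
by apply: le_trans (im_le_cmod _); rewrite cplxD2.
Qed.

Local Notation mu := (@lebesgue_measure R).

Lemma ccont_int1 a b f : ccont a b f -> mu.-integrable `[a, b] (EFin \o (fun t => (f t).1)).
Proof. by move=> /ccont_within1 h; apply: continuous_compact_integrable => //; exact: segment_compact. Qed.

Lemma ccont_int2 a b f : ccont a b f -> mu.-integrable `[a, b] (EFin \o (fun t => (f t).2)).
Proof. by move=> /ccont_within2 h; apply: continuous_compact_integrable => //; exact: segment_compact. Qed.

(** When [a <= b] the interval [[b, a]] is empty or a point and its integral vanishes; the
    difference is therefore the oriented integral, which changes sign with the order of the
    bounds. *)
Definition cint a b f : cplx R :=
  (\int[mu]_(t in `[a, b]) (f t).1 - \int[mu]_(t in `[b, a]) (f t).1,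
   \int[mu]_(t in `[a, b]) (f t).2 - \int[mu]_(t in `[b, a]) (f t).2).

Lemma cint_anti a b f : cint a b f = - cint b a f.
Proof. by apply: cplx_eq; rewrite /= ?cplxN1 ?cplxN2 /= opprB. Qed.

Lemma Rint_rev a b (u : R -> R) : a <= b -> \int[mu]_(t in `[b, a]) u t = 0.
Proof.
rewrite le_eqVlt => /orP[/eqP ->|ab]; first by rewrite set_itv1 Rintegral_set1.
by rewrite set_itv_ge ?Rintegral_set0 // bnd_simp -ltNge.
Qed.

Lemma cintE a b f : a <= b -> cint a b f =
  (\int[mu]_(t in `[a, b]) (f t).1, \int[mu]_(t in `[a, b]) (f t).2).
Proof. by move=> ab; rewrite /cint !(Rint_rev _ ab) !subr0. Qed.

Lemma cint_ext a b f g : a <= b -> (forall t, a <= t <= b -> f t = g t) ->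
  cint a b f = cint a b g.
Proof.
move=> ab fg; rewrite !cintE //; congr pair; apply: eq_Rintegral => t;
  by rewrite inE /= in_itv /= => /fg ->.
Qed.

Lemma cintD a b f g : a <= b -> ccont a b f -> ccont a b g ->
  cint a b (fun t => f t + g t) = cint a b f + cint a b g.
Proof.
move=> ab hf hg; rewrite !cintE //; apply: cplx_eq; rewrite ?cplxD1 ?cplxD2 /=.
  by rewrite -RintegralD //; [exact: ccont_int1|exact: ccont_int1].
by rewrite -RintegralD //; [exact: ccont_int2|exact: ccont_int2].
Qed.

Lemma cintZ a b (c : cplx R) f : a <= b -> ccont a b f ->
  cint a b (fun t => c * f t) = c * cint a b f.
Proof.
move=> ab hf; rewrite !cintE //.
have i1 := ccont_int1 hf; have i2 := ccont_int2 hf.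
have Z (r : R) (u : R -> R) : mu.-integrable `[a, b] (EFin \o u) ->
    mu.-integrable `[a, b] (EFin \o (fun t => r * u t)).
  move=> iu; apply: eq_integrable (integrableZl _ r iu) => //.
apply: cplx_eq; rewrite ?cplxM1 ?cplxM2 /=.
  by rewrite -!RintegralZl // -RintegralB //; exact: Z.
by rewrite -!RintegralZl // -RintegralD //; exact: Z.
Qed.

Lemma cintB a b f g : a <= b -> ccont a b f -> ccont a b g ->
  cint a b (fun t => f t - g t) = cint a b f - cint a b g.
Proof.
move=> ab hf hg; rewrite cintD //; last exact: ccontN.
congr (_ + _); rewrite -mulN1r -cintZ //; apply: cint_ext => // t _.
by rewrite mulN1r.
Qed.

Lemma cint_cat0 a b c f : a <= b -> b <= c -> ccont a c f ->
  cint a b f + cint b c f = cint a c f.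
Proof.
move=> ab bc hf; have ac := le_trans ab bc.
have i1 := ccont_int1 hf; have i2 := ccont_int2 hf.
have H (u : R -> R) : mu.-integrable `[a, c] (EFin \o u) ->
    \int[mu]_(t in `[a, b]) u t + \int[mu]_(t in `[b, c]) u t = \int[mu]_(t in `[a, c]) u t.
  move=> iu; rewrite -(@Rintegral_itv_obnd_cbnd _ b); last first.
    by apply: integrableS iu => //; apply: subset_itv; rewrite ?bnd_simp.
  by rewrite -(Rintegral_itvB iu) ?bnd_simp // addrC subrK.
rewrite !cintE //; apply: cplx_eq; rewrite ?cplxD1 ?cplxD2 /=; exact: H.
Qed.

Lemma cint_cat lo hi a b c f : ccont lo hi f -> lo <= a <= hi -> lo <= b <= hi ->
  lo <= c <= hi -> cint a b f + cint b c f = cint a c f.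
Proof.
move=> hf /andP[a1 a2] /andP[b1 b2] /andP[c1 c2].
have H x y z : lo <= x -> x <= y -> y <= z -> z <= hi -> cint x y f + cint y z f = cint x z f.
  by move=> h1 h2 h3 h4; apply: cint_cat0 => //; apply: ccont_sub hf.
have [ab|/ltW ab] := leP a b; have [bc|/ltW bc] := leP b c; first exact: H.
- have [ac|/ltW ac] := leP a c; rewrite (cint_anti b c).
    by rewrite -(H _ _ _ a1 ac bc) //; ring.
  by rewrite (cint_anti a c) -(H _ _ _ c1 ac ab) //; ring.
- have [ac|/ltW ac] := leP a c; rewrite (cint_anti a b).
    by rewrite -(H _ _ _ b1 ab ac) //; ring.
  by rewrite (cint_anti a c) -(H _ _ _ b1 bc ac) //; ring.
- by rewrite (cint_anti a b) (cint_anti b c) (cint_anti a c) -(H _ _ _ c1 bc ab) //; ring.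
Qed.

Lemma ccont_cmod a b f : ccont a b f -> ccont a b (fun t => rc (cmod (f t))).
Proof.
move=> h t tab e e0; have [d d0 hd] := h t tab e e0; exists d => // s sab st.
apply: le_lt_trans (hd s sab st); rewrite -rcB cmod_rc ler_norml; apply/andP; split.
  by rewrite lerNl opprB cmodBC; apply: ler_cmodB.
exact: ler_cmodB.
Qed.

Lemma ccont_intc a b f : ccont a b f -> mu.-integrable `[a, b] (EFin \o (fun t => cmod (f t))).
Proof. by move=> /ccont_cmod/ccont_int1. Qed.

(** The factor 2 comes from bounding real and imaginary parts separately; such constants have no
    effect on the final limit. *)
Lemma cint_le_norm a b f : a <= b -> ccont a b f ->
  cmod (cint a b f) <= 2 * \int[mu]_(t in `[a, b]) cmod (f t).
Proof.
move=> ab hf; rewrite cintE // mulr_natl mulr2n.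
have i1 := ccont_int1 hf; have i2 := ccont_int2 hf; have i3 := ccont_intc hf.
apply: le_trans (cmod_le_sum _) _; apply: lerD.
  apply: le_trans (le_normr_Rintegral _ i1) _ => //; apply: le_Rintegral => //.
    exact: (integrable_norm i1).
  by move=> t _; apply: re_le_cmod.
apply: le_trans (le_normr_Rintegral _ i2) _ => //; apply: le_Rintegral => //.
  exact: (integrable_norm i2).
by move=> t _; apply: im_le_cmod.
Qed.

Lemma cint_bound a b f M : a <= b -> ccont a b f ->
  (forall t, a <= t <= b -> cmod (f t) <= M) -> cmod (cint a b f) <= 2 * M * (b - a).
Proof.
move=> ab hf hM; apply: le_trans (cint_le_norm ab hf) _.
rewrite -mulrA ler_wpM2l //.
have -> : M * (b - a) = \int[mu]_(t in `[a, b]) M.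
  have e : mu `[a, b] = (b - a)%:E; last by rewrite Rintegral_cst // -[b - a]/(fine (b - a)%:E) -e.
    have := @lebesgue_measure_itv R `[a, b]; rewrite /= lte_fin => ->.
    by case: ltgtP ab => //= -> _; rewrite subrr.
apply: le_Rintegral => //; first exact: ccont_intc.
  exact: (ccont_int1 (@ccont_cst a b (rc M))).
Qed.

Lemma FTC_real a b (u v : R -> R) : a <= b -> (forall t, a <= t <= b -> rdif u t (v t)) ->
  {within `[a, b], continuous v} -> \int[mu]_(t in `[a, b]) v t = u b - u a.
Proof.
rewrite le_eqVlt => /orP[/eqP -> _ _|ab hu hv]; first by rewrite set_itv1 Rintegral_set1 subrr.
have cu x : a <= x <= b -> {for x, continuous u}.
  move=> /hu /rdif_is_derive [h _]; apply: differentiable_continuous.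
  exact/derivable1_diffP.
have hd x : x \in `]a, b[ -> is_derive x (1 : R) u (v x).
  by rewrite in_itv /= => /andP[/ltW x1 /ltW x2]; apply/rdif_is_derive/hu; rewrite x1.
rewrite /Rintegral (@continuous_FTC2 _ v u) //; last first.
  by move=> x /hd d; rewrite derive1E derive_val.
split => [x /hd[]//||].
- by apply: cvg_at_right_filter; apply: cu; rewrite lexx ltW.
- by apply: cvg_at_left_filter; apply: cu; rewrite lexx ltW.
Qed.

Lemma cint_FTC a b (G g : R -> cplx R) : a <= b ->
  (forall t, a <= t <= b -> rderiv G t (g t)) -> ccont a b g -> cint a b g = G b - G a.
Proof.
move=> ab hG hg; rewrite cintE //; apply: cplx_eq; rewrite ?cplxD1 ?cplxD2 /=.
  apply: (@FTC_real _ _ (fun t => (G t).1)) => //; last exact: ccont_within1.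
  by move=> t /hG /rderiv1.
apply: (@FTC_real _ _ (fun t => (G t).2)) => //; last exact: ccont_within2.
by move=> t /hG /rderiv2.
Qed.

End CInt.

(** * Euclidean discs against the product topology *)

Section Topology.
Variable R : realType.
Implicit Types z w : cplx R.

Lemma nbhs_cmodP z (A : set (R * R)) :
  nbhs (z : R * R) A <-> exists2 d : R, 0 < d & forall w : cplx R, cmod (w - z) < d -> A w.
Proof.
split.
  move=> /nbhs_ballP[d /= d0 hd]; exists d => // w wd; apply: hd.
  split; rewrite /ball /= distrC; apply: le_lt_trans wd.
    exact: (re_le_cmod (w - z)).
  exact: (im_le_cmod (w - z)).
move=> [d d0 hd]; apply/nbhs_ballP; exists (d / 2); first by rewrite /= divr_gt0.
move=> w [] /=; rewrite /ball /= => h1 h2; apply: hd.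
apply: le_lt_trans (cmod_le_sum _) _; rewrite cplxD1 cplxD2.
by move: h1 h2; rewrite distrC [in X in _ -> X -> _]distrC /=; lra.
Qed.

Lemma cmod_continuous : continuous (@cmod R : R * R -> R).
Proof.
move=> z; apply/cvgrPdist_lt => e e0; apply/nbhs_cmodP; exists e => // w wz.
apply: le_lt_trans wz; rewrite ler_norml; apply/andP; split.
  by rewrite lerNl opprB; apply: ler_cmodB.
by rewrite cmodBC; apply: ler_cmodB.
Qed.

Lemma compact_cdisc (r : R) : compact [set z : R * R | cmod z <= r].
Proof.
apply: (@subclosed_compact _ _ (`[- r, r] `*` `[- r, r])).
- have -> : [set z : R * R | cmod z <= r] = (@cmod R) @^-1` [set x | x <= r] by [].
  by apply: preimage_closed; [move=> x _; exact: cmod_continuous|exact: closed_le].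
- by apply: compact_setX; exact: segment_compact.
move=> z /= zr; split; rewrite /= in_itv /= -ler_norml; apply: le_trans zr.
  exact: re_le_cmod.
exact: im_le_cmod.
Qed.

(** Only [z] is confined to the compact disc; [w] may leave it, as happens for the intermediate
    points in [primitive]. *)
Lemma unif_cont (f : cplx R -> cplx R) (r : R) :
  (forall z, cmod z <= r -> ccontpt f z) -> forall e : R, 0 < e ->
  exists2 d : R, 0 < d & forall z w, cmod z <= r -> cmod (w - z) < d -> cmod (f w - f z) < e.
Proof.
move=> hf e e0; have /compact_near_coveringP := @compact_cdisc r.
have F : ProperFilter (0 : R)^'+ by exact: at_right_proper_filter.
move=> /(_ R (0 : R)^'+ (fun d (z : R * R) => forall w : cplx R, cmod (w - z) < d -> cmod (f w - f z) < e)).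
case.
  move=> z zr; have e2 : 0 < e / 2 by rewrite divr_gt0.
  have [d d0 hd] := hf z zr _ e2.
  exists ([set w : R * R | cmod (w - z : cplx R) < d / 2], [set x | x < d / 2]).
    split => /=; first by apply/nbhs_cmodP; exists (d / 2) => //; rewrite divr_gt0.
    by apply: nbhs_right_lt; rewrite divr_gt0.
  move=> [z' x] /= [h1 h2] w wz'.
  have -> : f w - f z' = (f w - f z) - (f z' - f z) by ring.
  apply: le_lt_trans (ler_cmodB' _ _) _.
  rewrite [ltRHS](_ : e = e / 2 + e / 2); last by lra.
  apply: ltrD; apply: hd; last by lra.
  have -> : w - z = (w - z') + (z' - z) :> cplx R by rewrite subrKA.
  by apply: le_lt_trans (ler_cmodD _ _) _; lra.
move=> d /= d0 hd; exists (d / 2); first by rewrite divr_gt0.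
move=> z w zr wz; apply: (hd (d / 2)) => //=; last by rewrite divr_gt0.
by rewrite sub0r normrN gtr0_norm ?divr_gt0 // ltr_pdivrMr // ltr_pMr // ltr1n.
Qed.

End Topology.

(** * Cauchy theory on the disk *)

Section Goursat.
Variable R : realType.
Implicit Types (f F : cplx R -> cplx R) (x y t : R).

Lemma rderiv_h y t : rderiv (fun t => (t, y) : cplx R) t (1 : cplx R).
Proof.
move=> e e0; exists 1 => // s _; rewrite mulr1.
have -> : (s, y) - (t, y) - rc (s - t) = 0 :> cplx R by apply: cplx_eq; rewrite ?cplxD1 ?cplxD2 ?cplxN1 ?cplxN2 /=; ring.
by rewrite cmod0 mulr_ge0 // ltW.
Qed.

Lemma rderiv_v x t : rderiv (fun t => (x, t) : cplx R) t (ci R).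
Proof.
move=> e e0; exists 1 => // s _.
have -> : (x, s) - (x, t) - rc (s - t) * ci R = 0 :> cplx R.
  by apply: cplx_eq; rewrite ?cplxD1 ?cplxD2 ?cplxN1 ?cplxN2 ?rcM1 ?rcM2 /=; ring.
by rewrite cmod0 mulr_ge0 // ltW.
Qed.

Lemma ccont_h f a b y : (forall t, a <= t <= b -> ccontpt f (t, y)) ->
  ccont a b (fun t => f (t, y)).
Proof.
move=> h; apply: (@ccont_comp _ _ _ f (fun t => (t, y))) => //.
by apply: (@rderiv_ccont _ _ _ _ (fun=> 1)) => t _; apply: rderiv_h.
Qed.

Lemma ccont_v f a b x : (forall t, a <= t <= b -> ccontpt f (x, t)) ->
  ccont a b (fun t => f (x, t)).
Proof.
move=> h; apply: (@ccont_comp _ _ _ f (fun t => (x, t))) => //.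
by apply: (@rderiv_ccont _ _ _ _ (fun=> ci R)) => t _; apply: rderiv_v.
Qed.

Lemma ccontptB f g z : ccontpt f z -> ccontpt g z -> ccontpt (fun w => f w - g w) z.
Proof.
move=> hf hg e e0; have e2 : 0 < e / 2 by rewrite divr_gt0.
have [d1 d10 k1] := hf _ e2; have [d2 d20 k2] := hg _ e2.
exists (Num.min d1 d2); first by rewrite lt_min d10.
move=> w; rewrite lt_min => /andP[/k1 h /k2 h'].
have -> : f w - g w - (f z - g z) = (f w - f z) - (g w - g z) by ring.
by apply: le_lt_trans (ler_cmodB' _ _) _; lra.
Qed.

Lemma natrc n : (n%:R : cplx R) = rc (n%:R : R).
Proof. by elim: n => [//|n IH]; rewrite -!natr1 rcD IH. Qed.

(** The counterclockwise boundary integral: [dz] is [dt] on horizontal sides and [ci R * dt] on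
    vertical ones, and the top and left sides are run backwards. *)
Definition rint f x0 x1 y0 y1 : cplx R :=
  cint x0 x1 (fun t => f (t, y0)) + ci R * cint y0 y1 (fun t => f (x1, t))
  - cint x0 x1 (fun t => f (t, y1)) - ci R * cint y0 y1 (fun t => f (x0, t)).

Definition rect x0 x1 y0 y1 : set (cplx R) :=
  [set z | (x0 <= z.1 <= x1) && (y0 <= z.2 <= y1)].

Section OnRect.
Variables (x0 x1 y0 y1 : R) (f : cplx R -> cplx R).
Hypotheses (x01 : x0 <= x1) (y01 : y0 <= y1).
Hypothesis fc : forall z, rect x0 x1 y0 y1 z -> ccontpt f z.

Lemma rect_ccont_h y : y0 <= y <= y1 -> ccont x0 x1 (fun t => f (t, y)).
Proof. by move=> h; apply: ccont_h => t tx; apply: fc; rewrite /rect /= tx. Qed.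

Lemma rect_ccont_v x : x0 <= x <= x1 -> ccont y0 y1 (fun t => f (x, t)).
Proof. by move=> h; apply: ccont_v => t tx; apply: fc; rewrite /rect /= h. Qed.

Lemma rint_prim F : (forall z, rect x0 x1 y0 y1 z -> is_cderiv F z (f z)) ->
  rint f x0 x1 y0 y1 = 0.
Proof.
move=> hF.
have H y : y0 <= y <= y1 -> cint x0 x1 (fun t => f (t, y)) = F (x1, y) - F (x0, y).
  move=> hy; apply: (@cint_FTC _ _ _ (fun t => F (t, y))) => //; last exact: rect_ccont_h.
  move=> t ht; rewrite -[f _]mulr1; apply: (rderiv_comp (rderiv_h y t)).
  by apply: hF; rewrite /rect /= ht.
have V x : x0 <= x <= x1 -> ci R * cint y0 y1 (fun t => f (x, t)) = F (x, y1) - F (x, y0).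
  move=> hx; rewrite -cintZ //; last exact: rect_ccont_v.
  apply: (@cint_FTC _ _ _ (fun t => F (x, t))) => //; last first.
    by apply: ccontM; [exact: ccont_cst|exact: rect_ccont_v].
  move=> t ht; rewrite mulrC; apply: (rderiv_comp (rderiv_v x t)).
  by apply: hF; rewrite /rect /= hx.
rewrite /rint !H ?V ?lexx ?x01 ?y01 //; ring.
Qed.

Lemma rint_bound M : (forall z, rect x0 x1 y0 y1 z -> cmod (f z) <= M) ->
  cmod (rint f x0 x1 y0 y1) <= 4 * M * ((x1 - x0) + (y1 - y0)).
Proof.
move=> hM.
have H y : y0 <= y <= y1 -> cmod (cint x0 x1 (fun t => f (t, y))) <= 2 * M * (x1 - x0).
  move=> hy; apply: cint_bound => //; first exact: rect_ccont_h.
  by move=> t ht; apply: hM; rewrite /rect /= ht.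
have V x : x0 <= x <= x1 -> cmod (ci R * cint y0 y1 (fun t => f (x, t))) <= 2 * M * (y1 - y0).
  move=> hx; rewrite cmodM cmod_ci mul1r; apply: cint_bound => //; first exact: rect_ccont_v.
  by move=> t ht; apply: hM; rewrite /rect /= hx.
rewrite /rint; apply: le_trans (ler_cmodB' _ _) _.
apply: le_trans (lerD (ler_cmodB' _ _) (lexx _)) _.
apply: le_trans (lerD (lerD (ler_cmodD _ _) (lexx _)) (lexx _)) _.
have := H y0; have := H y1; have := V x0; have := V x1.
rewrite !lexx x01 y01 => /(_ isT) a1 /(_ isT) a2 /(_ isT) a3 /(_ isT) a4; lra.
Qed.

End OnRect.

Lemma rintB f g x0 x1 y0 y1 : x0 <= x1 -> y0 <= y1 ->
  (forall z, rect x0 x1 y0 y1 z -> ccontpt f z) -> (forall z, rect x0 x1 y0 y1 z -> ccontpt g z) ->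
  rint (fun z => f z - g z) x0 x1 y0 y1 = rint f x0 x1 y0 y1 - rint g x0 x1 y0 y1.
Proof.
move=> x01 y01 hf hg; rewrite /rint !cintB //; first ring;
  try (by apply: rect_ccont_h; [eassumption|rewrite lexx y01]);
  try (by apply: rect_ccont_v; [eassumption|rewrite lexx x01]).
Qed.

Lemma rint_split f x0 xm x1 y0 ym y1 : x0 <= xm <= x1 -> y0 <= ym <= y1 ->
  (forall z, rect x0 x1 y0 y1 z -> ccontpt f z) ->
  rint f x0 x1 y0 y1 = rint f x0 xm y0 ym + rint f xm x1 y0 ym
    + rint f x0 xm ym y1 + rint f xm x1 ym y1.
Proof.
move=> /[dup] hx /andP[hx1 hx2] /[dup] hy /andP[hy1 hy2] fc.
have x01 := le_trans hx1 hx2; have y01 := le_trans hy1 hy2.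
have H y : y0 <= y <= y1 -> cint x0 x1 (fun t => f (t, y)) =
    cint x0 xm (fun t => f (t, y)) + cint xm x1 (fun t => f (t, y)).
  by move=> h; rewrite cint_cat0 //; apply: rect_ccont_h h.
have V x : x0 <= x <= x1 -> cint y0 y1 (fun t => f (x, t)) =
    cint y0 ym (fun t => f (x, t)) + cint ym y1 (fun t => f (x, t)).
  by move=> h; rewrite cint_cat0 //; apply: rect_ccont_v h.
by rewrite /rint (H y0) ?lexx // (H y1) ?lexx ?y01 // (V x0) ?lexx // (V x1) ?lexx ?x01 //; ring.
Qed.

(** Left ends increase and right ends decrease, so every right end bounds all left ends and the
    supremum of the latter lies in each interval. *)
Lemma sup_nested (x : nat -> R) (p : R) : 0 <= p ->
  (forall n, x n <= x n.+1) -> (forall n, x n.+1 + p / 2 ^+ n.+1 <= x n + p / 2 ^+ n) ->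
  exists X, forall n, x n <= X <= x n + p / 2 ^+ n.
Proof.
move=> p0 hi hd.
have mono : {homo x : n m / (n <= m)%N >-> n <= m} by apply/nondecreasing_seqP.
have mono' : {homo (fun n => - (x n + p / 2 ^+ n)) : n m / (n <= m)%N >-> n <= m}.
  by apply/nondecreasing_seqP => n; rewrite lerN2.
have q0 n : 0 <= p / 2 ^+ n by rewrite divr_ge0 // exprn_ge0.
have ub n m : x n <= x m + p / 2 ^+ m.
  have := mono _ _ (leq_maxl n m); have := mono' _ _ (leq_maxr n m); have := q0 (maxn n m).
  by rewrite lerN2; lra.
have ne : (range x) !=set0 by exists (x 0%N); exists 0%N.
have hub m : ubound (range x) (x m + p / 2 ^+ m) by move=> _ [n _ <-].
exists (sup (range x)) => n; apply/andP; split.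
  by apply: ub_le_sup; [exists (x 0%N + p / 2 ^+ 0)|exists n].
exact: ge_sup.
Qed.

(** Quadrisection: if the integral has modulus [c > 0], some quarter carries at least [c / 4], and
    so on. The rectangles shrink to a point where [f] is affine up to a small error, and affine
    functions integrate to zero. No continuity of the derivative is assumed. *)
Lemma goursat f x0 x1 y0 y1 : x0 <= x1 -> y0 <= y1 ->
  (forall z, rect x0 x1 y0 y1 z -> exists l, is_cderiv f z l) -> rint f x0 x1 y0 y1 = 0.
Proof.
move=> x01 y01 fd; apply/eqP; rewrite -cmod_eq0; apply: contraT => c0.
set c := cmod (rint f x0 x1 y0 y1) in c0.
have {}c0 : 0 < c by rewrite lt_neqAle eq_sym c0 cmod_ge0.
pose p := x1 - x0; pose q := y1 - y0.
have p0 : 0 <= p by rewrite subr_ge0. have q0 : 0 <= q by rewrite subr_ge0.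
have fc z : rect x0 x1 y0 y1 z -> ccontpt f z by move=> /fd[l]; apply: is_cderiv_cont.
pose P (n : nat) (v : cplx R) := [/\ x0 <= v.1, v.1 + p / 2 ^+ n <= x1, y0 <= v.2, v.2 + q / 2 ^+ n <= y1 &
  c / 4 ^+ n <= cmod (rint f v.1 (v.1 + p / 2 ^+ n) v.2 (v.2 + q / 2 ^+ n))].
(* The relation is vacuous outside [P], so every state has a successor and dependent choice
   applies. *)
pose S (v v' : nat * cplx R) := P v.1 v.2 -> [/\ v'.1 = v.1.+1, P v'.1 v'.2,
  v.2.1 <= v'.2.1 /\ v'.2.1 + p / 2 ^+ v'.1 <= v.2.1 + p / 2 ^+ v.1 &
  v.2.2 <= v'.2.2 /\ v'.2.2 + q / 2 ^+ v'.1 <= v.2.2 + q / 2 ^+ v.1].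
have step v : exists v', S v v'.
  have [hP|nP] := pselect (P v.1 v.2); last by exists v.
  case: v hP => n [x y] /= hP; case: (hP) => /= h1 h2 h3 h4 h5.
  pose p' := p / 2 ^+ n.+1; pose q' := q / 2 ^+ n.+1.
  have pp : p / 2 ^+ n = p' + p' by rewrite /p' exprS; field; rewrite expf_neq0.
  have qq : q / 2 ^+ n = q' + q' by rewrite /q' exprS; field; rewrite expf_neq0.
  have p'0 : 0 <= p' by rewrite divr_ge0 // exprn_ge0.
  have q'0 : 0 <= q' by rewrite divr_ge0 // exprn_ge0.
  have fcn z : rect x (x + p / 2 ^+ n) y (y + q / 2 ^+ n) z -> ccontpt f z.
    move=> /andP[/andP[a1 a2] /andP[a3 a4]]; apply: fc; rewrite /rect /=.
    by rewrite (le_trans h1 a1) (le_trans a2 h2) (le_trans h3 a3) (le_trans a4 h4).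
  have hs := @rint_split f x (x + p') (x + p / 2 ^+ n) y (y + q') (y + q / 2 ^+ n).
  have {}hs := hs _ _ fcn; rewrite pp qq in hs.
  have {}hs := hs ltac:(apply/andP; split; lra) ltac:(apply/andP; split; lra).
  rewrite pp qq in h5.
  pose I (a b : R) := rint f a (a + p') b (b + q').
  have {}hs : rint f x (x + (p' + p')) y (y + (q' + q')) =
      I x y + I (x + p') y + I x (y + q') + I (x + p') (y + q').
    by rewrite hs /I -!addrA.
  have e4 : c / 4 ^+ n = 4 * (c / 4 ^+ n.+1) by rewrite exprS; field; rewrite expf_neq0.
  have : exists a b, [/\ a \in [:: x; x + p'], b \in [:: y; y + q'] & c / 4 ^+ n.+1 <= cmod (I a b)].
    apply: contrapT => nh.
    have K a b : a \in [:: x; x + p'] -> b \in [:: y; y + q'] -> cmod (I a b) < c / 4 ^+ n.+1.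
      by move=> ha hb; rewrite ltNge; apply/negP => hh; apply: nh; exists a, b.
    have := K x y; have := K (x + p') y; have := K x (y + q'); have := K (x + p') (y + q').
    rewrite !inE !eqxx !orbT => /(_ isT isT) k1 /(_ isT isT) k2 /(_ isT isT) k3 /(_ isT isT) k4.
    move: h5; rewrite hs e4 => h5.
    have := le_trans h5 (ler_cmodD _ _).
    have := ler_cmodD (I x y + I (x + p') y) (I x (y + q')); have := ler_cmodD (I x y) (I (x + p') y).
    lra.
  move=> [a [b [ha hb hI]]]; exists (n.+1, (a, b)) => _ /=.
  have hax : (a == x) || (a == x + p') by move: ha; rewrite !inE.
  have hbx : (b == y) || (b == y + q') by move: hb; rewrite !inE.
  rewrite -/p' -/q' pp qq; rewrite pp in h2; rewrite qq in h4.
  have a1 : x <= a by case/orP: hax => /eqP ->; rewrite ?lerDl.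
  have a2 : a + p' <= x + (p' + p') by case/orP: hax => /eqP ->; rewrite ?addrA // lerDl.
  have b1 : y <= b by case/orP: hbx => /eqP ->; rewrite ?lerDl.
  have b2 : b + q' <= y + (q' + q') by case/orP: hbx => /eqP ->; rewrite ?addrA // lerDl.
  split => //; split => //=; rewrite -/p' -/q'.
  - exact: le_trans a1.
  - exact: le_trans h2.
  - exact: le_trans b1.
  - exact: le_trans h4.
have [v [v0 hv]] := dependent_choice (fun v => cid (step v)) (0%N, (x0, y0) : cplx R).
have Pv n : (v n).1 = n /\ P n (v n).2.
  elim: n => [|n [e hP]].
    rewrite v0 /P /= !expr0 !divr1 !lexx /p /q !(addrC _ (_ - _)) !subrK; split => //; split=> //.
  by have := hv n; rewrite /S e => /(_ hP)[e' hP' _ _]; move: hP'; rewrite e'; split.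
have hv' n : [/\ (v n).2.1 <= (v n.+1).2.1, (v n.+1).2.1 + p / 2 ^+ n.+1 <= (v n).2.1 + p / 2 ^+ n,
    (v n).2.2 <= (v n.+1).2.2 & (v n.+1).2.2 + q / 2 ^+ n.+1 <= (v n).2.2 + q / 2 ^+ n].
  have [e hP] := Pv n; have [e' _] := Pv n.+1.
  by have := hv n; rewrite /S e e' => /(_ hP)[_ _ [? ?] [? ?]]; split.
have [X hX] := @sup_nested (fun n => (v n).2.1) p p0 (fun n => let: And4 a _ _ _ := hv' n in a)
  (fun n => let: And4 _ a _ _ := hv' n in a).
have [Y hY] := @sup_nested (fun n => (v n).2.2) q q0 (fun n => let: And4 _ _ a _ := hv' n in a)
  (fun n => let: And4 _ _ _ a := hv' n in a).
pose z : cplx R := (X, Y).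
have [l /is_cderivP hl] : exists l : cplx R, is_cderiv f z l.
  apply: fd; have := hX 0%N; have := hY 0%N; rewrite v0 /= expr0 !divr1 /rect /= /p /q.
  by rewrite !(addrC _ (_ - _)) !subrK => -> ->.
have main (e : R) : 0 < e -> c <= 4 * e * (p + q) ^+ 2.
  move=> e0; have [d d0 hd] := hl e e0.
  have [n hn] : exists n, (p + q) / 2 ^+ n < d.
    have [n hn] : exists n, (p + q) / d < 2 ^+ n.
      exists (Num.trunc ((p + q) / d)).+1.
      apply: lt_trans (truncnS_gt _) _; rewrite -natrX ltr_nat; exact: ltn_expl.
    by exists n; rewrite ltr_pdivrMr ?exprn_gt0 // mulrC -ltr_pdivrMr.
  have [_ [h1 h2 h3 h4 h5]] := Pv n.
  set x := (v n).2.1 in h1 h2 h5; set y := (v n).2.2 in h3 h4 h5.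
  have xs : x <= x + p / 2 ^+ n by rewrite lerDl divr_ge0 // exprn_ge0.
  have ys : y <= y + q / 2 ^+ n by rewrite lerDl divr_ge0 // exprn_ge0.
  have fcn w : rect x (x + p / 2 ^+ n) y (y + q / 2 ^+ n) w -> ccontpt f w.
    move=> /andP[/andP[a1 a2] /andP[a3 a4]]; apply: fc; rewrite /rect /=.
    by rewrite (le_trans h1 a1) (le_trans a2 h2) (le_trans h3 a3) (le_trans a4 h4).
  pose L (w : cplx R) : cplx R := f z + l * (w - z).
  have dL (w : cplx R) : is_cderiv L w l.
    have := is_cderivD (is_cderiv_cst (f z) w) (is_cderivZ l (is_cderivB (is_cderiv_id w) (is_cderiv_cst z w))).
    by rewrite add0r subr0 mulr1.
  have cL (w : cplx R) : ccontpt L w by apply: is_cderiv_cont (dL w).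
  have rL : rint L x (x + p / 2 ^+ n) y (y + q / 2 ^+ n) = 0.
    apply: (@rint_prim _ _ _ _ L xs ys _ (fun w : cplx R => f z * w + l / 2%:R * (w - z) ^+ 2)) => [w _|w _] //.
    have h2' : is_cderiv (fun w : cplx R => (w - z) ^+ 2) w (2%:R * (w - z)).
      have dz := is_cderivB (is_cderiv_id w) (is_cderiv_cst z w).
      have -> : 2%:R * (w - z) = (1 - 0) * (w - z) + (w - z) * (1 - 0) :> cplx R by ring.
      exact: (is_cderivM dz dz).
    have := is_cderivD (is_cderivZ (f z) (is_cderiv_id w)) (is_cderivZ (l / 2%:R) h2').
    have n2 : (2%:R : cplx R) != 0.
      by rewrite natrc rc_eq0 pnatr_eq0.
    by rewrite mulr1 mulrA divfK.
  have ez w : rect x (x + p / 2 ^+ n) y (y + q / 2 ^+ n) w -> cmod (w - z) <= (p + q) / 2 ^+ n.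
    move=> /andP[a1 a2]; apply: le_trans (cmod_le_sum _) _; rewrite mulrDl cplxD1 cplxD2 cplxN1 cplxN2 /=.
    have b1 := hX n; have b2 := hY n.
    by apply: lerD; rewrite ler_norml; move: a1 a2 b1 b2; rewrite -/x -/y; lra.
  (* Both the distance to [z] and the sum of the sides are of order [2 ^- n]; their product cancels
     the lower bound [c / 4 ^+ n]. *)
  have := @rint_bound x (x + p / 2 ^+ n) y (y + q / 2 ^+ n) (fun w => f w - L w) xs ys _ (e * ((p + q) / 2 ^+ n)).
  rewrite rintB // rL subr0 => hb.
  have {}hb : cmod (rint f x (x + p / 2 ^+ n) y (y + q / 2 ^+ n)) <= 4 * (e * ((p + q) / 2 ^+ n)) * ((p + q) / 2 ^+ n).
    have E : (x + p / 2 ^+ n - x) + (y + q / 2 ^+ n - y) = (p + q) / 2 ^+ n.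
      have E0 (a b u t : R) : (a + u - a) + (b + t - b) = u + t by ring.
      by rewrite E0 -mulrDl.
    rewrite E in hb; apply: hb => w hw; first by apply: ccontptB; [exact: fcn|exact: cL].
    have -> : f w - L w = f w - f z - l * (w - z) by rewrite /L; ring.
    apply: le_trans (hd _ (le_lt_trans (ez w hw) hn)) _.
    by rewrite ler_wpM2l ?ez // ltW.
  have := le_trans h5 hb; rewrite ler_pdivrMr ?exprn_gt0 // => hc.
  apply: le_trans hc _; clear -c; move: (p + q) => k; rewrite le_eqVlt; apply/orP; left; apply/eqP.
  have -> : 4 ^+ n = (2 ^+ n) ^+ 2 :> R by rewrite exprAC -[2 ^+ 2]natrX.
  by field; rewrite expf_neq0.
have K0 : 0 <= 4 * (p + q) ^+ 2 by rewrite mulr_ge0 // sqr_ge0.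
have {}main (e : R) : 0 < e -> c <= e * (4 * (p + q) ^+ 2).
  by move=> /main; rewrite (mulrC 4 e) -mulrA.
move: K0 main; set k := 4 * _ ^+ 2 => K0 main.
have K1 : 0 < k + 1 by rewrite ltr_wpDl.
have h : 0 < c / (k + 1) by rewrite divr_gt0.
by have := main _ h; rewrite mulrAC ler_pdivlMr // mulrDr mulr1; lra.
Qed.

End Goursat.

(** * Primitives on the disk *)

Section Primitive.
Variable R : realType.
Implicit Types (f F P : cplx R -> cplx R) (z w : cplx R).

Definition between (a b t : R) := Num.min a b <= t <= Num.max a b.

Lemma between_norm a b t : between a b t -> `|t| <= Num.max `|a| `|b|.
Proof.
rewrite /between ge_min le_max => /andP[/orP h1 /orP h2]; rewrite le_max.
by rewrite !ler_norml; case: h1; case: h2 => h1 h2;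
  have := ler_norm a; have := ler_norm b; have := ler_norm (- a); have := ler_norm (- b);
  rewrite !normrN => k1 k2 k3 k4; case: (leP `|a| `|b|) => h; apply/orP;
  solve [by left; apply/andP; split; lra|by right; apply/andP; split; lra].
Qed.

Lemma between_dist a b t : between a b t -> `|t - a| <= `|b - a|.
Proof.
rewrite /between; have [ab|ab] := leP a b => /andP[h1 h2].
  by rewrite ger0_norm ?ger0_norm //; lra.
by rewrite ler0_norm ?ltr0_norm //; lra.
Qed.

Lemma cmod_mono z w : `|z.1| <= `|w.1| -> `|z.2| <= `|w.2| -> cmod z <= cmod w.
Proof.
move=> h1 h2; rewrite ler_sqrt ?addr_ge0 ?sqr_ge0 //.
have sq (x y : R) : `|x| <= `|y| -> x ^+ 2 <= y ^+ 2.
  by move=> h; rewrite -(real_normK (num_real x)) -(real_normK (num_real y)) ler_pXn2r ?nnegrE.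
by apply: lerD; apply: sq.
Qed.

Lemma cint_cst a b (c : cplx R) : cint a b (fun=> c) = rc (b - a) * c.
Proof.
wlog ab : a b / a <= b.
  move=> H; have [/H//|/ltW /H h] := leP a b; rewrite cint_anti h.
  by rewrite -mulNr -rcN opprB.
have := @cint_FTC _ a b (fun t => rc t * c) (fun=> c) ab; rewrite rcB mulrBl; apply.
  move=> t _ e e0; exists 1 => // s _; rewrite rcB.
  have -> : rc s * c - rc t * c - (rc s - rc t) * c = 0 by ring.
  by rewrite cmod0 mulr_ge0 // ltW.
exact: ccont_cst.
Qed.

Lemma cint_close a b (g : R -> cplx R) (c : cplx R) M :
  ccont (Num.min a b) (Num.max a b) g -> (forall t, between a b t -> cmod (g t - c) <= M) ->
  cmod (cint a b g - rc (b - a) * c) <= 2 * M * `|b - a|.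
Proof.
wlog ab : a b / a <= b.
  move=> H; case/orP: (le_total a b) => [/H//|ba hg hM].
  have := H b a ba; rewrite minC maxC => /(_ hg) h; rewrite cint_anti distrC -[rc (b - a)]opprK -rcN opprB mulNr -opprD cmodN.
  by apply: h => t; rewrite /between minC maxC; apply: hM.
rewrite /between min_l // max_r // => hg hM; rewrite -cint_cst -cintB //; last exact: ccont_cst.
rewrite ger0_norm ?subr_ge0 //; apply: cint_bound => //.
by apply: ccontB => //; exact: ccont_cst.
Qed.

Lemma goursat_or f x0 x1 y0 y1 :
  (forall z, between x0 x1 z.1 -> between y0 y1 z.2 -> exists l, is_cderiv f z l) ->
  rint f x0 x1 y0 y1 = 0.
Proof.
wlog x01 : x0 x1 / x0 <= x1.
  move=> H; have [/H//|/ltW xx hf] := leP x0 x1.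
  have : rint f x1 x0 y0 y1 = 0 by apply: H => // z; rewrite /between minC maxC; apply: hf.
  rewrite /rint (cint_anti x1 x0) [X in _ - X - _](cint_anti x1 x0) => h.
  by apply: oppr_inj; rewrite oppr0 -[RHS]h; ring.
wlog y01 : y0 y1 / y0 <= y1.
  move=> H; have [/H//|/ltW xx hf] := leP y0 y1.
  have : rint f x0 x1 y1 y0 = 0 by apply: H => // z h; rewrite /between minC maxC; apply: hf.
  rewrite /rint !(cint_anti y1 y0) => h.
  by apply: oppr_inj; rewrite oppr0 -[RHS]h; ring.
move=> hf; apply: goursat => // z /andP[z1 z2]; apply: hf; rewrite /between min_l ?max_r //.
Qed.

(** Differentiability uniform on the closed disc, the form needed to differentiate under the
    integral in [homot_int_diff]. *)
Definition udiff (r : R) F f := forall e : R, 0 < e -> exists2 d : R, 0 < d &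
  forall z w, cmod z <= r -> cmod w <= r -> cmod (w - z) < d ->
  cmod (F w - F z - f z * (w - z)) <= e * cmod (w - z).

Lemma udiff_is_cderiv (r : R) F f z : cmod z < r -> udiff r F f -> is_cderiv F z (f z).
Proof.
move=> zr h; apply/is_cderivP => e /h[d d0 hd].
exists (Num.min d (r - cmod z)); first by rewrite lt_min d0 subr_gt0.
move=> w; rewrite lt_min => /andP[w1 w2]; apply: hd => //; first exact: ltW.
by have := ler_cmodD z (w - z); rewrite addrC subrK; lra.
Qed.

Lemma analytic_cont f z : analytic_on_disk f -> cmod z < 1 -> ccontpt f z.
Proof. by move=> hf /hf[l]; apply: is_cderiv_cont. Qed.

(** [P] integrates along the real axis and then vertically. Goursat on the rectangle with abscissas
    [z.1], [w.1] and ordinates [0], [w.2] turns [P w - P z] into an integral over the two short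
    sides from [z] to [w], where [f] is nearly [f z]. A single [P] serves all radii. *)
Lemma primitive f : analytic_on_disk f -> exists P, forall r : R, r < 1 -> udiff r P f.
Proof.
move=> hf.
have fc z : cmod z < 1 -> ccontpt f z by apply: analytic_cont.
pose P z := cint 0 z.1 (fun t => f (t, 0)) + ci R * cint 0 z.2 (fun t => f (z.1, t)).
exists P => r r1 e e0.
have e8 : 0 < e / 8 by rewrite divr_gt0.
have [d' d'0 hd'] := unif_cont (fun z (zr : cmod z <= r) => fc z (le_lt_trans zr r1)) e8.
exists (Num.min d' (1 - r)); first by rewrite lt_min d'0 subr_gt0.
move=> z w zr wr; rewrite lt_min => /andP[wd wr'].
have near u : cmod (u - z) <= cmod (w - z) -> cmod u < 1 /\ cmod (f u - f z) <= e / 8.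
  move=> uz; split; first by have := ler_cmodD z (u - z); rewrite addrC subrK; lra.
  by apply: ltW; apply: hd' => //; apply: le_lt_trans wd.
have rec u : between z.1 w.1 u.1 -> between z.2 w.2 u.2 -> cmod (u - z) <= cmod (w - z).
  by move=> h1 h2; apply: cmod_mono; [exact: between_dist|exact: between_dist].
have bl (a b : R) : between a b a by rewrite /between ge_min le_max lexx.
have br (a b : R) : between a b b by rewrite /between ge_min le_max lexx !orbT.
(* The corner of the path may have larger modulus than both [z] and [w]; it stays in the disk
   because [cmod (w - z) < 1 - r]. *)
have [c1 _] : cmod ((z.1, w.2) : cplx R) < 1 /\ _ := near (z.1, w.2) (rec (z.1, w.2) (bl _ _) (br _ _)).
have w1 : cmod w < 1 by apply: le_lt_trans r1.
have z1 : cmod z < 1 by apply: le_lt_trans r1.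
have H1 : cint 0 z.1 (fun t => f (t, 0)) + cint z.1 w.1 (fun t => f (t, 0)) = cint 0 w.1 (fun t => f (t, 0)).
  apply: (@cint_cat _ (- r) r).
  - apply: ccont_h => t tr; apply: fc; apply: le_lt_trans (cmod_le_sum _) _.
    by rewrite /= normr0 addr0; apply: le_lt_trans r1; rewrite ler_norml.
  - by rewrite lerNl oppr0 andbb; apply: le_trans zr; exact: cmod_ge0.
  - by rewrite -ler_norml; apply: le_trans zr; exact: re_le_cmod.
  - by rewrite -ler_norml; apply: le_trans wr; exact: re_le_cmod.
have H2 : cint 0 z.2 (fun t => f (z.1, t)) + cint z.2 w.2 (fun t => f (z.1, t)) = cint 0 w.2 (fun t => f (z.1, t)).
  pose h := Num.max `|z.2| `|w.2|.
  apply: (@cint_cat _ (- h) h).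
  - apply: ccont_v => t; rewrite -ler_norml /h le_max => /orP[th|th]; apply: fc.
      by apply: le_lt_trans z1; apply: cmod_mono.
    by apply: le_lt_trans c1; apply: cmod_mono.
  - by rewrite lerNl oppr0 andbb /h le_max normr_ge0.
  - by rewrite -ler_norml /h le_max lexx.
  - by rewrite -ler_norml /h le_max lexx orbT.
have H3 : rint f z.1 w.1 0 w.2 = 0.
  apply: goursat_or => u /between_norm; rewrite le_max => h1 /between_norm; rewrite normr0 le_max => h2.
  have {}h2 : `|u.2| <= `|w.2|.
    by case/orP: h2 => // h2; apply: le_trans h2 _.
  apply: hf; case/orP: h1 => h1.
    by apply: le_lt_trans c1; apply: cmod_mono.
  by apply: le_lt_trans w1; apply: cmod_mono.
have E : P w - P z = cint z.1 w.1 (fun t => f (t, w.2)) + ci R * cint z.2 w.2 (fun t => f (z.1, t)).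
  rewrite /P -H1; apply/eqP; rewrite -subr_eq0 -[X in _ == X]H3 /rint -H2; apply/eqP; ring.
have wzE : w - z = rc (w.1 - z.1) + ci R * rc (w.2 - z.2).
  by apply: cplx_eq; rewrite ?cplxD1 ?cplxD2 ?cplxN1 ?cplxN2 ?cplxM1 ?cplxM2 /=; ring.
have K1 : cmod (cint z.1 w.1 (fun t => f (t, w.2)) - rc (w.1 - z.1) * f z) <= 2 * (e / 8) * `|w.1 - z.1|.
  apply: cint_close.
    by apply: ccont_h => t ht; apply: fc; apply: (near (t, w.2) _).1; apply: rec.
  by move=> t ht; apply: (near (t, w.2) _).2; apply: rec.
have K2 : cmod (cint z.2 w.2 (fun t => f (z.1, t)) - rc (w.2 - z.2) * f z) <= 2 * (e / 8) * `|w.2 - z.2|.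
  apply: cint_close.
    by apply: ccont_v => t ht; apply: fc; apply: (near (z.1, t) _).1; apply: rec.
  by move=> t ht; apply: (near (z.1, t) _).2; apply: rec.
rewrite E {1}wzE.
have -> : cint z.1 w.1 (fun t => f (t, w.2)) + ci R * cint z.2 w.2 (fun t => f (z.1, t)) -
    f z * (rc (w.1 - z.1) + ci R * rc (w.2 - z.2)) =
    (cint z.1 w.1 (fun t => f (t, w.2)) - rc (w.1 - z.1) * f z)
    + ci R * (cint z.2 w.2 (fun t => f (z.1, t)) - rc (w.2 - z.2) * f z) by ring.
apply: le_trans (ler_cmodD _ _) _; rewrite cmodM cmod_ci mul1r.
apply: le_trans (lerD K1 K2) _.
have L1 := re_le_cmod (w - z); have L2 := im_le_cmod (w - z).
rewrite cplxD1 cplxN1 in L1; rewrite cplxD2 cplxN2 in L2.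
have := ler_wpM2l (ltW e8) L1; have := ler_wpM2l (ltW e8) L2.
have := mulr_ge0 (ltW e8) (cmod_ge0 (w - z)); lra.
Qed.

End Primitive.

(** * Cauchy's formula by contracting a closed path *)

Section Homotopy.
Variable R : realType.
Implicit Types (f F : cplx R -> cplx R) (z : cplx R).

(** With [N] steps each increment is at most [e / N], so the total is at most [e]. Uniformity in the
    hypothesis replaces a mean value theorem. *)
Lemma flat_const (Phi : R -> cplx R) :
  (forall e : R, 0 < e -> exists2 d : R, 0 < d & forall s t : R, 0 <= s <= 1 -> 0 <= t <= 1 ->
     `|s - t| < d -> cmod (Phi s - Phi t) <= e * `|s - t|) -> Phi 1 = Phi 0.
Proof.
move=> H; apply/eqP; rewrite -subr_eq0 -cmod_eq0; apply/eqP/le_anti.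
rewrite cmod_ge0 andbT; apply/ler_addgt0Pr => e e0; rewrite add0r.
have [d d0 hd] := H e e0.
pose N := (Num.trunc d^-1).+1.
have N0 : 0 < N%:R :> R by rewrite ltr0n.
have Nd : N%:R^-1 < d.
  by rewrite -[d]invrK ltf_pV2 ?posrE ?invr_gt0 //; apply: truncnS_gt.
have {1}-> : (1 : R) = N%:R / N%:R by rewrite divff ?gt_eqF.
have {1}-> : (0 : R) = 0%:R / N%:R by rewrite mul0r.
rewrite -(@telescope_sumr _ 0 N (fun k => Phi (k%:R / N%:R))) //.
apply: le_trans (cmod_sum _ _ _) _.
have -> : e = \sum_(0 <= k < N) e / N%:R.
  by rewrite sumr_const_nat subn0 -[RHS]mulr_natr divfK // gt_eqF.
rewrite !big_mkord; apply: ler_sum => k _.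
have kN : (k < N)%N by [].
have dk : k.+1%:R / N%:R - k%:R / N%:R = N%:R^-1 :> R.
  by rewrite -mulrBl -natrB ?subSnn ?mul1r // leqW.
have := hd (k.+1%:R / N%:R) (k%:R / N%:R); rewrite dk ger0_norm ?invr_ge0 ?ler0n //.
by apply => //; rewrite divr_ge0 ?ler0n //= ler_pdivrMr // mul1r ler_nat // ltnW.
Qed.

Section Path.
Variables (r a b M : R) (F f : cplx R -> cplx R) (z : cplx R) (w dw : R -> cplx R).
Hypotheses (ab : a <= b) (r1 : r < 1) (Ff : udiff r F f).
Hypothesis dF : forall u : cplx R, cmod u < 1 -> is_cderiv F u (f u).
Hypothesis fc : forall u : cplx R, cmod u < 1 -> ccontpt f u.
Hypotheses (zr : cmod z <= r) (wr : forall t, a <= t <= b -> cmod (w t) <= r).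
Hypotheses (wz : forall t, a <= t <= b -> w t != z).
Hypotheses (wd : forall t, a <= t <= b -> rderiv w t (dw t)) (dwc : ccont a b dw).
Hypothesis (dwM : forall t, a <= t <= b -> cmod (dw t) <= M).

Let p (t : R) (x : R) : cplx R := z + rc t * (w x - z).

Let wc : ccont a b w. Proof. exact: rderiv_ccont wd. Qed.

Let r0 : 0 <= r. Proof. by apply: le_trans zr; exact: cmod_ge0. Qed.

Let M0 : 0 <= M. Proof. by apply: le_trans (dwM (_ : a <= a <= b)); rewrite ?cmod_ge0 // lexx. Qed.

Let pr (t x : R) : 0 <= t <= 1 -> a <= x <= b -> cmod (p t x) <= r.
Proof.
move=> /andP[t0 t1] xab; have -> : p t x = rc (1 - t) * z + rc t * w x by rewrite /p rcB (_ : rc 1 = 1) //; ring.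
apply: le_trans (ler_cmodD _ _) _; rewrite !cmodM !cmod_rc !ger0_norm ?subr_ge0 //.
apply: le_trans (lerD (ler_wpM2l _ zr) (ler_wpM2l t0 (wr xab))) _; first by rewrite subr_ge0.
by rewrite -mulrDl subrK mul1r.
Qed.

Let pc t : ccont a b (p t).
Proof.
apply: ccontD; first exact: ccont_cst.
by apply: ccontM; [exact: ccont_cst|apply: ccontB => //; exact: ccont_cst].
Qed.

Let kc : ccont a b (fun x => dw x / (w x - z)).
Proof.
apply: ccontM => //; apply: ccontV => [x xab|]; first by rewrite subr_eq0; exact: wz.
by apply: ccontB => //; exact: ccont_cst.
Qed.

Let Fpc (t : R) : 0 <= t <= 1 -> ccont a b (fun x => F (p t x)).
Proof.
move=> t01; apply: ccont_comp => [x xab|]; last exact: pc.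
by apply: is_cderiv_cont (dF _); apply: le_lt_trans r1; apply: pr.
Qed.

Let fpc (t : R) : 0 <= t <= 1 -> ccont a b (fun x => f (p t x)).
Proof.
move=> t01; apply: ccont_comp => [x xab|]; last exact: pc.
by apply: fc; apply: le_lt_trans r1; apply: pr.
Qed.

(* Contracting the path [w] to [z]: the derivative of [homot_int] is an exact integral,
   so [homot_int 1 = homot_int 0] on a closed path, which is Cauchy's formula. *)
Definition homot_int t := cint a b (fun x => F (z + rc t * (w x - z)) * (dw x / (w x - z))).

Definition homot_diff t := cint a b (fun x => f (z + rc t * (w x - z)) * dw x).

(** The derivative in [t] of the argument of [F] is [w x - z], which cancels the singular
    denominator and leaves the integrand of [homot_diff]. *)
Lemma homot_int_diff (e : R) : 0 < e -> exists2 d : R, 0 < d & forall s t : R, 0 <= s <= 1 -> 0 <= t <= 1 ->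
     `|s - t| < d -> cmod (homot_int s - homot_int t - rc (s - t) * homot_diff t) <= e * `|s - t|.
Proof.
move=> e0; pose K := 2 * (M + 1) * (b - a + 1).
have K0 : 0 < K by rewrite !mulr_gt0 // ltr_wpDl // subr_ge0.
have [d1 d10 hd1] := Ff (divr_gt0 e0 K0).
exists (d1 / (2 * r + 1)); first by rewrite divr_gt0 // ltr_wpDl // mulr_ge0.
move=> s t s01 t01; rewrite ltr_pdivlMr; last by rewrite ltr_wpDl // mulr_ge0.
move=> st; rewrite /homot_int /homot_diff -cintB //; [|by apply: ccontM; [exact: Fpc|]..].
have fdc : ccont a b (fun x => f (z + rc t * (w x - z)) * dw x) by apply: ccontM => //; exact: fpc.
rewrite -cintZ // -cintB //; first last.
- by apply: ccontM => //; exact: ccont_cst.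
- by apply: ccontB; apply: ccontM => //; exact: Fpc.
apply: le_trans (@cint_bound _ a b _ (e / K * `|s - t| * M) ab _ _) _.
- apply: ccontB; last by apply: ccontM => //; exact: ccont_cst.
  by apply: ccontB; apply: ccontM => //; exact: Fpc.
- move=> x xab; have nz : w x - z != 0 by rewrite subr_eq0 wz.
  have dp : p s x - p t x = rc (s - t) * (w x - z) by rewrite /p rcB; ring.
  have -> : F (z + rc s * (w x - z)) * (dw x / (w x - z)) - F (z + rc t * (w x - z)) * (dw x / (w x - z)) -
     rc (s - t) * (f (z + rc t * (w x - z)) * dw x) =
     (F (p s x) - F (p t x) - f (p t x) * (p s x - p t x)) / (w x - z) * dw x.
    by rewrite dp /p; field.
  rewrite cmodM cmod_div; apply: ler_pM; rewrite ?divr_ge0 ?cmod_ge0 ?dwM //.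
  rewrite ler_pdivrMr ?cmod_gt0 //.
  apply: le_trans (hd1 _ _ _ _ _) _; rewrite ?pr //; last by rewrite dp cmodM cmod_rc mulrA.
  rewrite dp cmodM cmod_rc; apply: le_lt_trans st; rewrite ler_wpM2l //.
  by have := ler_cmodB' (w x) z; have := wr xab; have := zr; lra.
have -> : 2 * (e / K * `|s - t| * M) * (b - a) = (e * `|s - t|) * (2 * M * (b - a) / K) by field; rewrite gt_eqF.
rewrite -[leRHS]mulr1 ler_wpM2l ?mulr_ge0 ?(ltW e0) // ler_pdivrMr // mul1r /K.
by apply: ler_pM; rewrite ?mulr_ge0 ?subr_ge0 // ?ler_wpM2l // lerDl.
Qed.

(** After multiplication by [t] the integrand is the derivative in [x] of [F] along the contracted
    path. On a closed path this settles [t != 0]; [homot_diff0] covers [t = 0]. *)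
Lemma homot_diff_FTC (t : R) : 0 <= t <= 1 ->
  rc t * homot_diff t = F (z + rc t * (w b - z)) - F (z + rc t * (w a - z)).
Proof.
move=> t01; have fdc : ccont a b (fun x => f (z + rc t * (w x - z)) * dw x) by apply: ccontM => //; exact: fpc.
rewrite /homot_diff -cintZ //; apply: (@cint_FTC _ _ _ (fun x => F (z + rc t * (w x - z)))) => //; last first.
  by apply: ccontM => //; exact: ccont_cst.
move=> x xab; have -> : rc t * (f (z + rc t * (w x - z)) * dw x) = f (p t x) * (rc t * dw x).
  by rewrite /p; ring.
apply: (@rderiv_comp _ F (p t)); last by apply: dF; apply: le_lt_trans r1; apply: pr.
apply: (@rderiv_comp _ (fun u => z + rc t * (u - z)) w); first exact: wd.
have := is_cderivD (is_cderiv_cst z (w x)) (is_cderivZ (rc t) (is_cderivB (is_cderiv_id (w x)) (is_cderiv_cst z (w x)))).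
by rewrite subr0 mulr1 add0r.
Qed.

Lemma homot_diff0 : homot_diff 0 = f z * (w b - w a).
Proof.
rewrite /homot_diff; have -> : cint a b (fun x => f (z + rc 0 * (w x - z)) * dw x) = cint a b (fun x => f z * dw x).
  by apply: cint_ext => // x _; rewrite (_ : rc 0 = 0) // mul0r addr0.
by rewrite cintZ //; congr (_ * _); apply: cint_FTC.
Qed.

Lemma homot_int0 : homot_int 0 = F z * cint a b (fun x => dw x / (w x - z)).
Proof.
rewrite -cintZ //; apply: cint_ext => // x _.
by rewrite (_ : rc 0 = 0) // mul0r addr0.
Qed.

Lemma homot_int1 : homot_int 1 = cint a b (fun x => F (w x) * (dw x / (w x - z))).
Proof.
by apply: cint_ext => // x _; rewrite (_ : rc 1 = 1) // mul1r addrC subrK.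
Qed.

Lemma closed_path_cauchy : w a = w b ->
  cint a b (fun x => F (w x) * (dw x / (w x - z))) = F z * cint a b (fun x => dw x / (w x - z)).
Proof.
move=> cl; rewrite -homot_int0 -homot_int1; apply: flat_const => e /homot_int_diff[d d0 hd].
exists d => // s t s01 t01 /(hd _ _ s01 t01).
have -> : homot_diff t = 0; last by rewrite mulr0 subr0.
have [->|t0] := eqVneq t 0; first by rewrite homot_diff0 cl subrr mulr0.
have rt0 : rc t != 0 by rewrite rc_eq0.
by apply: (mulfI rt0); rewrite homot_diff_FTC // cl subrr mulr0.
Qed.

End Path.
End Homotopy.

(** * Circles and their index *)

Section Circle.
Variable R : realType.
Implicit Types (f F : cplx R -> cplx R) (z : cplx R).

Definition circ (r t : R) : cplx R := (r * cos t, r * sin t).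

Lemma cmod_circ r t : 0 <= r -> cmod (circ r t) = r.
Proof.
move=> r0; rewrite /cmod /= !exprMn -mulrDr cos2Dsin2 mulr1 sqrtr_sqr ger0_norm //.
Qed.

Lemma rderiv_circ r t : rderiv (circ r) t (ci R * circ r t).
Proof.
apply: rderiv_pair; rewrite ?cplxM1 ?cplxM2 /= !mul0r !mul1r ?add0r ?addr0; apply: is_derive_rdif.
  have -> : - (r * sin t) = r *: - sin t by rewrite /GRing.scale /= mulrN.
  exact: is_deriveZ.
Qed.

Lemma circ_ccont r a b : ccont a b (circ r).
Proof. by apply: (@rderiv_ccont _ _ _ _ (fun t => ci R * circ r t)) => t _; exact: rderiv_circ. Qed.

Lemma circ_closed r : circ r 0 = circ r (2 * pi).
Proof. by rewrite /circ cos0 sin0 mulr_natl cos2pi sin2pi. Qed.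

Lemma circ_neq0 r t : 0 < r -> circ r t != 0.
Proof. by move=> r0; rewrite -cmod_gt0 cmod_circ // ltW. Qed.

Lemma circ_neq r t z : cmod z < r -> circ r t - z != 0.
Proof.
move=> zr; rewrite subr_eq0; apply: contraTneq zr => <-; rewrite -leNgt.
have [r0|/ltW r0] := leP 0 r; first by rewrite cmod_circ.
exact: le_trans r0 (cmod_ge0 _).
Qed.

Lemma pi2_ge0 : 0 <= 2 * pi :> R. Proof. by rewrite mulr_ge0 // pi_ge0. Qed.

Lemma kgeo_udiff (r : R) : 0 <= r < 1 -> udiff r (fun u : cplx R => (1 - u)^-1) (fun u => (1 - u) ^- 2).
Proof.
move=> /andP[r0 r1] e e0; have r3 : 0 < (1 - r) ^+ 3 by rewrite exprn_gt0 // subr_gt0.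
exists (e * (1 - r) ^+ 3); first by rewrite mulr_gt0.
have nz (u : cplx R) : cmod u <= r -> 1 - r <= cmod (1 - u : cplx R).
  by move=> ur; have := ler_cmodB 1 u; rewrite cmod1; lra.
move=> z w /nz zr /nz wr wz.
have z0 : 1 - z != 0 by rewrite -cmod_gt0; apply: lt_le_trans zr; rewrite subr_gt0.
have w0 : 1 - w != 0 by rewrite -cmod_gt0; apply: lt_le_trans wr; rewrite subr_gt0.
have -> : (1 - w)^-1 - (1 - z)^-1 - (1 - z) ^- 2 * (w - z) = (w - z) ^+ 2 / ((1 - z) ^+ 2 * (1 - w)).
  by field; rewrite ?z0 ?w0.
rewrite cmod_div (cmodM ((1 - z) ^+ 2)) !cmodX expr2 -mulrA mulrC ler_wpM2r ?cmod_ge0 //.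
rewrite ler_pdivrMr ?mulr_gt0 ?exprn_gt0 ?cmod_gt0 //; apply: le_trans (ltW wz) _.
rewrite ler_wpM2l ?(ltW e0) // exprSr; apply: ler_pM; rewrite ?exprn_ge0 ?subr_ge0 ?(ltW r1) //.
by rewrite ler_pXn2r // nnegrE ?cmod_ge0 // subr_ge0 ltW.
Qed.

Lemma kgeo_deriv z : 1 - z != 0 -> is_cderiv (fun u : cplx R => (1 - u)^-1) z ((1 - z) ^- 2).
Proof.
move=> z0; have := is_cderivB (is_cderiv_cst (1 : cplx R) z) (is_cderiv_id z).
move=> /(@is_cderiv_inv _ (fun u => 1 - u) _ _ z0).
by rewrite sub0r mulrN1 opprK.
Qed.

(** With [v = z / circ r t] the integrand is [1 / (1 - v)], and [v] runs on a circle about 0 with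
    constant logarithmic derivative [- ci R]. Contracting that circle to 0 replaces [1 / (1 - v)] by
    its value 1. *)
Lemma circ_index r z : cmod z < r ->
  cint 0 (2 * pi) (fun t => circ r t / (circ r t - z)) = rc (2 * pi).
Proof.
move=> zr; have r0 : 0 < r by apply: le_lt_trans zr; exact: cmod_ge0.
have [->|z0] := eqVneq z 0.
  have := cint_cst 0 (2 * pi) (1 : cplx R); rewrite subr0 mulr1 => <-.
  apply: cint_ext => [|t _]; first exact: pi2_ge0.
  by rewrite subr0 divff // circ_neq0.
pose v t := z / circ r t.
have cv t : cmod (v t) = cmod z / r by rewrite cmod_div cmod_circ // ltW.
have vr1 : cmod z / r < 1 by rewrite ltr_pdivrMr // mul1r.
have dv t : rderiv v t (- ci R * v t).
  have := rderiv_comp (rderiv_circ r t) (is_cderivZ z (is_cderivV (circ_neq0 t r0))).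
  have -> : z * (- circ r t ^- 2) * (ci R * circ r t) = - ci R * v t.
    by rewrite /v; field; rewrite circ_neq0.
  by [].
have vc : ccont 0 (2 * pi) v by apply: (@rderiv_ccont _ _ _ _ (fun t => - ci R * v t)).
have D (u : cplx R) : cmod u < 1 -> 1 - u != 0.
  by move=> u1; rewrite subr_eq0; apply: contraTneq u1 => <-; rewrite cmod1 ltxx.
have v0 t : v t != 0 by rewrite mulf_neq0 // invr_neq0 // circ_neq0.
have nci : - ci R != 0 by rewrite oppr_eq0 -cmod_gt0 cmod_ci.
have := @closed_path_cauchy R (cmod z / r) 0 (2 * pi) (cmod z / r) (fun u => (1 - u)^-1) (fun u => (1 - u) ^- 2) 0 v
  (fun t => - ci R * v t) pi2_ge0 vr1 => H.
have {}H : cint 0 (2 * pi) (fun t => (1 - v t)^-1 * (- ci R * v t / (v t - 0))) =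
    (1 - 0)^-1 * cint 0 (2 * pi) (fun t => - ci R * v t / (v t - 0)).
  apply: H.
  - by apply: kgeo_udiff; rewrite vr1 divr_ge0 ?cmod_ge0 // ltW.
  - by move=> u /D; exact: kgeo_deriv.
  - move=> u /D u0; have := is_cderivM (kgeo_deriv u0) (kgeo_deriv u0) => /is_cderiv_cont.
    by move=> h e /h[d d0 hd]; exists d => // w /hd; rewrite -!expr2 -!exprVn.
  - by rewrite cmod0 divr_ge0 ?cmod_ge0 // ltW.
  - by move=> t _; rewrite cv.
  - by move=> t _.
  - by move=> t _; exact: dv.
  - by apply: ccontM => //; exact: ccont_cst.
  - by move=> t _; rewrite cmodM cmodN cmod_ci mul1r cv.
  - by rewrite /v -circ_closed.
move: H; rewrite subr0 invr1 mul1r.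
have -> : cint 0 (2 * pi) (fun t => - ci R * v t / (v t - 0)) = cint 0 (2 * pi) (fun=> - ci R).
  by apply: cint_ext; [exact: pi2_ge0|move=> t _; rewrite subr0 mulfK].
rewrite cint_cst subr0 => H; apply: (mulfI nci); rewrite [RHS]mulrC -H -cintZ ?pi2_ge0 //; last first.
  apply: ccontM; first exact: circ_ccont.
  apply: ccontV => [t _|]; first exact: circ_neq.
  by apply: ccontB; [exact: circ_ccont|exact: ccont_cst].
apply: cint_ext; first exact: pi2_ge0.
move=> t _; have c0 := circ_neq0 t r0; have c1 := circ_neq t zr.
rewrite subr0 mulfK // mulrC; congr (_ * _); rewrite /v.
by field; rewrite ?c0 ?c1.
Qed.

End Circle.

(** * Cauchy's formula, smoothness and derivative estimates *)

Section CauchyFormula.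
Variable R : realType.
Implicit Types (f F : cplx R -> cplx R) (z u h : cplx R).

Lemma ccont_bounded (a b : R) (f : R -> cplx R) : a <= b -> ccont a b f ->
  exists2 M : R, 0 <= M & forall t, a <= t <= b -> cmod (f t) <= M.
Proof.
move=> ab /ccont_cmod/ccont_within1 h.
have [c _ hc] := EVT_max ab h; exists (cmod (f c)); first exact: cmod_ge0.
by move=> t tab; apply: hc; rewrite in_itv.
Qed.

Section Formula.
Variables (r : R) (F f : cplx R -> cplx R) (z : cplx R).
Hypotheses (r1 : r < 1) (zr : cmod z < r) (Ff : udiff r F f).
Hypothesis dF : forall u : cplx R, cmod u < 1 -> is_cderiv F u (f u).
Hypothesis fc : forall u : cplx R, cmod u < 1 -> ccontpt f u.

(** The hypotheses on the derivative [f] are available at once only for a primitive; for arbitrary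
    analytic functions they follow later from [analytic_udiff] and [analytic_cderiv]. *)
Lemma cauchy_formula0 : rc (2 * pi) * F z =
  cint 0 (2 * pi) (fun t => F (circ r t) * circ r t / (circ r t - z)).
Proof.
have r0 : 0 < r by apply: le_lt_trans zr; exact: cmod_ge0.
have cr t : cmod (circ r t) = r by rewrite cmod_circ // ltW.
have := @closed_path_cauchy R r 0 (2 * pi) r F f z (circ r) (fun t => ci R * circ r t) (pi2_ge0 R) r1 Ff dF fc => H.
have {}H : cint 0 (2 * pi) (fun t => F (circ r t) * (ci R * circ r t / (circ r t - z))) =
     F z * cint 0 (2 * pi) (fun t => ci R * circ r t / (circ r t - z)).
  apply: H.
  - exact: ltW.
  - by move=> t _; rewrite cr.
  - by move=> t _; rewrite -subr_eq0 circ_neq.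
  - by move=> t _; exact: rderiv_circ.
  - by apply: ccontM; [exact: ccont_cst|exact: circ_ccont].
  - by move=> t _; rewrite cmodM cmod_ci mul1r cr.
  - exact: circ_closed.
have kc : ccont 0 (2 * pi) (fun t => circ r t / (circ r t - z)).
  apply: ccontM; first exact: circ_ccont.
  apply: ccontV => [t _|]; first exact: circ_neq.
  by apply: ccontB; [exact: circ_ccont|exact: ccont_cst].
have Fc : ccont 0 (2 * pi) (fun t => F (circ r t)).
  apply: ccont_comp; last exact: circ_ccont.
  by move=> t _; apply: is_cderiv_cont (dF _); rewrite cr.
have nci : ci R != 0 by rewrite -cmod_gt0 cmod_ci.
apply: (mulfI nci); rewrite -cintZ ?pi2_ge0 //; last first.
  by apply: (ccont_ext _ (ccontM Fc kc)) => t _; rewrite mulrA.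
transitivity (F z * cint 0 (2 * pi) (fun t => ci R * circ r t / (circ r t - z))).
  rewrite (_ : cint _ _ _ = ci R * rc (2 * pi)); first by ring.
  rewrite -(circ_index zr) -cintZ ?pi2_ge0 //; apply: cint_ext; first exact: pi2_ge0.
  by move=> t _; rewrite mulrA.
rewrite -H; apply: cint_ext; first exact: pi2_ge0.
by move=> t _; ring.
Qed.

End Formula.

(** The exponents 1, 2, 3 belong to a primitive, to the function and to its derivative. In each case
    the remainder has an explicit factor [h ^+ 2]. *)
Lemma kernel_quad (m : nat) (eta : R) : (0 < m <= 3)%N -> 0 < eta -> exists2 C : R, 0 <= C &
  forall u h : cplx R, eta <= cmod u <= 2 -> cmod h <= eta / 2 ->
  cmod ((u - h) ^- m - u ^- m - m%:R * h * u ^- m.+1) <= C * cmod h ^+ 2.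
Proof.
move=> m03 e0; have e2 : 0 < eta / 2 by rewrite divr_gt0.
(* A crude bound for the numerators: with [cmod u <= 2] and [cmod h <= 1] the largest, for [m = 3],
   is at most 43. *)
exists (70 / (eta / 2) ^+ (m.+1 + m)); first by rewrite divr_ge0 // exprn_ge0 // ltW.
move=> u h /andP[u1 u2] h1.
have uh : eta / 2 <= cmod (u - h) by have := ler_cmodB u h; lra.
have h2 : cmod h <= 1 by lra.
have u0 : u != 0 by rewrite -cmod_gt0; apply: lt_le_trans u1.
have uh0 : u - h != 0 by rewrite -cmod_gt0; apply: lt_le_trans uh.
have [N NE Nb] : exists2 N : cplx R, (u - h) ^- m - u ^- m - m%:R * h * u ^- m.+1 =
    h ^+ 2 * (N / (u ^+ m.+1 * (u - h) ^+ m)) & cmod N <= 70.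
  case: m m03 => [//|[|[|[|//]]]] _.
  - exists 1; last by rewrite cmod1; lra.
    by field; rewrite ?u0 ?uh0.
  - exists (3%:R * u - 2%:R * h); first by field; rewrite ?u0 ?uh0.
    apply: le_trans (ler_cmodB' _ _) _; rewrite !cmodM !natrc !cmod_rc !normr_nat; lra.
  - exists (6%:R * (u * u) - 8%:R * (u * h) + 3%:R * (h * h)); first by field; rewrite ?u0 ?uh0.
    have p1 := ler_pM (cmod_ge0 _) (cmod_ge0 _) u2 u2.
    have p2 := ler_pM (cmod_ge0 _) (cmod_ge0 _) u2 h2.
    have p3 := ler_pM (cmod_ge0 _) (cmod_ge0 _) h2 h2.
    apply: le_trans (ler_cmodD _ _) _.
    apply: le_trans (lerD (ler_cmodB' _ _) (lexx _)) _.
    rewrite !(cmodM _ (_ * _)) !natrc !cmod_rc !normr_nat.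
    by rewrite (cmodM u u) (cmodM u h) (cmodM h h); lra.
rewrite NE cmodM cmodX mulrC ler_wpM2r ?exprn_ge0 ?cmod_ge0 //.
rewrite cmod_div; apply: ler_pM; rewrite ?cmod_ge0 ?invr_ge0 ?cmod_ge0 //.
rewrite lef_pV2 ?posrE ?exprn_gt0 // ?cmod_gt0 ?mulf_neq0 ?expf_neq0 //.
rewrite cmodM !cmodX exprD; apply: ler_pM; rewrite ?exprn_ge0 ?(ltW e2) //.
  by rewrite ler_pXn2r ?nnegrE ?cmod_ge0 ?(ltW e2) //; lra.
by rewrite lerXn2r ?nnegrE ?cmod_ge0 ?(ltW e2).
Qed.

Section CauchyIntegral.
Variables (r : R) (g : R -> cplx R).
Hypotheses (r0 : 0 < r) (r1 : r < 1) (gc : ccont 0 (2 * pi) g).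

Definition cauchy_int (m : nat) z := cint 0 (2 * pi) (fun t => g t / (circ r t - z) ^+ m).

Let kc m z : cmod z < r -> ccont 0 (2 * pi) (fun t => g t / (circ r t - z) ^+ m).
Proof.
move=> zr; apply: ccontM => //; apply: ccontV => [t _|]; first by rewrite expf_neq0 // circ_neq.
elim: m => [|m IH]; first exact: ccont_cst.
apply: (@ccont_ext _ _ _ (fun t => (circ r t - z) * (circ r t - z) ^+ m)) => [t _|]; first by rewrite exprS.
by apply: ccontM => //; apply: ccontB; [exact: circ_ccont|exact: ccont_cst].
Qed.

Lemma cauchy_int_quad m (s : R) : (0 < m <= 3)%N -> s < r -> exists2 C : R, 0 <= C &
  forall z h : cplx R, cmod z <= s -> cmod h <= (r - s) / 2 ->
  cmod (cauchy_int m (z + h) - cauchy_int m z - m%:R * cauchy_int m.+1 z * h) <= C * cmod h ^+ 2.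
Proof.
move=> m03 sr; have eta0 : 0 < r - s by rewrite subr_gt0.
have [C C0 hC] := kernel_quad m03 eta0.
have [G G0 hG] := ccont_bounded (pi2_ge0 R) gc.
exists (2 * (G * C) * (2 * pi)); first by rewrite !mulr_ge0 ?pi2_ge0 ?pi_ge0.
move=> z h zs hs.
have zr : cmod z < r by apply: le_lt_trans sr.
have zhr : cmod (z + h) < r by apply: le_lt_trans (ler_cmodD _ _) _; lra.
rewrite [m%:R * cauchy_int m.+1 z * h]mulrAC /cauchy_int -cintZ ?pi2_ge0 //; last exact: kc.
rewrite -cintB ?pi2_ge0 //; [|exact: kc..].
have c1 : ccont 0 (2 * pi) (fun t => m%:R * h * (g t / (circ r t - z) ^+ m.+1)).
  by apply: ccontM; [exact: ccont_cst|exact: kc].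
have c2 : ccont 0 (2 * pi) (fun t => g t / (circ r t - (z + h)) ^+ m - g t / (circ r t - z) ^+ m).
  by apply: ccontB; exact: kc.
rewrite -cintB ?pi2_ge0 //.
apply: le_trans (@cint_bound _ 0 (2 * pi) _ (G * (C * cmod h ^+ 2)) (pi2_ge0 R) _ _) _.
- exact: ccontB.
- move=> t t01.
  have -> : g t / (circ r t - (z + h)) ^+ m - g t / (circ r t - z) ^+ m - m%:R * h * (g t / (circ r t - z) ^+ m.+1)
    = g t * ((circ r t - z - h) ^- m - (circ r t - z) ^- m - m%:R * h * (circ r t - z) ^- m.+1).
    by rewrite opprD addrA; ring.
  rewrite cmodM; apply: ler_pM; rewrite ?cmod_ge0 ?hG //; apply: hC => //.
  have := ler_cmodB (circ r t) z; have := ler_cmodB' (circ r t) z; rewrite !cmod_circ ?(ltW r0) // => k1 k2.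
  apply/andP; split; first by apply: le_trans k2; rewrite lerD2l lerN2.
  apply: le_trans k1 _; apply: le_trans (lerD (ltW r1) (ltW (lt_trans zr r1))) _.
  by rewrite -[1 + 1]/2%:R.
by rewrite subr0 le_eqVlt; apply/orP; left; apply/eqP; ring.
Qed.

Lemma cauchy_int_deriv m z : (0 < m <= 3)%N -> cmod z < r ->
  is_cderiv (cauchy_int m) z (m%:R * cauchy_int m.+1 z).
Proof.
move=> m03 zr; have [C C0 hC] := cauchy_int_quad m03 zr; apply/is_cderivP => e e0.
have C1 : 0 < C + 1 by rewrite ltr_wpDl.
exists (Num.min ((r - cmod z) / 2) (e / (C + 1))); first by rewrite lt_min !divr_gt0 // subr_gt0.
move=> w; rewrite lt_min => /andP[/ltW w1 w2].
have := hC z (w - z) (lexx _) w1; rewrite (_ : z + (w - z) = w); last by rewrite addrC subrK.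
move=> h; apply: le_trans h _.
rewrite expr2 mulrA ler_wpM2r ?cmod_ge0 //; move: w2; rewrite ltr_pdivlMr // => /ltW.
by apply: le_trans; rewrite mulrC ler_wpM2l ?cmod_ge0 // lerDl.
Qed.

Lemma cauchy_int_udiff m (s : R) : (0 < m <= 3)%N -> s < r ->
  udiff s (cauchy_int m) (fun z => m%:R * cauchy_int m.+1 z).
Proof.
move=> m03 sr; have [C C0 hC] := cauchy_int_quad m03 sr => e e0.
have C1 : 0 < C + 1 by rewrite ltr_wpDl.
exists (Num.min ((r - s) / 2) (e / (C + 1))); first by rewrite lt_min !divr_gt0 // subr_gt0.
move=> z w zs _; rewrite lt_min => /andP[/ltW w1 w2].
have := hC z (w - z) zs w1; rewrite (_ : z + (w - z) = w); last by rewrite addrC subrK.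
move=> h; apply: le_trans h _.
rewrite expr2 mulrA ler_wpM2r ?cmod_ge0 //; move: w2; rewrite ltr_pdivlMr // => /ltW.
by apply: le_trans; rewrite mulrC ler_wpM2l ?cmod_ge0 // lerDl.
Qed.

End CauchyIntegral.

(** The bootstrap: the primitive [P] has a continuous derivative, so it is a Cauchy integral with
    exponent 1, and differentiating it represents [f] with exponent 2. Such integrals can be
    differentiated again. *)
Lemma analytic_cauchy_int f (r : R) : analytic_on_disk f -> 0 < r < 1 -> exists2 g,
  ccont 0 (2 * pi) g & forall z, cmod z < r -> f z = cauchy_int r g 2 z.
Proof.
move=> hf /andP[r0 r1]; have [P hP] := primitive hf.
have dP (u : cplx R) : cmod u < 1 -> is_cderiv P u (f u).
  by move=> u1; apply: (@udiff_is_cderiv _ ((cmod u + 1) / 2)) (hP _ _); lra.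
have fc (u : cplx R) : cmod u < 1 -> ccontpt f u by apply: analytic_cont.
have pi0 : rc (2 * pi) != 0 :> cplx R by rewrite rc_eq0 mulf_neq0 // ?gt_eqF ?pi_gt0.
pose g t := P (circ r t) * circ r t / rc (2 * pi).
have gc : ccont 0 (2 * pi) g.
  apply: ccontM; last exact: ccont_cst.
  apply: ccontM; last exact: circ_ccont.
  apply: ccont_comp; last exact: circ_ccont.
  by move=> t _; apply: is_cderiv_cont (dP _ _); rewrite cmod_circ // ltW.
exists g => // z zr.
have J1 u : cmod u < r -> cauchy_int r g 1 u = P u.
  move=> ur; apply: (mulfI pi0); rewrite (cauchy_formula0 r1 ur (hP r r1) dP fc).
  rewrite /cauchy_int -cintZ ?pi2_ge0 //; last first.
    apply: ccontM => //; apply: ccontV => [t _|]; first by rewrite expr1 circ_neq.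
    by apply: ccontB; [exact: circ_ccont|exact: ccont_cst].
  apply: cint_ext; first exact: pi2_ge0.
  by move=> t _; rewrite /g expr1; field; rewrite ?pi0 ?circ_neq.
apply: is_cderiv_unique (dP z (lt_trans zr r1)) _; rewrite -[cauchy_int _ _ _ _]mul1r.
have zr' : 0 < r - cmod z by rewrite subr_gt0.
apply: (is_cderiv_near zr' _ (@cauchy_int_deriv r g r0 r1 gc 1 z isT zr)) => w wz.
apply: J1; have := ler_cmodD z (w - z); rewrite addrC subrK; lra.
Qed.

Lemma analytic_is_cderiv f z : analytic_on_disk f -> disk z -> is_cderiv f z (cderiv f z).
Proof. by move=> hf /hf[l hl]; rewrite (cderivE hl). Qed.

Lemma cderiv_cauchy_int f (r : R) g z : (0 < r < 1) -> ccont 0 (2 * pi) g ->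
  (forall z, cmod z < r -> f z = cauchy_int r g 2 z) -> cmod z < r ->
  is_cderiv f z (2%:R * cauchy_int r g 3 z).
Proof.
move=> /andP[r0 r1] gc fE zr; have zr' : 0 < r - cmod z by rewrite subr_gt0.
apply: (is_cderiv_near zr' _ (@cauchy_int_deriv r g r0 r1 gc 2 z isT zr)) => w wz.
by apply/esym/fE; have := ler_cmodD z (w - z); rewrite addrC subrK; lra.
Qed.

Lemma analytic_cderiv f : analytic_on_disk f -> analytic_on_disk (cderiv f).
Proof.
move=> hf z z1; pose r := (cmod z + 1) / 2; have zr : cmod z < r by rewrite /r; move: z1; rewrite /disk /=; lra.
have r01 : 0 < r < 1.
  by apply/andP; split; [apply: le_lt_trans zr; exact: cmod_ge0|move: z1; rewrite /r /disk /=; lra].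
have [g gc fE] := analytic_cauchy_int hf r01.
have r0 := andP r01; case: r0 => r0 r1.
have zr' : 0 < r - cmod z by rewrite subr_gt0.
exists (2%:R * (3%:R * cauchy_int r g 4 z)).
apply: (is_cderiv_near zr' _ (is_cderivZ 2%:R (@cauchy_int_deriv r g r0 r1 gc 3 z isT zr))) => w wz.
apply/esym/cderivE/cderiv_cauchy_int => //.
by have := ler_cmodD z (w - z); rewrite addrC subrK; lra.
Qed.

Lemma analytic_udiff f (s : R) : analytic_on_disk f -> s < 1 -> udiff s f (cderiv f).
Proof.
(* [s] may be negative; the maximum keeps [r] positive. *)
move=> hf s1; pose r := (Num.max s 0 + 1) / 2.
have m1 : Num.max s 0 < 1 by rewrite gt_max s1 ltr01.
have sr : s < r by have := lexx (Num.max s 0); rewrite {1}ge_max /r => /andP[h _]; lra.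
have r0 : 0 < r by have := lexx (Num.max s 0); rewrite {1}ge_max /r => /andP[_ h]; lra.
have r1 : r < 1 by rewrite /r; lra.
have r01 : 0 < r < 1 by rewrite r0.
have [g gc fE] := analytic_cauchy_int hf r01.
move=> e /(@cauchy_int_udiff r g r0 r1 gc 2 s isT sr)[d d0 hd]; exists d => // z w zs ws wz.
have := hd z w zs ws wz; rewrite -!fE ?(le_lt_trans _ sr) //.
by rewrite (cderivE (cderiv_cauchy_int r01 gc fE (le_lt_trans zs sr))).
Qed.

Lemma cauchy_formula f (r : R) z : analytic_on_disk f -> r < 1 -> cmod z < r ->
  rc (2 * pi) * f z = cint 0 (2 * pi) (fun t => f (circ r t) * circ r t / (circ r t - z)).
Proof.
move=> hf r1 zr; apply: (cauchy_formula0 r1 zr (analytic_udiff hf r1)) => u u1.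
  exact: analytic_is_cderiv.
by apply: analytic_cont => //; exact: analytic_cderiv.
Qed.

Lemma analytic_circ_ccont f (r : R) : analytic_on_disk f -> 0 <= r < 1 ->
  ccont 0 (2 * pi) (fun t => f (circ r t)).
Proof.
move=> hf /andP[r0 r1]; apply: ccont_comp; last exact: circ_ccont.
by move=> t _; apply: analytic_cont; rewrite ?cmod_circ.
Qed.

Lemma cauchy_estimate0 f (r M : R) : analytic_on_disk f -> 0 < r < 1 ->
  (forall z : cplx R, cmod z = r -> cmod (f z) <= M) -> cmod (cderiv f 0) <= 2 * M / r.
Proof.
move=> hf /andP[r0 r1] hM; have pi0 : rc (2 * pi) != 0 :> cplx R by rewrite rc_eq0 mulf_neq0 // ?gt_eqF ?pi_gt0.
have cr t : cmod (circ r t) = r by rewrite cmod_circ // ltW.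
pose g t := f (circ r t) * circ r t.
have gc : ccont 0 (2 * pi) g.
  by apply: ccontM; [apply: analytic_circ_ccont => //; rewrite ltW|exact: circ_ccont].
have z0 : cmod (0 : cplx R) < r by rewrite cmod0.
have fE : is_cderiv f 0 ((rc (2 * pi))^-1 * (1%:R * cauchy_int r g 2 0)).
  apply: (is_cderiv_near r0 _ (is_cderivZ (rc (2 * pi))^-1 (@cauchy_int_deriv r g r0 r1 gc 1 0 isT z0))) => w.
  rewrite subr0 => wr; apply: (mulfI pi0); rewrite (cauchy_formula hf r1 wr) mulrA divff // mul1r.
  by apply: cint_ext => [|t _]; rewrite ?pi2_ge0 ?expr1.
rewrite (cderivE fE) mul1r cmodM cmodV cmod_rc ger0_norm ?pi2_ge0 //.
have k : 0 < 2 * pi :> R by rewrite mulr_gt0 // pi_gt0.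
rewrite mulrC ler_pdivrMr //.
apply: le_trans (@cint_bound _ 0 (2 * pi) _ (M / r) (pi2_ge0 R) _ _) _; last by rewrite subr0 (mulrA 2 M).
  apply: ccontM => //; apply: ccontV => [t _|]; first by rewrite expf_neq0 // circ_neq.
  by apply: ccontM; apply: ccontB; [exact: circ_ccont|exact: ccont_cst|exact: circ_ccont|exact: ccont_cst].
move=> t _; rewrite subr0 cmod_div cmodX cmodM cr expr2 -mulrA invfM mulrA mulrCA.
by rewrite mulfK ?gt_eqF // mulrC ler_wpM2r ?invr_ge0 ?(ltW r0) // hM.
Qed.

End CauchyFormula.

(** * Measurability in the plane *)

Section Measurability.
Variable R : realType.

(** The measurable sets are those of the product; an open set is the countable union of the rational
    rectangles it contains, the others being replaced by the empty set. *)
Lemma open_measurable2 (A : set (R * R)) : open A -> measurable A.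
Proof.
move=> oA.
pose B (q : rat * rat * (rat * rat)) : set (R * R) :=
  `](ratr q.1.1 : R), ratr q.1.2[ `*` `](ratr q.2.1 : R), ratr q.2.2[.
pose Q q := if pselect (B q `<=` A) then B q else set0.
have -> : A = \bigcup_q Q q.
  apply/seteqP; split => [[x y] Axy|z [q _]]; last first.
    by rewrite /Q; case: pselect => // h; exact: h.
  have /nbhs_ballP[e /= e0 he] : nbhs (x, y) A by exact: open_nbhs_nbhs.
  have [q1 h1] : exists q, x - e < ratr q < x.
    by have [] := @rat_in_itvoo _ (x - e) x; rewrite ?ltrBlDr ?ltrDl // => q; rewrite in_itv; exists q.
  have [q2 h2] : exists q, x < ratr q < x + e.
    by have [] := @rat_in_itvoo _ x (x + e); rewrite ?ltrDl // => q; rewrite in_itv; exists q.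
  have [q3 h3] : exists q, y - e < ratr q < y.
    by have [] := @rat_in_itvoo _ (y - e) y; rewrite ?ltrBlDr ?ltrDl // => q; rewrite in_itv; exists q.
  have [q4 h4] : exists q, y < ratr q < y + e.
    by have [] := @rat_in_itvoo _ y (y + e); rewrite ?ltrDl // => q; rewrite in_itv; exists q.
  exists ((q1, q2), (q3, q4)) => //; rewrite /Q; case: pselect => [sub|[]] /=.
    by move: h1 h2 h3 h4 => /andP[? ?] /andP[? ?] /andP[? ?] /andP[? ?]; split; rewrite /= in_itv /=; apply/andP.
  move=> [u v] [] /=; rewrite !in_itv /= => /andP[u1 u2] /andP[v1 v2]; apply: he.
  move: h1 h2 h3 h4 => /andP[? ?] /andP[? ?] /andP[? ?] /andP[? ?].
  by split; rewrite /ball /= ltr_norml; apply/andP; split; lra.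
apply: countable_bigcupT_measurable; first exact: countableP.
move=> q; rewrite /Q; case: pselect => [sub|nsub] /=; [exact: measurableX|exact: measurable0].
Qed.

Lemma closed_measurable2 (A : set (R * R)) : closed A -> measurable A.
Proof. by move=> /closed_openC/open_measurable2/measurableC; rewrite setCK. Qed.

Lemma compact_measurable2 (A : set (R * R)) : compact A -> measurable A.
Proof. by move=> /compact_closed h; apply: closed_measurable2; apply: h; exact: norm_hausdorff. Qed.

Lemma open_disk : open (@disk R).
Proof.
have -> : @disk R = (@cmod R) @^-1` [set x | x < 1] by [].
by apply: open_comp; [move=> z _; exact: cmod_continuous|exact: open_lt].
Qed.

Lemma measurable_disk : measurable (@disk R).
Proof. exact: open_measurable2 open_disk. Qed.

Lemma continuous_measurable2 (D : set (R * R)) (f : R * R -> R) : open D ->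
  (forall z, D z -> {for z, continuous f}) -> measurable_fun D f.
Proof.
move=> oD cf; apply: (measurability (@measurable_realfun.RGenOInfty.G R)) => [|/= _ [_] [r] -> <-].
  exact: measurable_realfun.RGenOInfty.measurableE.
apply: open_measurable2; rewrite openE => z [Dz fz].
have h1 : nbhs z D by exact: open_nbhs_nbhs.
have h2 : nbhs z (f @^-1` `]r, +oo[).
  apply: (cf z Dz); apply: open_nbhs_nbhs; split => //.
by rewrite /interior /=; near=> w; split; near: w.
Unshelve. all: by end_near. Qed.

Lemma ccontpt_continuous (f : cplx R -> cplx R) z : ccontpt f z ->
  {for (z : R * R), continuous (fun w : R * R => cmod (f w))}.
Proof.
move=> h; apply/cvgrPdist_lt => e /h[d d0 hd]; apply/nbhs_cmodP; exists d => // w /hd wz.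
apply: le_lt_trans wz; rewrite ler_norml; apply/andP; split.
  by rewrite lerNl opprB; apply: ler_cmodB.
by rewrite cmodBC; apply: ler_cmodB.
Qed.

Lemma analytic_cmod_measurable (f : cplx R -> cplx R) : analytic_on_disk f ->
  measurable_fun (@disk R) (fun z : R * R => cmod (f z)).
Proof.
move=> hf; apply: continuous_measurable2 open_disk _ => z z1.
by apply: ccontpt_continuous; apply: analytic_cont.
Qed.

Lemma measurable_cmod : measurable_fun setT (@cmod R : R * R -> R).
Proof. by apply: continuous_measurable2 openT _ => z _; exact: cmod_continuous. Qed.

Lemma weight_measurable (om : R -> R) : {within `[0, 1[, continuous om} ->
  measurable_fun (@disk R) (fun z : R * R => om (cmod z)).
Proof.
move=> h; have m1 : measurable_fun (`[0%R, 1[ : set R) om.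
  by apply: subspace_continuous_measurable_fun.
apply: (measurable_comp _ _ m1) => //=.
- move=> _ [z /= z1 <-]; rewrite in_itv /= cmod_ge0 //.
- exact: measurable_funS measurable_cmod.
Qed.

Lemma Dirichlet_measurable (om : R -> R) (f : cplx R -> cplx R) :
  {within `[0, 1[, continuous om} -> analytic_on_disk f ->
  measurable_fun (@disk R) (fun z : R * R => (cmod (cderiv f z) ^+ 2 * om (cmod z))%:E).
Proof.
move=> h hf; apply/measurable_EFinP; apply: measurable_funM; last exact: weight_measurable.
by apply: measurable_funX; apply: analytic_cmod_measurable; apply: analytic_cderiv.
Qed.

End Measurability.

Opaque cint homot_int homot_diff.

(** * Pointwise values from integrals over the sides of a rectangle *)

Section RectCauchy.
Variable R : realType.
Local Notation mu := (@lebesgue_measure R).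
Implicit Types (F f : cplx R -> cplx R).

Lemma cint_kernel_bound (p q s M : R) (g k : R -> cplx R) : p <= q -> ccont p q g -> ccont p q k ->
  (forall t, p <= t <= q -> cmod (k t) <= M) ->
  cmod (cint p q (fun t => g t * k t)) <= 2 * M * \int[mu]_(t in `[p, q]) cmod (g t).
Proof.
move=> pq gc kc hM; apply: le_trans (cint_le_norm pq (ccontM gc kc)) _.
rewrite -mulrA ler_wpM2l // -RintegralZl //; last exact: ccont_intc.
apply: le_Rintegral => //; first exact: (ccont_intc (ccontM gc kc)).
  apply: eq_integrable (integrableZl _ M (ccont_intc gc)) => //.
by move=> t /=; rewrite in_itv /= => /hM kM; rewrite cmodM mulrC ler_wpM2r ?cmod_ge0.
Qed.

Lemma cintN (p q : R) (k : R -> cplx R) : p <= q -> ccont p q k ->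
  cint p q (fun t => - k t) = - cint p q k.
Proof.
move=> pq kc; rewrite -mulN1r -cintZ //; apply: cint_ext => // t _.
by rewrite mulN1r.
Qed.

Lemma cint_im_ge0 (p q : R) (k : R -> cplx R) : p <= q ->
  (forall t, p <= t <= q -> 0 <= (k t).2) -> 0 <= (cint p q k).2.
Proof.
move=> pq h; rewrite cintE //=; apply: Rintegral_ge0 => t /=; rewrite in_itv /=; exact: h.
Qed.

Lemma cint_im_ge (p q c : R) (k : R -> cplx R) : p <= q -> ccont p q k ->
  (forall t, p <= t <= q -> c <= (k t).2) -> c * (q - p) <= (cint p q k).2.
Proof.
move=> pq kc h; have : 0 <= (cint p q (fun t => k t - rc c * ci R)).2.
  apply: cint_im_ge0 => // t /h; rewrite cplxD2 cplxN2 rcM2 /= mulr1 subr_ge0 //.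
rewrite cintB // ?cint_cst; last exact: ccont_cst.
by rewrite cplxD2 cplxN2 !rcM2 /= mulr1 subr_ge0 mulrC.
Qed.

(** No single side of a rectangle is a closed path, so only the signed sum of the four derivatives
    vanishes. *)
Lemma flat_const4 (P1 P2 P3 P4 D1 D2 D3 D4 : R -> cplx R) :
  let flat P D := (forall e : R, 0 < e -> exists2 d : R, 0 < d & forall s t : R, 0 <= s <= 1 -> 0 <= t <= 1 ->
     `|s - t| < d -> cmod (P s - P t - rc (s - t) * D t) <= e * `|s - t|) in
  flat P1 D1 -> flat P2 D2 -> flat P3 D3 -> flat P4 D4 ->
  (forall t : R, 0 <= t <= 1 -> D1 t + D2 t - D3 t - D4 t = 0) ->
  P1 1 + P2 1 - P3 1 - P4 1 = P1 0 + P2 0 - P3 0 - P4 0.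
Proof.
move=> /= h1 h2 h3 h4 hD; apply: (@flat_const _ (fun t => P1 t + P2 t - P3 t - P4 t)) => e e0.
have e4 : 0 < e / 4 by rewrite divr_gt0.
have [d1 d10 hd1] := h1 _ e4; have [d2 d20 hd2] := h2 _ e4.
have [d3 d30 hd3] := h3 _ e4; have [d4 d40 hd4] := h4 _ e4.
exists (Num.min (Num.min d1 d2) (Num.min d3 d4)); first by rewrite !lt_min d10 d20 d30.
move=> u t u01 t01; rewrite !lt_min => /andP[/andP[k1 k2] /andP[k3 k4]].
have := hd1 _ _ u01 t01 k1; have := hd2 _ _ u01 t01 k2.
have := hd3 _ _ u01 t01 k3; have := hd4 _ _ u01 t01 k4.
set A1 := P1 u - _ - _; set A2 := P2 u - _ - _; set A3 := P3 u - _ - _; set A4 := P4 u - _ - _.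
have -> : P1 u + P2 u - P3 u - P4 u - (P1 t + P2 t - P3 t - P4 t) =
    A1 + A2 - A3 - A4 + rc (u - t) * (D1 t + D2 t - D3 t - D4 t).
  by rewrite /A1 /A2 /A3 /A4; ring.
rewrite hD // mulr0 addr0 => a1 a2 a3 a4; apply: le_trans (ler_cmodB' _ _) _.
apply: le_trans (lerD (ler_cmodB' _ _) (lexx _)) _.
apply: le_trans (lerD (lerD (ler_cmodD _ _) (lexx _)) (lexx _)) _.
clear -a1 a2 a3 a4; lra.
Qed.

Lemma sum4_cancel (c D1 D2 D3 D4 u1 u2 u3 u4 : cplx R) : c != 0 ->
  c * D1 = u2 - u1 -> c * D2 = u3 - u2 -> c * D3 = u3 - u4 -> c * D4 = u4 - u1 ->
  D1 + D2 - D3 - D4 = 0.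
Proof.
move=> c0 h1 h2 h3 h4; apply: (mulfI c0); rewrite mulr0 !mulrDr !mulrN h1 h2 h3 h4; ring.
Qed.

Lemma sum4_lower (b1 b2 b3 b4 c d : R) : 0 <= b1 -> 0 <= - b2 -> 0 <= - b3 -> c <= b4 -> d <= c ->
  d <= b1 + b4 - b2 - b3.
Proof. lra. Qed.

Lemma sum4_upper (a1 a2 a3 a4 b1 b2 b3 b4 k : R) :
  a1 <= k * b1 -> a4 <= k * b4 -> a2 <= k * b2 -> a3 <= k * b3 ->
  a1 + a4 + a2 + a3 <= k * (b1 + b2 + b3 + b4).
Proof. lra. Qed.

(** The boundary is contracted to [a] side by side, giving [F a * K] with [K] the integral of
    [1 / (z - a)]. Bounding [K] below is enough. The constant is [4 * 2 * (4 / s)]: the factors come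
    from [K], from [cint_le_norm] and from the kernel. *)
Lemma rect_cauchy F (a : cplx R) (x0 x1 y0 y1 s r : R) : analytic_on_disk F -> 0 < s -> r < 1 ->
  cmod a <= r ->
  (forall z : cplx R, rect x0 x1 y0 y1 z -> cmod z <= r) ->
  s / 4 <= x1 - a.1 <= s / 2 -> s / 4 <= a.1 - x0 <= s / 2 ->
  s / 4 <= y1 - a.2 <= s / 2 -> s / 4 <= a.2 - y0 <= s / 2 ->
  cmod (F a) <= 32 / s *
    (\int[mu]_(t in `[x0, x1]) cmod (F (t, y0)) + \int[mu]_(t in `[x0, x1]) cmod (F (t, y1))
     + \int[mu]_(t in `[y0, y1]) cmod (F (x0, t)) + \int[mu]_(t in `[y0, y1]) cmod (F (x1, t))).
Proof.
move=> hF s0 r1 ar Qr /andP[X1 X1'] /andP[X0 X0'] /andP[Y1 Y1'] /andP[Y0 Y0'].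
have s4 : 0 < s / 4 by rewrite divr_gt0.
have x01 : x0 <= x1 by lra.
have y01 : y0 <= y1 by lra.
have Fc z : rect x0 x1 y0 y1 z -> ccontpt F z by move=> /Qr zr; apply: analytic_cont => //; apply: le_lt_trans r1.
pose f := cderiv F.
have dF (u : cplx R) : cmod u < 1 -> is_cderiv F u (f u) by exact: analytic_is_cderiv.
have fc (u : cplx R) : cmod u < 1 -> ccontpt f u by move=> u1; apply: analytic_cont => //; exact: analytic_cderiv.
have Ff := analytic_udiff hF r1.
have far z : [|| s / 4 <= `|z.1 - a.1| | s / 4 <= `|z.2 - a.2|] -> s / 4 <= cmod (z - a).
  move=> /orP[h|h]; apply: le_trans h _; [exact: (re_le_cmod (z - a))|exact: (im_le_cmod (z - a))].
have nea z : s / 4 <= cmod (z - a) -> z != a.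
  by move=> h; rewrite -subr_eq0 -cmod_gt0; apply: lt_le_trans h.
have farh t y : y = y0 \/ y = y1 -> s / 4 <= cmod (((t, y) : cplx R) - a).
  by move=> h; apply: far; apply/orP; right => /=; case: h => ->; [rewrite distrC|]; rewrite ger0_norm //; lra.
have farv t x : x = x0 \/ x = x1 -> s / 4 <= cmod (((x, t) : cplx R) - a).
  by move=> h; apply: far; apply/orP; left => /=; case: h => ->; [rewrite distrC|]; rewrite ger0_norm //; lra.
have ry y : y = y0 \/ y = y1 -> y0 <= y <= y1 by case=> ->; rewrite lexx y01.
have rx x : x = x0 \/ x = x1 -> x0 <= x <= x1 by case=> ->; rewrite lexx x01.
pose wh (y t : R) : cplx R := (t, y).
pose wv (x t : R) : cplx R := (x, t).
pose dh (t : R) : cplx R := 1.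
pose dv (t : R) : cplx R := ci R.
have dhc p q : ccont p q dh by exact: ccont_cst.
have dvc p q : ccont p q dv by exact: ccont_cst.
have hr y t : y = y0 \/ y = y1 -> x0 <= t <= x1 -> cmod (wh y t) <= r.
  by move=> /ry hy ht; apply: Qr; rewrite /rect /= hy ht.
have vr x t : x = x0 \/ x = x1 -> y0 <= t <= y1 -> cmod (wv x t) <= r.
  by move=> /rx hx ht; apply: Qr; rewrite /rect /= hx ht.
have dh1 (t : R) : x0 <= t <= x1 -> cmod (dh t) <= 1 by rewrite cmod1.
have dv1 (t : R) : y0 <= t <= y1 -> cmod (dv t) <= 1 by rewrite cmod_ci.
have Hh y (hy : y = y0 \/ y = y1) := @homot_int_diff R r x0 x1 1 F f a (wh y) dh x01 r1 Ff dF fc ar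
  (fun t => @hr y t hy) (fun t _ => nea _ (farh t y hy)) (fun t _ => rderiv_h y t) (dhc _ _) dh1.
have Hv x (hx : x = x0 \/ x = x1) := @homot_int_diff R r y0 y1 1 F f a (wv x) dv y01 r1 Ff dF fc ar
  (fun t => @vr x t hx) (fun t _ => nea _ (farv t x hx)) (fun t _ => rderiv_v x t) (dvc _ _) dv1.
have Th y (hy : y = y0 \/ y = y1) := @homot_diff_FTC R r x0 x1 F f a (wh y) dh x01 r1 dF fc ar
  (fun t => @hr y t hy) (fun t _ => rderiv_h y t) (dhc _ _).
have Tv x (hx : x = x0 \/ x = x1) := @homot_diff_FTC R r y0 y1 F f a (wv x) dv y01 r1 dF fc ar
  (fun t => @vr x t hx) (fun t _ => rderiv_v x t) (dvc _ _).
have Zh y (hy : y = y0 \/ y = y1) := @homot_diff0 R x0 x1 f a (wh y) dh x01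
  (fun t _ => rderiv_h y t) (dhc _ _).
have Zv x (hx : x = x0 \/ x = x1) := @homot_diff0 R y0 y1 f a (wv x) dv y01
  (fun t _ => rderiv_v x t) (dvc _ _).
have k0 : y0 = y0 \/ y0 = y1 by left. have k1 : y1 = y0 \/ y1 = y1 by right.
have j0 : x0 = x0 \/ x0 = x1 by left. have j1 : x1 = x0 \/ x1 = x1 by right.
pose Phi t := homot_int x0 x1 F a (wh y0) dh t + homot_int y0 y1 F a (wv x1) dv t
  - homot_int x0 x1 F a (wh y1) dh t - homot_int y0 y1 F a (wv x0) dv t.
have PhiE : Phi 1 = Phi 0.
  apply: (flat_const4 (Hh _ k0) (Hv _ j1) (Hh _ k1) (Hv _ j0)) => t t01.
  have [->|t0] := eqVneq t 0.
    rewrite (Zh _ k0) (Zh _ k1) (Zv _ j0) (Zv _ j1) /wh /wv.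
    have E (u1 u2 u3 u4 v : cplx R) : u2 - u1 + (u3 - u2) - (u3 - u4) - (u4 - u1) = 0 ->
        v * (u2 - u1) + v * (u3 - u2) - v * (u3 - u4) - v * (u4 - u1) = 0.
      by move=> h; rewrite -[RHS](mulr0 v) -h; ring.
    by apply: E; ring.
  have rt : rc t != 0 by rewrite rc_eq0.
  exact: (sum4_cancel rt (Th _ k0 _ t01) (Tv _ j1 _ t01) (Th _ k1 _ t01) (Tv _ j0 _ t01)).
clear Hh Hv Th Tv Zh Zv.
pose kh y (t : R) : cplx R := dh t / (wh y t - a).
pose kv x (t : R) : cplx R := dv t / (wv x t - a).
have khc y : y = y0 \/ y = y1 -> ccont x0 x1 (kh y).
  move=> hy; apply: ccontM; first exact: dhc.
  apply: ccontV => [t _|]; first by rewrite subr_eq0; apply: nea; exact: farh.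
  apply: ccontB; last exact: ccont_cst.
  by apply: (@rderiv_ccont _ _ _ _ dh) => t _; exact: rderiv_h.
have kvc x : x = x0 \/ x = x1 -> ccont y0 y1 (kv x).
  move=> hx; apply: ccontM; first exact: dvc.
  apply: ccontV => [t _|]; first by rewrite subr_eq0; apply: nea; exact: farv.
  apply: ccontB; last exact: ccont_cst.
  by apply: (@rderiv_ccont _ _ _ _ dv) => t _; exact: rderiv_v.
pose K := cint x0 x1 (kh y0) + cint y0 y1 (kv x1) - cint x0 x1 (kh y1) - cint y0 y1 (kv x0).
have P0 : Phi 0 = F a * K.
  rewrite /Phi (@homot_int0 R x0 x1 F a (wh y0) dh x01 (fun t _ => nea _ (farh t y0 k0)) (fun t _ => rderiv_h y0 t) (dhc _ _)).
  rewrite (@homot_int0 R x0 x1 F a (wh y1) dh x01 (fun t _ => nea _ (farh t y1 k1)) (fun t _ => rderiv_h y1 t) (dhc _ _)).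
  rewrite (@homot_int0 R y0 y1 F a (wv x0) dv y01 (fun t _ => nea _ (farv t x0 j0)) (fun t _ => rderiv_v x0 t) (dvc _ _)).
  rewrite (@homot_int0 R y0 y1 F a (wv x1) dv y01 (fun t _ => nea _ (farv t x1 j1)) (fun t _ => rderiv_v x1 t) (dvc _ _)).
  by rewrite /K !mulrDr !mulrN.
(* Every side contributes a nonnegative imaginary part, and the right side alone contributes
   [1 / 4]. *)
have Kge : 1 / 4 <= cmod K.
  apply: le_trans (im_le_cmod _); apply: le_trans (ler_norm _).
  have K2 : K.2 = (cint x0 x1 (kh y0)).2 + (cint y0 y1 (kv x1)).2 - (cint x0 x1 (kh y1)).2 - (cint y0 y1 (kv x0)).2 by [].
  have b1 : 0 <= (cint x0 x1 (kh y0)).2.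
    apply: cint_im_ge0 => // t _; rewrite /kh /dh mul1r /=.
    rewrite mulr_ge0 ?invr_ge0 ?sqr_ge0 // oppr_ge0; clear -Y0 s4; lra.
  have b2 : 0 <= (- cint x0 x1 (kh y1)).2.
    rewrite -cintN //; last exact: khc.
    apply: cint_im_ge0 => // t _; rewrite /kh /dh mul1r cplxN2 /=.
    rewrite -mulNr opprK mulr_ge0 ?invr_ge0 ?sqr_ge0 //; clear -Y1 s4; lra.
  have b3 : 0 <= (- cint y0 y1 (kv x0)).2.
    rewrite -cintN //; last exact: kvc.
    apply: cint_im_ge0 => // t _; rewrite /kv /dv cplxN2 cplxM2 /= mul0r add0r mul1r.
    rewrite -mulNr mulr_ge0 ?invr_ge0 ?sqr_ge0 // oppr_ge0; clear -X0 s4; lra.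
  (* The imaginary part is [(x1 - a.1)] over a squared distance, at least [s / 4] over
     [s ^+ 2 / 2]. *)
  have b4 : 1 / (2 * s) * (y1 - y0) <= (cint y0 y1 (kv x1)).2.
    apply: cint_im_ge => // [|t /andP[t1 t2]]; first exact: kvc.
    rewrite /kv /dv cplxM2 /= mul0r add0r !mul1r.
    have cp : 0 < cmod (wv x1 t - a) by apply: lt_le_trans (farv t x1 j1).
    rewrite ler_pdivlMr ?exprn_gt0 // mulrC ler_pdivrMr ?mulr_gt0 //.
    rewrite cmod_sqr /wv cplxD1 cplxD2 cplxN1 cplxN2 /=.
    have q1 : (x1 - a.1) ^+ 2 <= (s / 2) ^+ 2 by rewrite ler_pXn2r // nnegrE; clear -X1 X1' s4; lra.
    have q2 : (t - a.2) ^+ 2 <= (s / 2) ^+ 2.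
      by rewrite -subr_ge0 subr_sqr mulr_ge0 //; clear -t1 t2 Y0' Y1'; lra.
    apply: le_trans (lerD q1 q2) _; apply: le_trans (_ : s / 4 * (2 * s) <= _).
      by rewrite le_eqVlt; apply/orP; left; apply/eqP; field.
    by rewrite ler_wpM2r // mulr_ge0 // ltW.
  have b5 : 1 / 4 <= 1 / (2 * s) * (y1 - y0).
    rewrite mulrAC mul1r ler_pdivlMr ?mulr_gt0 //; clear -Y0 Y1; lra.
  rewrite K2; exact: (sum4_lower b1 b2 b3 b4 b5).
have kM (u d : cplx R) : cmod d = 1 -> s / 4 <= cmod u -> cmod (d / u) <= 4 / s.
  by move=> d1 us; rewrite cmod_div d1 mul1r -[4 / s]invf_div lef_pV2 ?posrE // (lt_le_trans s4).
have Ih y : y = y0 \/ y = y1 -> cmod (cint x0 x1 (fun t => F (wh y t) * kh y t)) <= 2 * (4 / s) * \int[mu]_(t in `[x0, x1]) cmod (F (t, y)).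
  move=> hy; apply: (@cint_kernel_bound x0 x1 s) => //; [|exact: khc|].
    by apply: rect_ccont_h (Fc) _ (ry _ hy).
  by move=> t _; apply: kM; [exact: cmod1|exact: farh].
have Iv x : x = x0 \/ x = x1 -> cmod (cint y0 y1 (fun t => F (wv x t) * kv x t)) <= 2 * (4 / s) * \int[mu]_(t in `[y0, y1]) cmod (F (x, t)).
  move=> hx; apply: (@cint_kernel_bound y0 y1 s) => //; [|exact: kvc|].
    by apply: rect_ccont_v (Fc) _ (rx _ hx).
  by move=> t _; apply: kM; [exact: cmod_ci|exact: farv].
move: PhiE; rewrite P0 /Phi !homot_int1 // => PE.
have : cmod (F a * K) <= 2 * (4 / s) *
    (\int[mu]_(t in `[x0, x1]) cmod (F (t, y0)) + \int[mu]_(t in `[x0, x1]) cmod (F (t, y1))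
     + \int[mu]_(t in `[y0, y1]) cmod (F (x0, t)) + \int[mu]_(t in `[y0, y1]) cmod (F (x1, t))).
  rewrite -PE; apply: le_trans (ler_cmodB' _ _) _.
  apply: le_trans (lerD (ler_cmodB' _ _) (lexx _)) _.
  apply: le_trans (lerD (lerD (ler_cmodD _ _) (lexx _)) (lexx _)) _.
  exact: (sum4_upper (Ih _ k0) (Iv _ j1) (Ih _ k1) (Iv _ j0)).
set T := (_ + _ + _ + _); rewrite cmodM => h.
have : cmod (F a) * (1 / 4) <= 2 * (4 / s) * T by apply: le_trans h; rewrite ler_wpM2l ?cmod_ge0.
rewrite (_ : 32 / s * T = 2 * (4 / s) * T * 4); last by field; rewrite gt_eqF.
clear; move: (2 * (4 / s) * T) => k; lra.
Qed.

End RectCauchy.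

(** * Pointwise values from area integrals *)

Section AreaBound.
Variable R : realType.
Local Notation mu := (@lebesgue_measure R).
Local Notation mu2 := ((@lebesgue_measure R) \x (@lebesgue_measure R))%E.

Lemma lebesgue_itv (a b : R) : a <= b -> mu `[a, b] = (b - a)%:E.
Proof.
move=> ab; have := @lebesgue_measure_itv R `[a, b]; rewrite /= lte_fin => ->.
by case: ltgtP ab => //= -> _; rewrite subrr.
Qed.

(** Otherwise [phi] exceeds its mean by [d] on all of [[a, b]]; the slack makes the contradiction
    strict. *)
Lemma good_line (phi : R -> \bar R) (a b I d : R) : a < b -> measurable_fun setT phi ->
  (forall x, (0 <= phi x)%E) -> (\int[mu]_x phi x <= I%:E)%E -> 0 < d ->
  exists2 x, a <= x <= b & (phi x <= (I / (b - a) + d)%:E)%E.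
Proof.
move=> ab mphi phi0 hI d0; apply: contrapT => nh.
have ba : 0 < b - a by rewrite subr_gt0.
have H (x : R) : x \in `[a, b] -> ((I / (b - a) + d)%:E <= phi x)%E.
  rewrite in_itv /= => xab; rewrite leNgt; apply/negP => /ltW h; apply: nh; exists x => //.
have I0 : 0 <= I by rewrite -lee_fin; apply: le_trans hI; apply: integral_ge0.
have c0 : 0 <= I / (b - a) + d by rewrite addr_ge0 ?(ltW d0) // divr_ge0 // ltW.
have : (((I / (b - a) + d) * (b - a))%:E <= I%:E)%E.
  apply: le_trans hI; apply: le_trans (_ : (\int[mu]_(x in `[a, b]) phi x <= _)%E); last first.
    by apply: ge0_subset_integral.
  rewrite EFinM -(lebesgue_itv (ltW ab)) -integral_cst //.
  apply: ge0_le_integral => //.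
  exact: measurable_funS mphi.
rewrite lee_fin mulrDl divfK ?gt_eqF //; have := mulr_gt0 d0 ba; lra.
Qed.

Definition square (a : cplx R) (s : R) : set (R * R) :=
  `[a.1 - s / 2, a.1 + s / 2] `*` `[a.2 - s / 2, a.2 + s / 2].

(** A substitute for the area mean value property. By Fubini each of the four outer strips of width
    [s / 4] contains a line on which [cmod F] integrates to about [I / (s / 4)]; these lines carry
    the rectangle of [rect_cauchy], and [512 = 32 * 4 * 4]. *)
Lemma area_bound (F : cplx R -> cplx R) (a : cplx R) (s I : R) : analytic_on_disk F -> 0 < s -> cmod a + s < 1 ->
  (\int[mu2]_(z in square a s) (cmod (F z))%:E <= I%:E)%E ->
  cmod (F a) <= 512 / s ^+ 2 * I.
Proof.
move=> hF s0 as1 hI; pose S := `[a.1 - s / 2, a.1 + s / 2]; pose T := `[a.2 - s / 2, a.2 + s / 2].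
pose Q : set (R * R) := [set` S] `*` [set` T].
have mQ : measurable Q by apply: measurableX.
have Qr (z : cplx R) : Q z -> cmod z <= cmod a + s.
  move=> [] /=; rewrite !in_itv /= => /andP[h1 h2] /andP[h3 h4].
  have := ler_cmodD a (z - a); rewrite addrC subrK => h; apply: le_trans h _; rewrite lerD2l.
  apply: le_trans (cmod_le_sum _) _; rewrite cplxD1 cplxD2 cplxN1 cplxN2.
  rewrite (_ : s = s / 2 + s / 2); last by lra.
  by apply: lerD; rewrite ler_norml; apply/andP; split; lra.
have Qd : Q `<=` @disk R by move=> z /Qr h; apply: le_lt_trans as1.
pose G := ((fun z : R * R => (cmod (F z))%:E) \_ Q)%E.
have mG : measurable_fun setT G.
  apply/(measurable_restrictT _ mQ); apply/measurable_EFinP.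
  by apply: measurable_funS Qd (analytic_cmod_measurable hF); exact: measurable_disk.
have G0 z : (0 <= G z)%E by rewrite /G patchE; case: ifP => // _; rewrite lee_fin cmod_ge0.
have hG : (\int[mu2]_z G z <= I%:E)%E by rewrite -integral_mkcond.
have I0 : 0 <= I by rewrite -lee_fin; apply: le_trans hG; apply: integral_ge0.
have e4 : s / 2 - s / 4 = s / 4 by lra.
have Fx x : (fubini_F mu G x = if x \in S then \int[mu]_(y in [set` T]) (cmod (F (x, y)))%:E else 0)%E.
  rewrite /fubini_F; case: ifP => xS.
    rewrite [RHS]integral_mkcond; apply: eq_integral => y _; rewrite /G !patchE.
    by rewrite in_setX /= mem_setE xS.
  by rewrite integral0_eq // => y _; rewrite /G patchE in_setX /= mem_setE xS.
have Fy y : (fubini_G mu G y = if y \in T then \int[mu]_(x in [set` S]) (cmod (F (x, y)))%:E else 0)%E.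
  rewrite /fubini_G; case: ifP => yT.
    rewrite [RHS]integral_mkcond; apply: eq_integral => x _; rewrite /G !patchE.
    by rewrite in_setX /= !mem_setE yT andbT.
  by rewrite integral0_eq // => x _; rewrite /G patchE in_setX /= !mem_setE yT andbF.
have mF : measurable_fun setT (fubini_F mu G) by exact: measurable_fun_fubini_tonelli_F.
have mGG : measurable_fun setT (fubini_G mu G) by exact: measurable_fun_fubini_tonelli_G.
have F0 x : (0 <= fubini_F mu G x)%E by apply: integral_ge0.
have GG0 x : (0 <= fubini_G mu G x)%E by apply: integral_ge0.
have IF : (\int[mu]_x fubini_F mu G x <= I%:E)%E by rewrite -fubini_tonelli1.
have IG : (\int[mu]_x fubini_G mu G x <= I%:E)%E by rewrite -fubini_tonelli2.
apply/ler_addgt0Pr => e e0.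
(* Four lines with slack [d] and the factor [32 / s] cost exactly [e]. *)
pose d := e / (128 / s); have d0 : 0 < d by rewrite !divr_gt0.
have P (p : R) : p < p + s / 4 by rewrite ltrDl divr_gt0.
have W p : p + s / 4 - p = s / 4 by rewrite addrAC subrr add0r.
have [x1 x1i x1h] := good_line (P (a.1 + s / 4)) mF F0 IF d0.
have [x0 x0i x0h] := good_line (P (a.1 - s / 2)) mF F0 IF d0.
have [y1 y1i y1h] := good_line (P (a.2 + s / 4)) mGG GG0 IG d0.
have [y0 y0i y0h] := good_line (P (a.2 - s / 2)) mGG GG0 IG d0.
rewrite !W !Fx in x1h x0h; rewrite !W !Fy in y1h y0h.
have half (p t : R) : p - s / 2 <= t <= p - s / 2 + s / 4 -> t \in `[p - s / 2, p + s / 2].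
  by clear -s0 => /andP[? ?]; rewrite in_itv /=; apply/andP; split; lra.
have half' (p t : R) : p + s / 4 <= t <= p + s / 4 + s / 4 -> t \in `[p - s / 2, p + s / 2].
  by clear -s0 => /andP[? ?]; rewrite in_itv /=; apply/andP; split; lra.
have x1S : x1 \in S by exact: half'.
have x0S : x0 \in S by exact: half.
have y1T : y1 \in T by exact: half'.
have y0T : y0 \in T by exact: half.
rewrite x1S in x1h; rewrite x0S in x0h; rewrite y1T in y1h; rewrite y0T in y0h.
set c := I / (s / 4) + d in x1h x0h y1h y0h.
have sub (p q u v : R) : u \in `[p, q] -> v \in `[p, q] -> [set` `[u, v]] `<=` [set` `[p, q]].
  rewrite !in_itv /= => /andP[pu _] /andP[_ vq] t /=; rewrite !in_itv /= => /andP[ut tv].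
  by rewrite (le_trans pu ut) (le_trans tv vq).
have ST : [set` `[x0, x1]] `<=` [set` S] by exact: sub.
have TT : [set` `[y0, y1]] `<=` [set` T] by exact: sub.
have low (A : interval R) (B : set R) (g : R -> R) : measurable B -> B `<=` [set` A] ->
    measurable_fun [set` A] g -> (forall x, 0 <= g x) ->
    (\int[mu]_(x in [set` A]) (g x)%:E <= c%:E)%E -> \int[mu]_(x in B) g x <= c.
  move=> mB BA mg g0 h; have h' : (\int[mu]_(x in B) (g x)%:E <= c%:E)%E.
    by apply: le_trans h; apply: ge0_subset_integral => //; [exact/measurable_EFinP|move=> x _; rewrite lee_fin].
  have h0 : (0 <= \int[mu]_(x in B) (g x)%:E)%E by apply: integral_ge0 => x _; rewrite lee_fin.
  by rewrite /Rintegral -lee_fin fineK // ge0_fin_numE // (le_lt_trans h') ?ltry.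
have Fcv x : x \in S -> ccont (a.2 - s / 2) (a.2 + s / 2) (fun t => F (x, t)).
  move=> xS; apply: ccont_v => t ht; apply: analytic_cont => //; apply: Qd; split => //.
have Fch y : y \in T -> ccont (a.1 - s / 2) (a.1 + s / 2) (fun t => F (t, y)).
  move=> yT; apply: ccont_h => t ht; apply: analytic_cont => //; apply: Qd; split => //.
have mv x : x \in S -> measurable_fun [set` T] (fun t => cmod (F (x, t))).
  by move=> /Fcv/ccont_intc/measurable_int/measurable_EFinP.
have mh y : y \in T -> measurable_fun [set` S] (fun t => cmod (F (t, y))).
  by move=> /Fch/ccont_intc/measurable_int/measurable_EFinP.
have L1 := low T `[y0, y1]%classic (fun t => cmod (F (x1, t))) (measurable_itv _) TT (mv _ x1S) (fun t => cmod_ge0 _) x1h.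
have L2 := low T `[y0, y1]%classic (fun t => cmod (F (x0, t))) (measurable_itv _) TT (mv _ x0S) (fun t => cmod_ge0 _) x0h.
have L3 := low S `[x0, x1]%classic (fun t => cmod (F (t, y1))) (measurable_itv _) ST (mh _ y1T) (fun t => cmod_ge0 _) y1h.
have L4 := low S `[x0, x1]%classic (fun t => cmod (F (t, y0))) (measurable_itv _) ST (mh _ y0T) (fun t => cmod_ge0 _) y0h.
clear low mv mh Fcv Fch mF mGG F0 GG0 IF IG Fx Fy x1h x0h y1h y0h mG G0 hG.
case/andP: x1i => x1a x1b; case/andP: x0i => x0a x0b; case/andP: y1i => y1a y1b; case/andP: y0i => y0a y0b.
have := @rect_cauchy R F a x0 x1 y0 y1 s (cmod a + s) hF s0 as1.
rewrite lerDl (ltW s0) => /(_ isT) H.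
apply: le_trans (H _ _ _ _ _) _.
- move=> z /andP[zx zy]; apply: Qr; split; [apply: ST|apply: TT]; rewrite /= in_itv //.
- by clear -x1a x1b; apply/andP; split; lra.
- by clear -x0a x0b; apply/andP; split; lra.
- by clear -y1a y1b; apply/andP; split; lra.
- by clear -y0a y0b; apply/andP; split; lra.
apply: le_trans (ler_wpM2l _ (lerD (lerD (lerD L4 L3) L2) L1)) _; first by rewrite divr_ge0 // ltW.
rewrite /c /d le_eqVlt; apply/orP; left; apply/eqP; clear -s0; field.
by rewrite gt_eqF.
Qed.

End AreaBound.

(** * The weighted Hilbert space *)

Section DiskArea.
Variable R : realType.
Local Notation mu := (@lebesgue_measure R).
Local Notation mu2 := ((@lebesgue_measure R) \x (@lebesgue_measure R))%E.

Definition cball (r : R) : set (R * R) := [set z | cmod z <= r].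

Lemma measurable_cball r : measurable (cball r).
Proof. exact: compact_measurable2 (@compact_cdisc R r). Qed.

(** The area of the unit disc, that is [pi]; only its finiteness and sign matter, so the value is
    left unevaluated. *)
Definition area_const : R := \int[mu]_(u in `[-1, 1]) (2 * Num.sqrt (1 - u ^+ 2)).

Lemma sqrt_within (a b r : R) : {within `[a, b], continuous (fun y => 2 * Num.sqrt (r ^+ 2 - y ^+ 2))}.
Proof.
apply: continuous_subspaceT => y; apply: cvgM; first exact: cvg_cst.
apply: (cvg_comp _ _ (_ : r ^+ 2 - x ^+ 2 @[x --> y] --> r ^+ 2 - y ^+ 2)); last exact: sqrt_continuous.
by apply: cvgB; [exact: cvg_cst|exact: exprn_continuous].
Qed.

(** Valid for every [y]: beyond the disc the section is empty, and the square root of a negative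
    number is 0. *)
Lemma cball_xsection (r y : R) : 0 <= r ->
  mu (xsection (cball r) y) = (2 * Num.sqrt (r ^+ 2 - y ^+ 2))%:E.
Proof.
move=> r0.
have [yr|ry] := leP (y ^+ 2) (r ^+ 2).
  have q0 : 0 <= r ^+ 2 - y ^+ 2 by rewrite subr_ge0.
  have -> : xsection (cball r) y = `[- Num.sqrt (r ^+ 2 - y ^+ 2), Num.sqrt (r ^+ 2 - y ^+ 2)]%classic.
    apply/seteqP; split => x /=; rewrite /xsection /= inE /cball /= in_itv /= -ler_norml -(sqrtr_sqr x) /cmod /=.
      rewrite -{1}(ger0_norm r0) -(sqrtr_sqr r) ler_sqrt ?sqr_ge0 // => h; rewrite ler_sqrt //.
      by rewrite lerBrDl.
    rewrite ler_sqrt // => h.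
    by rewrite -[leRHS](ger0_norm r0) -(sqrtr_sqr r) ler_sqrt ?sqr_ge0 // -lerBrDl.
  rewrite lebesgue_itv.
    by rewrite opprK mulr2n mulrDl mul1r.
  by have := sqrtr_ge0 (r ^+ 2 - y ^+ 2); lra.
have -> : Num.sqrt (r ^+ 2 - y ^+ 2) = 0 by apply/eqP; rewrite sqrtr_eq0 subr_le0 ltW.
have -> : xsection (cball r) y = set0.
  rewrite -subset0 => x; rewrite /xsection /= inE /cball /= /cmod /= leNgt => /negP; apply.
  rewrite -[ltLHS](ger0_norm r0) -(sqrtr_sqr r) ltr_sqrt; first by rewrite ltr_wpDr // sqr_ge0.
  by apply: lt_le_trans (_ : y ^+ 2 <= _); [exact: le_lt_trans (sqr_ge0 r) ry|rewrite lerDl sqr_ge0].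
by rewrite measure0 mulr0.
Qed.

Lemma cball_area (r : R) : 0 < r -> mu2 (cball r) = (r ^+ 2 * area_const)%:E.
Proof.
move=> r0; rewrite /product_measure1.
transitivity (\int[mu]_(y in `[(- r)%R, r]) (2 * Num.sqrt (r ^+ 2 - y ^+ 2))%:E)%E.
  rewrite [RHS]integral_mkcond; apply: eq_integral => y _ /=; rewrite cball_xsection ?(ltW r0) // patchE.
  case: ifPn => //; rewrite notin_setE /= in_itv /= -ler_norml => /negP; rewrite -ltNge => ry.
  suff -> : Num.sqrt (r ^+ 2 - y ^+ 2) = 0 by rewrite mulr0.
  apply/eqP; rewrite sqrtr_eq0 subr_le0 -(real_normK (num_real y)).
  by rewrite ler_pXn2r ?nnegrE ?(ltW r0) // ltW.
pose F u : R := r * u.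
have dF (u : R) : is_derive u (1 : R) F r.
  have -> : r = r *: (1 : R) by rewrite /GRing.scale /= mulr1.
  exact: is_deriveZ.
have F' : F^`()%classic = cst r.
  by apply/funext => u; rewrite derive1E derive_val.
have -> : `[- r, r]%classic = `[F (-1), F 1]%classic by rewrite /F mulrN1 mulr1.
rewrite (@integration_by_substitution_increasing R F) //; first last.
- exact: sqrt_within.
- split => [u _||]; first by have [] := dF u.
  + by apply: cvg_at_right_filter; apply: differentiable_continuous; apply/derivable1_diffP; have [] := dF (-1).
  + by apply: cvg_at_left_filter; apply: differentiable_continuous; apply/derivable1_diffP; have [] := dF 1.
- by rewrite F'; apply: is_cvg_cst.
- by rewrite F'; apply: is_cvg_cst.
- by rewrite F' => u _; apply: cst_continuous.
- by move=> u v _ _ uv; rewrite /F ltr_pM2l.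
rewrite /area_const /Rintegral EFinM fineK; last first.
  apply: integrable_fin_num => //; apply: continuous_compact_integrable; first exact: segment_compact.
  by have := @sqrt_within (-1) 1 1; rewrite expr1n.
rewrite -ge0_integralZl //; first last.
- by rewrite lee_fin sqr_ge0.
- apply/measurable_EFinP; have := @sqrt_within (-1) 1 1; rewrite expr1n.
  exact: subspace_continuous_measurable_fun.
apply: eq_integral => u _; rewrite F' /= /F -EFinM; congr EFin.
change (2 * Num.sqrt (r ^+ 2 - (r * u) ^+ 2) * r = r ^+ 2 * (2 * Num.sqrt (1 - u ^+ 2))).
have -> : r ^+ 2 - (r * u) ^+ 2 = r ^+ 2 * (1 - u ^+ 2) by rewrite exprMn mulrBr mulr1.
rewrite sqrtrM ?sqr_ge0 // sqrtr_sqr gtr0_norm //.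
by move: (Num.sqrt _) => k; ring.
Qed.

Lemma area_const_ge0 : 0 <= area_const.
Proof. by apply: Rintegral_ge0 => u _; rewrite mulr_ge0 // sqrtr_ge0. Qed.

Definition area_disk : measure _ R := mrestr mu2 (@measurable_disk R).

Lemma measurable_cmodR :
  measurable_fun [set: (measurableTypeR R * measurableTypeR R)%type] (@cmod R : _ -> measurableTypeR R).
Proof. exact: measurable_cmod. Qed.

(* The image of the area measure under the modulus, bounded by a multiple of the Lebesgue measure. *)
Definition radial : measure _ R :=
  measure_function_pushforward__canonical__measure_function_Measure area_disk measurable_cmodR.

(** An annulus inside the unit disc has area [area_const * (b ^+ 2 - a ^+ 2)], at most
    [2 * area_const * (b - a)]. The [+ 1] makes the constant positive, so that [radial_le] can
    divide by it. *)
Lemma radial_itv (a b : R) : a <= b ->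
  (radial `]a, b]%classic <= ((2 * area_const + 1) * (b - a))%:E)%E.
Proof.
move=> ab; pose D : set (R * R) := (@cmod R @^-1` `]a, b]%classic) `&` @disk R.
rewrite (_ : radial _ = mu2 D) //.
have A0 := area_const_ge0.
have mD : measurable D.
  apply: measurableI; last exact: measurable_disk.
  by rewrite -[X in measurable X]setTI; apply: (@measurable_cmod R) => //.
pose b' := Num.min b 1.
have Db : D `<=` cball b'.
  move=> z [] /=; rewrite /disk /= in_itv /= => /andP[_ zb] /ltW z1.
  by rewrite /cball /= /b' le_min zb.
have [b0|b0] := leP b' 0.
  have bb : b <= 0 by move: b0; rewrite /b' ge_min; case/orP => //; lra.
  have D0 : D `<=` [set 0].
    move=> z /Db; rewrite /cball /= => h; apply/eqP; rewrite -cmod_eq0 eq_le cmod_ge0 andbT.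
    exact: le_trans b0.
  have : (mu2 D <= mu2 [set 0%R : R * R])%E.
    by apply: le_measure => //; rewrite inE //; apply: compact_measurable2; exact: compact_set1.
  have -> : [set 0 : R * R] = [set 0 : R] `*` [set 0 : R].
    by apply/seteqP; split => [z ->//|[x y] [/= -> ->]].
  rewrite product_measure1E // [X in (X * _)%E](_ : _ = 0%E); last exact: lebesgue_measure_set1.
  rewrite mul0e => h; apply: le_trans h _.
  by rewrite lee_fin mulr_ge0 ?subr_ge0 // addr_ge0 // mulr_ge0.
have b1 : b' <= 1 by rewrite /b' ge_min lexx orbT.
have bb : b' <= b by rewrite /b' ge_min lexx.
have [a0|a0] := leP a 0.
  apply: le_trans (_ : mu2 (cball b') <= _)%E.
    by apply: le_measure => //; rewrite inE //; exact: measurable_cball.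
  rewrite cball_area // lee_fin.
  have h1 : b' ^+ 2 <= b' by rewrite expr2 ger_pMr.
  have h2 := ler_wpM2r A0 h1; have h3 := ler_wpM2l A0 bb; have h4 := mulr_ge0 A0 (ltW b0).
  have h5 : 0 <= area_const * - a by rewrite mulr_ge0 // oppr_ge0.
  rewrite mulrDl mul1r; apply: le_trans h2 _; rewrite mulrC; move: h3 h4 h5; clear -ab b0 bb a0; lra.
have [ab'|ab'] := leP b' a.
  have -> : D = set0.
    rewrite -subset0 => z /[dup] /Db; rewrite /cball /= => zb [] /=; rewrite in_itv /= => /andP[az _] _.
    by have := lt_le_trans az (le_trans zb ab'); rewrite ltxx.
  by rewrite measure0 lee_fin mulr_ge0 ?subr_ge0 // addr_ge0 // mulr_ge0.
apply: le_trans (_ : mu2 (cball b' `\` cball a) <= _)%E.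
  apply: le_measure => //; rewrite ?inE //; first by apply: measurableD; exact: measurable_cball.
  move=> z Dz; split; first exact: Db.
  by move: Dz => [] /=; rewrite in_itv /= => /andP[az _] _; apply/negP; rewrite -ltNge.
have sub : cball a `<=` cball b' by move=> z /= za; apply: le_trans za (ltW ab').
rewrite measureD ?setIidr //; [|exact: measurable_cball|exact: measurable_cball|].
  have Eb := cball_area b0; have Ea := cball_area a0.
  rewrite [X in (X - _ <= _)%E]Eb [X in (_ - X <= _)%E]Ea -EFinB lee_fin -mulrBl.
  have h1 : b' ^+ 2 - a ^+ 2 <= 2 * (b - a).
    rewrite subr_sqr mulrC ler_pM //; [lra|lra|lra|lra].
  have := ler_wpM2r A0 h1; clear -ab A0; lra.
by have Eb := cball_area b0; rewrite [X in (X < _)%E]Eb ltry.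
Qed.

(** Lebesgue measure is an infimum over countable covers by half-open intervals, so the bound on
    intervals extends by subadditivity. *)
Lemma radial_le (S : set R) : measurable S -> (radial S <= (2 * area_const + 1)%:E * mu S)%E.
Proof.
move=> mS; have C0 : 0 < 2 * area_const + 1 by rewrite ltr_wpDl // mulr_ge0 // area_const_ge0.
rewrite -lee_pdivrMl // /lebesgue_measure /lebesgue_stieltjes_measure /measure_extension /mu_ext.
apply: le_ereal_inf_tmp => _ [A [mA SA] <-].
rewrite lee_pdivrMl // -nneseriesZl //.
have mA' k : measurable (A k : set R).
  by have [[x y] _ <-] := mA k.
apply: le_trans (_ : (\sum_(0 <= k <oo) radial (A k) <= _)%E).
  exact: measure_sigma_subadditive.
apply: lee_nneseries => // k _.
have [[x y] _ <-] := mA k.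
have [xy|yx] := leP x y; last first.
  have -> : [set` `](x, y).1, (x, y).2]] = set0 :> set R by rewrite set_itv_ge // bnd_simp -leNgt ltW.
  by rewrite !measure0 mule0.
rewrite [X in (_ * X)%E]wlength_itv /= lte_fin; case: ltgtP xy => // [xy _|-> _].
  exact: radial_itv (ltW xy).
by apply: le_trans (radial_itv (lexx y)) _; rewrite subrr mulr0 mule0.
Qed.

(** This says that the identity function has finite norm. Pushing the area forward under the modulus
    takes the place of polar coordinates. *)
Lemma weight_integral_disk (om : R -> R) : {within `[0, 1[, continuous om} ->
  (forall r : R, 0 <= r < 1 -> 0 < om r) -> mu.-integrable `[0, 1[ (EFin \o om) ->
  (\int[mu2]_(z in @disk R) (om (cmod z))%:E < +oo)%E.
Proof.
move=> omc om0 omi.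
have mom : measurable_fun (`[0, 1[ : set R)%classic om by apply: subspace_continuous_measurable_fun.
pose f : R -> \bar R := (EFin \o om) \_ `[0, 1[%classic.
have mf : measurable_fun setT f.
  by apply/(measurable_restrictT _ (measurable_itv _)); exact/measurable_EFinP.
have f0 r : (0 <= f r)%E.
  rewrite /f patchE; case: ifPn => //; rewrite inE /= in_itv /= => h; rewrite lee_fin.
  exact/ltW/om0.
have diskE : @disk R = (@cmod R : R * R -> R) @^-1` `[0, 1[%classic.
  by apply/seteqP; split => z /=; rewrite /disk /= in_itv /= cmod_ge0.
have -> : (\int[mu2]_(z in @disk R) (om (cmod z))%:E = \int[radial]_(r in `[0%R, 1%R[) f r)%E.
  have P := @ge0_integral_pushforward _ _ _ _ R _ measurable_cmodR area_disk `[0, 1[%classic f (measurable_itv _)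
    (measurable_funS measurableT (@subsetT _ _) mf) (fun r _ => f0 r).
  apply: etrans (esym P); rewrite -diskE; transitivity (\int[mu2]_(z in @disk R) (f \o @cmod R) z)%E.
    apply: eq_integral => z; rewrite inE diskE => hz; rewrite /f /= patchE ifT //.
    by rewrite inE.
  apply: eq_measure_integral => A mA AD; change (mu2 A = mu2 (A `&` @disk R)).
  by rewrite setIidl.
have C0 : 0 <= 2 * area_const + 1 by rewrite addr_ge0 // mulr_ge0 // area_const_ge0.
pose m2 : measure _ R := mscale (NngNum C0) mu.
apply: le_lt_trans (@ge0_le_measure_integral _ _ _ radial m2 _ f `[0, 1[%classic _ f0 mf) _ => //.
  by move=> S mS; exact: radial_le.
rewrite ge0_integral_mscale //; last exact: measurable_funS mf.
rewrite /= lte_mul_pinfty // (_ : (\int[mu]_(x in _) f x = \int[mu]_(x in `[0%R, 1%R[) (om x)%:E)%E).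
  have := integrable_lty _ omi; apply => //.
by apply: eq_integral => x hx; rewrite /f patchE hx.
Qed.

End DiskArea.

(** * Norm estimates and point evaluations *)

Section HSpace.
Variable R : realType.
Local Notation mu2 := ((@lebesgue_measure R) \x (@lebesgue_measure R))%E.
Variable omega : R -> R.
Hypothesis omc : {within `[0, 1[, continuous omega}.
Hypothesis om0 : forall r : R, 0 <= r < 1 -> 0 < omega r.
Hypothesis omi : (@lebesgue_measure R).-integrable `[0, 1[ (EFin \o omega).
Implicit Types (f g : cplx R -> cplx R).
Local Notation Dir := (Dirichlet_integral omega).

Lemma cderiv_eq_on_disk f g z : eq_on_disk f g -> disk z -> cderiv f z = cderiv g z.
Proof.
move=> fg z1; rewrite /cderiv; congr xget; apply/seteqP.
have d0 : 0 < 1 - cmod z by rewrite subr_gt0.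
have near (w : cplx R) : cmod (w - z) < 1 - cmod z -> disk w.
  by rewrite /disk /= => h; have := ler_cmodD z (w - z); rewrite addrC subrK; lra.
by split => l; apply: (is_cderiv_near d0) => w /near /fg.
Qed.

Lemma analytic_eq_on_disk f g : eq_on_disk f g -> analytic_on_disk f -> analytic_on_disk g.
Proof.
move=> fg hf z z1; have [l hl] := hf z z1; exists l.
have d0 : 0 < 1 - cmod z by rewrite subr_gt0.
apply: (is_cderiv_near d0) hl => w h; apply: fg; rewrite /disk /=.
by have := ler_cmodD z (w - z); rewrite addrC subrK; lra.
Qed.

Lemma Dir_eq_on_disk f g : eq_on_disk f g -> Dir f = Dir g.
Proof.
by move=> fg; apply: eq_integral => z; rewrite inE => /(cderiv_eq_on_disk fg) ->.
Qed.

Lemma in_H_eq f g : eq_on_disk f g -> in_H omega f -> in_H omega g.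
Proof.
by move=> fg [hf hD]; split; [apply: analytic_eq_on_disk hf|rewrite -(Dir_eq_on_disk fg)].
Qed.

Lemma disk0 : disk (0 : R * R). Proof. by rewrite /disk /= (@cmod0 R). Qed.

Lemma Hnorm_eq f g : eq_on_disk f g -> Hnorm omega f = Hnorm omega g.
Proof.
by move=> fg; rewrite /Hnorm /Hnorm2 (Dir_eq_on_disk fg) fg //; exact: disk0.
Qed.

Lemma om_ge0 (z : R * R) : disk z -> 0 <= omega (cmod z).
Proof. by move=> z1; apply/ltW/om0; rewrite cmod_ge0. Qed.

Lemma Dir_ge0 f : (0 <= Dir f)%E.
Proof. by apply: integral_ge0 => z z1; rewrite lee_fin mulr_ge0 ?sqr_ge0 ?om_ge0. Qed.

Lemma Dir_fin f : in_H omega f -> Dir f = (fine (Dir f))%:E.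
Proof. by move=> [_ h]; rewrite fineK // ge0_fin_numE // Dir_ge0. Qed.

Lemma fDir_ge0 f : 0 <= fine (Dir f).
Proof. exact/fine_ge0/Dir_ge0. Qed.

Lemma Hnorm2_ge0 f : 0 <= Hnorm2 omega f.
Proof. by rewrite addr_ge0 ?sqr_ge0 // divr_ge0 ?fDir_ge0 ?pi_ge0. Qed.

Lemma Hnorm_ge0 f : 0 <= Hnorm omega f. Proof. exact: sqrtr_ge0. Qed.

Lemma Hnorm_sqr f : Hnorm omega f ^+ 2 = Hnorm2 omega f.
Proof. by rewrite sqr_sqrtr // Hnorm2_ge0. Qed.

Lemma Hnorm_le f (K : R) : 0 <= K -> Hnorm2 omega f <= K ^+ 2 -> Hnorm omega f <= K.
Proof. by move=> K0; rewrite -Hnorm_sqr ler_pXn2r // nnegrE Hnorm_ge0. Qed.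

(** The common source of membership and norm bounds: a pointwise inequality between squared
    derivatives, integrated against the weight. *)
Lemma Dir_comb2 f g (h : cplx R -> cplx R) (A B : R) : 0 <= A -> 0 <= B -> analytic_on_disk f -> in_H omega g -> in_H omega h ->
  (forall z : cplx R, disk z -> cmod (cderiv f z) ^+ 2 <= A * cmod (cderiv g z) ^+ 2 + B * cmod (cderiv h z) ^+ 2) ->
  in_H omega f /\ fine (Dir f) <= A * fine (Dir g) + B * fine (Dir h).
Proof.
move=> A0 B0 af hg hh le.
have mg := Dirichlet_measurable omc hg.1; have mh := Dirichlet_measurable omc hh.1.
have ge0 k (z : R * R) : disk z -> (0 <= (cmod (cderiv k z) ^+ 2 * omega (cmod z))%:E)%E.
  by move=> z1; rewrite lee_fin mulr_ge0 ?sqr_ge0 ?om_ge0.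
have D : (Dir f <= A%:E * Dir g + B%:E * Dir h)%E.
  rewrite -!ge0_integralZl //; 
    try exact: measurable_disk; try (by rewrite lee_fin); try (by move=> z /ge0).
  rewrite -ge0_integralD //; try exact: measurable_disk; try (by apply: measurable_funeM);
    try (by move=> z z1; rewrite mule_ge0 ?ge0 // lee_fin).
  apply: ge0_le_integral => //; try exact: measurable_disk; try (by move=> z /ge0).
  - exact: Dirichlet_measurable.
  - by apply: emeasurable_funD; apply: measurable_funeM.
  - move=> z z1; rewrite -!EFinM -EFinD lee_fin (mulrA A) (mulrA B) -mulrDl.
    by rewrite ler_wpM2r ?om_ge0 //; exact: le.
have D' : (Dir f <= (A * fine (Dir g) + B * fine (Dir h))%:E)%E.
  by move: D; rewrite (Dir_fin hg) (Dir_fin hh) -!EFinM -EFinD.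
have fH : in_H omega f by split=> //; apply: le_lt_trans D' (ltry _).
by split=> //; move: D'; rewrite {1}(Dir_fin fH) lee_fin.
Qed.

Lemma Dir_le f g (M : R) : 0 <= M -> analytic_on_disk f -> in_H omega g ->
  (forall z : cplx R, disk z -> cmod (cderiv f z) <= M * cmod (cderiv g z)) ->
  in_H omega f /\ fine (Dir f) <= M ^+ 2 * fine (Dir g).
Proof.
move=> M0 af hg le.
have [] := @Dir_comb2 f g g (M ^+ 2) 0 (sqr_ge0 _) (lexx _) af hg hg.
  move=> z z1; rewrite mul0r addr0 -exprMn ler_pXn2r ?nnegrE ?mulr_ge0 ?cmod_ge0 ?le //.
by rewrite mul0r addr0.
Qed.

Lemma cderiv_comb (a : cplx R) f g z : analytic_on_disk f -> analytic_on_disk g -> disk z ->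
  is_cderiv (fun w => a * f w + g w) z (a * cderiv f z + cderiv g z).
Proof.
by move=> hf hg z1; apply: is_cderivD; [apply: is_cderivZ|]; exact: analytic_is_cderiv.
Qed.

Lemma cmodD_sqr (u v : cplx R) : cmod (u + v) ^+ 2 <= 2 * cmod u ^+ 2 + 2 * cmod v ^+ 2.
Proof.
apply: le_trans (_ : (cmod u + cmod v) ^+ 2 <= _).
  by rewrite ler_pXn2r ?nnegrE ?addr_ge0 ?cmod_ge0 // ler_cmodD.
by have := sqr_ge0 (cmod u - cmod v); lra.
Qed.

Lemma lin_comb (A p q u v i : R) : A * p + 2 * q + (A * u + 2 * v) * i = A * (p + u * i) + 2 * (q + v * i).
Proof. ring. Qed.

(** The cheap inequality [cmodD_sqr] replaces Minkowski's; the factors 2 are harmless. *)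
Lemma in_H_comb (a : cplx R) f g : in_H omega f -> in_H omega g ->
  in_H omega (fun z => a * f z + g z) /\
  Hnorm2 omega (fun z => a * f z + g z) <= 2 * cmod a ^+ 2 * Hnorm2 omega f + 2 * Hnorm2 omega g.
Proof.
move=> hf hg; set h := fun z => _.
have ah : analytic_on_disk h by move=> z z1; eexists; exact: cderiv_comb hf.1 hg.1 z1.
have A0 : 0 <= 2 * cmod a ^+ 2 by rewrite mulr_ge0 // sqr_ge0.
have [] := @Dir_comb2 h f g (2 * cmod a ^+ 2) 2 A0 (ltW (ltr0n R 2)) ah hf hg.
  move=> z z1; rewrite (cderivE (cderiv_comb a hf.1 hg.1 z1)).
  by apply: le_trans (cmodD_sqr _ _) _; rewrite cmodM exprMn mulrA.
move=> hH hD; split=> //; rewrite /Hnorm2.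
have := cmodD_sqr (a * f 0) (g 0); rewrite cmodM exprMn mulrA => h0.
have pi0 : 0 <= (pi : R)^-1 by rewrite invr_ge0 pi_ge0.
apply: le_trans (lerD h0 (ler_wpM2r pi0 hD)) _; rewrite le_eqVlt; apply/orP; left; apply/eqP.
exact: lin_comb.
Qed.

Lemma in_H_scale (a : cplx R) f : in_H omega f ->
  in_H omega (fun z => a * f z) /\ Hnorm omega (fun z => a * f z) <= cmod a * Hnorm omega f.
Proof.
move=> hf.
have da z : disk z -> is_cderiv (fun z => a * f z) z (a * cderiv f z).
  by move=> z1; apply: is_cderivZ; apply: analytic_is_cderiv hf.1 z1.
have [] := @Dir_le (fun z => a * f z) f (cmod a) (cmod_ge0 _) _ hf.
- by move=> z z1; eexists; exact: da.
- by move=> z z1; rewrite (cderivE (da z z1)) cmodM.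
move=> hH hD; split=> //; apply: Hnorm_le; first by rewrite mulr_ge0 ?cmod_ge0 ?Hnorm_ge0.
rewrite exprMn Hnorm_sqr /Hnorm2 mulrDr cmodM exprMn lerD2l mulrA ler_wpM2r // invr_ge0 pi_ge0 //.
Qed.

Lemma in_H_cst (c : cplx R) : in_H omega (fun=> c).
Proof.
split; first by move=> z _; exists 0; exact: is_cderiv_cst.
rewrite /Dirichlet_integral (_ : (\int[_]_(z in _) _)%E = 0%E) ?ltry //.
by apply: integral0_eq => z z1; rewrite (cderivE (is_cderiv_cst c z)) (@cmod0 R) expr0n /= mul0r.
Qed.

Lemma in_H_id : in_H omega (fun z : cplx R => z).
Proof.
split; first by move=> z _; exists (1 : cplx R); exact: is_cderiv_id.
apply: le_lt_trans (weight_integral_disk omc om0 omi); rewrite le_eqVlt; apply/orP; left; apply/eqP.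
by apply: eq_integral => z z1; rewrite (cderivE (is_cderiv_id z)) (@cmod1 R) expr1n mul1r.
Qed.

Lemma in_H_bounded f (M : R) : 0 <= M -> analytic_on_disk f ->
  (forall z : cplx R, disk z -> cmod (cderiv f z) <= M) ->
  in_H omega f /\ fine (Dir f) <= M ^+ 2 * fine (Dir (fun z => z)).
Proof.
move=> M0 af le; apply: Dir_le => //; first exact: in_H_id.
by move=> z z1; rewrite (cderivE (is_cderiv_id z)) (@cmod1 R) mulr1 le.
Qed.

Lemma omega_lower (r : R) : 0 <= r < 1 -> exists2 m : R, 0 < m & forall x, 0 <= x <= r -> m <= omega x.
Proof.
move=> /andP[r0 r1].
have h : {within `[0, r], continuous omega}.
  by apply: continuous_subspaceW omc; apply: subset_itvl; rewrite bnd_simp.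
have [c cr hc] := EVT_min r0 h; exists (omega c).
  by apply: om0; move: cr; rewrite in_itv /= => /andP[-> /le_lt_trans]; apply.
by move=> x xr; apply: hc; rewrite in_itv.
Qed.

(** [area_bound] is applied to the square of the derivative, again analytic, on a square around [a]
    where the weight is at least [m > 0]. *)
Lemma deriv_bound (r : R) : 0 <= r < 1 -> exists2 C : R, 0 <= C &
  forall f (a : cplx R), in_H omega f -> cmod a <= r -> cmod (cderiv f a) ^+ 2 <= C * fine (Dir f).
Proof.
move=> /andP[r0 r1]; pose s : R := (1 - r) / 2; pose r' : R := (1 + r) / 2.
have s0 : 0 < s by rewrite /s; lra.
have r'01 : 0 <= r' < 1 by rewrite /r'; apply/andP; split; lra.
have [m m0 hm] := omega_lower r'01.
exists (512 / s ^+ 2 * m^-1); first by apply: mulr_ge0; [apply: divr_ge0; [exact: ler0n|exact: sqr_ge0]|rewrite invr_ge0 ltW].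
move=> f a hf ar.
have as1 : cmod a + s < 1 by rewrite /s; lra.
pose f' (z : cplx R) : cplx R := cderiv f z; pose F (z : cplx R) : cplx R := f' z * f' z.
have aF : analytic_on_disk F.
  move=> z z1; have [l hl] := analytic_cderiv hf.1 z1; exists ((l : cplx R) * f' z + f' z * l).
  exact: (@is_cderivM R f' f' z l l hl hl).
have sqr' (z : cplx R) : square a s z -> cmod z <= r'.
  move=> [] /=; rewrite !in_itv /= => /andP[h1 h2] /andP[h3 h4].
  have := ler_cmodD a (z - a); rewrite addrC subrK => h; apply: le_trans h _.
  apply: le_trans (_ : cmod a + s <= _); last by rewrite /s /r'; lra.
  rewrite lerD2l; apply: le_trans (cmod_le_sum _) _; rewrite cplxD1 cplxD2 cplxN1 cplxN2.
  rewrite (_ : s = s / 2 + s / 2); last by lra.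
  by apply: lerD; rewrite ler_norml; apply/andP; split; lra.
have sqd : square a s `<=` @disk R by move=> z /sqr' h; apply: le_lt_trans h _; case/andP: r'01.
have msq : measurable (square a s) by apply: measurableX.
have mF : measurable_fun (square a s) (fun z : R * R => (cmod (F z))%:E).
  apply/measurable_EFinP; apply: measurable_funS sqd (analytic_cmod_measurable aF); exact: measurable_disk.
have := @area_bound R F a s (m^-1 * fine (Dir f)) aF s0 as1; rewrite cmodM -expr2 mulrA; apply.
rewrite EFinM -Dir_fin // lee_pdivlMl // -ge0_integralZl //; first last.
- by rewrite lee_fin ltW.
- by move=> z _; rewrite lee_fin cmod_ge0.
apply: le_trans (_ : (\int[mu2]_(z in square a s) (cmod (cderiv f z) ^+ 2 * omega (cmod z))%:E <= _)%E).
  apply: ge0_le_integral => //.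
  - by move=> z _; rewrite mule_ge0 // lee_fin ?cmod_ge0 // ltW.
  - exact: measurable_funeM.
  - by apply: measurable_funS sqd (Dirichlet_measurable omc hf.1); exact: measurable_disk.
  - move=> z hz; rewrite -EFinM lee_fin cmodM -expr2 mulrC ler_wpM2l ?sqr_ge0 //.
    by apply: hm; rewrite cmod_ge0 sqr'.
apply: ge0_subset_integral => //.
- exact: measurable_disk.
- exact: Dirichlet_measurable hf.1.
- by move=> z z1; rewrite lee_fin mulr_ge0 ?sqr_ge0 ?om_ge0.
Qed.

Lemma fDir_le_Hnorm f : fine (Dir f) <= pi * Hnorm omega f ^+ 2.
Proof.
rewrite Hnorm_sqr /Hnorm2 mulrDr [pi * (fine _ / pi)]mulrCA divff ?gt_eqF ?pi_gt0 // mulr1 lerDr.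
by rewrite mulr_ge0 ?pi_ge0 ?sqr_ge0.
Qed.

Lemma f0_le_Hnorm f : cmod (f 0) <= Hnorm omega f.
Proof.
rewrite -(@ler_pXn2r _ 2) ?nnegrE ?cmod_ge0 ?Hnorm_ge0 // Hnorm_sqr /Hnorm2 lerDl.
by rewrite divr_ge0 ?fDir_ge0 ?pi_ge0.
Qed.

(** [f z - f 0] is the integral of the derivative along the segment from 0 to [z], on which
    [deriv_bound] applies. *)
Lemma eval_bound (r : R) : 0 <= r < 1 -> exists2 C : R, 0 <= C &
  forall f (z : cplx R), in_H omega f -> cmod z <= r -> cmod (f z) <= C * Hnorm omega f.
Proof.
move=> r01; have [K K0 hK] := deriv_bound r01; case/andP: r01 => r0 r1.
pose k : R := Num.sqrt (K * pi).
exists (1 + 2 * k); first by rewrite addr_ge0 // mulr_ge0 // sqrtr_ge0.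
move=> f z hf zr.
have dk (u : cplx R) : cmod u <= r -> cmod (cderiv f u) <= k * Hnorm omega f.
  move=> ur; rewrite -(@ler_pXn2r _ 2) ?nnegrE ?cmod_ge0 ?mulr_ge0 ?sqrtr_ge0 ?Hnorm_ge0 //.
  have -> : (k * Hnorm omega f) ^+ 2 = K * pi * Hnorm omega f ^+ 2.
    by rewrite exprMn /k sqr_sqrtr // mulr_ge0 ?pi_ge0.
  apply: le_trans (hK f u hf ur) _.
  by rewrite -mulrA ler_wpM2l // fDir_le_Hnorm.
have rt (t : R) : 0 <= t <= 1 -> cmod (rc t * z) <= r.
  move=> /andP[t0 t1]; rewrite cmodM cmod_rc ger0_norm //; apply: le_trans zr.
  by rewrite ler_piMl ?cmod_ge0.
have dw t : rderiv (fun t => rc t * z) t z.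
  move=> e e0; exists 1 => // s _; rewrite rcB.
  have -> : rc s * z - rc t * z - (rc s - rc t) * z = 0 by ring.
  by rewrite cmod0 mulr_ge0 // ltW.
pose f' (u : cplx R) : cplx R := cderiv f u.
have gc : ccont 0 1 (fun t => f' (rc t * z) * z).
  apply: ccontM; last exact: ccont_cst.
  apply: (@ccont_comp _ _ _ f' (fun t => rc t * z)).
    move=> t /rt h; apply: analytic_cont; [exact: analytic_cderiv hf.1|exact: le_lt_trans r1].
  by apply: (@rderiv_ccont _ _ _ _ (fun=> z)) => t _; exact: dw.
have := @cint_FTC _ 0 1 (fun t => f (rc t * z)) (fun t => f' (rc t * z) * z) ler01 _ gc.
rewrite (_ : rc 1 = 1) // mul1r (_ : rc 0 = 0) // mul0r => H.
have {H} <- : cint 0 1 (fun t => f' (rc t * z) * z) + f 0 = f z.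
  rewrite H ?subrK // => t /rt h; apply: (@rderiv_comp _ f (fun t => rc t * z)); first exact: dw.
  by apply: analytic_is_cderiv hf.1 _; exact: le_lt_trans r1.
apply: le_trans (ler_cmodD _ _) _; rewrite mulrDl mul1r addrC; apply: lerD; first exact: f0_le_Hnorm.
apply: le_trans (@cint_bound _ 0 1 _ (k * Hnorm omega f) ler01 gc _) _; last by rewrite subr0 mulr1 mulrA.
move=> t /rt h; rewrite cmodM; apply: le_trans (_ : cmod (f' (rc t * z)) * 1 <= _).
  by rewrite ler_wpM2l ?cmod_ge0 // (le_trans zr) // ltW.
by rewrite mulr1; exact: dk.
Qed.

End HSpace.

(** * Blaschke factors and the Green function *)

Section Blaschke.
Variable R : realType.
Implicit Types (a z w : cplx R).

Definition bden a z : cplx R := 1 - (cconj a : cplx R) * z.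

Definition blas a z : cplx R := (z - a) / bden a z.

Lemma bden_sqr a z : cmod (bden a z) ^+ 2 - cmod (z - a) ^+ 2 = (1 - cmod a ^+ 2) * (1 - cmod z ^+ 2).
Proof.
case: a => a1 a2; case: z => z1 z2; rewrite !cmod_sqr /bden /cconj !(cplxD1, cplxD2, cplxN1, cplxN2, cplxM1, cplxM2) /=.
ring.
Qed.

Lemma bden_ge a z : 1 - cmod a * cmod z <= cmod (bden a z).
Proof. by have := ler_cmodB 1 ((cconj a : cplx R) * z); rewrite cmod1 cmodM cmod_conj. Qed.

Lemma bden_ge1 a z (r : R) : cmod a <= r -> cmod z <= 1 -> 1 - r <= cmod (bden a z).
Proof.
move=> ar z1; apply: le_trans (bden_ge a z); rewrite lerD2l lerN2.
by apply: le_trans ar; rewrite ler_piMr ?cmod_ge0.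
Qed.

Lemma bden_gt0 a z : cmod a < 1 -> cmod z <= 1 -> 0 < cmod (bden a z).
Proof. by move=> a1 z1; apply: lt_le_trans (bden_ge1 (lexx _) z1); rewrite subr_gt0. Qed.

Lemma bden_neq0 a z : cmod a < 1 -> cmod z <= 1 -> bden a z != 0.
Proof. by move=> a1 z1; rewrite -cmod_gt0 bden_gt0. Qed.

Lemma bden_le a z : cmod a <= 1 -> cmod z <= 1 -> cmod (bden a z) <= 2.
Proof.
move=> a1 z1; apply: le_trans (ler_cmodB' _ _) _; rewrite cmod1 cmodM cmod_conj.
by have := ler_pM (cmod_ge0 _) (cmod_ge0 _) a1 z1; lra.
Qed.

Lemma bden_sym a z : cmod (bden a z) = cmod (bden z a).
Proof.
have -> : bden z a = cconj (bden a z).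
  by apply: cplx_eq; rewrite /bden /cconj !(cplxD1, cplxD2, cplxN1, cplxN2, cplxM1, cplxM2) /=; ring.
by rewrite cmod_conj.
Qed.

Lemma blas_le1 a z : cmod a < 1 -> cmod z <= 1 -> cmod (blas a z) <= 1.
Proof.
move=> a1 z1; have d0 := bden_gt0 a1 z1; rewrite cmod_div ler_pdivrMr // mul1r.
rewrite -(@ler_pXn2r _ 2) ?nnegrE ?cmod_ge0 // -subr_ge0 bden_sqr.
by rewrite mulr_ge0 // subr_ge0 expr_le1 ?cmod_ge0 // ltW.
Qed.

(** The modulus dominates its square, whose defect from 1 is given by [bden_sqr]. Hence the factor
    tends to 1 at the unit circle, uniformly in [a]. *)
Lemma blas_lower a z (r : R) : cmod a <= r -> r < 1 -> cmod z <= 1 ->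
  1 - (1 - cmod z ^+ 2) / (1 - r) ^+ 2 <= cmod (blas a z).
Proof.
move=> ar r1 z1; have a1 : cmod a < 1 by apply: le_lt_trans r1.
have d0 := bden_gt0 a1 z1; have d1 := bden_ge1 ar z1.
have b0 := cmod_ge0 (blas a z); have b1 := blas_le1 a1 z1.
apply: le_trans (_ : cmod (blas a z) ^+ 2 <= _); last by rewrite expr2 ler_piMl.
rewrite cmod_div expr_div_n lerBlDr -lerBlDl.
have e : 1 - cmod (z - a) ^+ 2 / cmod (bden a z) ^+ 2 = ((1 - cmod a ^+ 2) * (1 - cmod z ^+ 2)) / cmod (bden a z) ^+ 2.
  by rewrite -bden_sqr mulrBl divff // expf_neq0 // gt_eqF.
rewrite e; have z2 : 0 <= 1 - cmod z ^+ 2 by rewrite subr_ge0 expr_le1 ?cmod_ge0.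
apply: ler_pM; rewrite ?invr_ge0 ?sqr_ge0 //.
- by rewrite mulr_ge0 // subr_ge0 expr_le1 ?cmod_ge0 // ltW.
- by rewrite ler_piMl // gerBl sqr_ge0.
rewrite lef_pV2 ?posrE ?exprn_gt0 ?subr_gt0 // ler_pXn2r ?nnegrE ?cmod_ge0 // subr_ge0 ltW //.
Qed.

Lemma bden_deriv a z : is_cderiv (bden a) z (- (cconj a : cplx R)).
Proof.
have := is_cderivB (is_cderiv_cst (1 : cplx R) z) (is_cderivZ (cconj a : cplx R) (is_cderiv_id z)).
by rewrite mulr1 sub0r.
Qed.

Lemma blas_deriv a z : cmod a < 1 -> cmod z <= 1 ->
  is_cderiv (blas a) z (rc (1 - cmod a ^+ 2) / bden a z ^+ 2).
Proof.
move=> a1 z1; have d0 := bden_neq0 a1 z1.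
have := is_cderivM (is_cderivB (is_cderiv_id z) (is_cderiv_cst a z)) (is_cderiv_inv d0 (bden_deriv a z)).
have -> // : (1 - 0) * (bden a z)^-1 + (z - a) * (- bden a z ^- 2 * - (cconj a : cplx R)) =
  rc (1 - cmod a ^+ 2) / bden a z ^+ 2.
rewrite rcB -cmul_conj (_ : rc 1 = 1) //.
have -> : (1 - 0) / bden a z = bden a z / bden a z ^+ 2 by field.
by rewrite /bden; field.
Qed.

Lemma blas_deriv_le a z (r : R) : cmod a <= r -> r < 1 -> cmod z <= 1 ->
  cmod (rc (1 - cmod a ^+ 2) / bden a z ^+ 2) <= (1 - r) ^- 2.
Proof.
move=> ar r1 z1; have a1 : cmod a < 1 by apply: le_lt_trans r1.
have d1 := bden_ge1 ar z1; rewrite cmod_div cmodX cmod_rc ger0_norm; last first.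
  by rewrite subr_ge0 expr_le1 ?cmod_ge0 // ltW.
rewrite -[leRHS]mul1r; apply: ler_pM; rewrite ?invr_ge0 ?sqr_ge0 //.
- by rewrite subr_ge0 expr_le1 ?cmod_ge0 // ltW.
- by rewrite gerBl sqr_ge0.
rewrite lef_pV2 ?posrE ?exprn_gt0 ?subr_gt0 ?bden_gt0 // ler_pXn2r ?nnegrE ?cmod_ge0 // subr_ge0 ltW //.
Qed.

Definition blasp (s : seq (cplx R)) z : cplx R := \prod_(a <- s) blas a z.

Lemma blasp_le1 (s : seq (cplx R)) z : (forall a, a \in s -> cmod a < 1) -> cmod z <= 1 ->
  cmod (blasp s z) <= 1.
Proof.
move=> hs z1; rewrite /blasp cmod_prod big_seq.
suff /andP[] : 0 <= \prod_(a <- s | a \in s) cmod (blas a z) <= 1 by [].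
apply: (big_ind (fun x : R => 0 <= x <= 1)) => [|x y /andP[x0 x1] /andP[y0 y1]|a /hs a1].
- by rewrite ler01 lexx.
- by rewrite mulr_ge0 //= -[leRHS](mulr1 1) ler_pM.
- by rewrite cmod_ge0 blas_le1.
Qed.

(** The finite values of [green]; on the diagonal the conventions for division and [ln] give 0. *)
Definition gr z w : R := ln (cmod (bden w z) / cmod (z - w)).

Lemma greenE z w : green z w = if z == w then +oo%E else (gr z w)%:E.
Proof. by []. Qed.

Lemma gr_sym z w : gr z w = gr w z.
Proof. by rewrite /gr bden_sym cmodBC. Qed.

Lemma green_sym z w : green z w = green w z.
Proof. by rewrite !greenE eq_sym gr_sym. Qed.

Lemma gr_blas z w : cmod z < 1 -> cmod w < 1 -> z != w -> cmod (blas w z) = expR (- gr z w).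
Proof.
move=> z1 w1 zw; have d0 := bden_gt0 w1 (ltW z1).
have n0 : 0 < cmod (z - w) by rewrite cmod_gt0 subr_eq0.
by rewrite /gr -lnV ?posrE ?divr_gt0 // invf_div lnK ?posrE ?divr_gt0 // cmod_div.
Qed.

Lemma gr_ge0 z w : cmod z < 1 -> cmod w < 1 -> 0 <= gr z w.
Proof.
move=> z1 w1; have [->|zw] := eqVneq z w; first by rewrite /gr subrr cmod0 invr0 mulr0 ln0.
have := blas_le1 w1 (ltW z1); rewrite gr_blas // -{1}expR0 ler_expR oppr_le0 //.
Qed.

Lemma green_ge0 z w : cmod z < 1 -> cmod w < 1 -> (0 <= green z w)%E.
Proof. by move=> z1 w1; rewrite greenE; case: ifP => // _; rewrite lee_fin gr_ge0. Qed.

End Blaschke.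

(** * Potentials and energies for a symmetric kernel *)

Section ProbabilityOfMeasure.
Context {d : measure_display} {T : measurableType d} {R : realType}.
Variables (m : {measure set T -> \bar R}) (m1 : m setT = 1%E).

(** The proof of total mass one is an argument so that a probability structure can be attached to
    the resulting function. *)
Definition as_probability (_ : m setT = 1%E) : set T -> \bar R := m.

HB.instance Definition _ := Measure.on (as_probability m1).

HB.instance Definition _ := Measure_isProbability.Build _ _ _ (as_probability m1) m1.

Lemma probability_of_measure : exists p : probability T R,
  (forall A, p A = m A) /\ forall f : T -> \bar R, (\int[p]_x f x = \int[m]_x f x)%E.
Proof. by exists (as_probability m1 : probability T R). Qed.

End ProbabilityOfMeasure.

Section Kernel.
Context {d : measure_display} {T : measurableType d} {R : realType}.
Variable G : T -> T -> \bar R.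
Hypothesis G0 : forall x y, (0 <= G x y)%E.
Hypothesis GC : forall x y, G x y = G y x.
Hypothesis Gm : measurable_fun setT (fun p : T * T => G p.1 p.2).
Implicit Types (nu : probability T R) (s : seq T) (B : set T).
Local Open Scope ereal_scope.

Definition pot s x := \sum_(y <- s) G x y.

(** Each unordered pair counts once, hence the binomial coefficients below and the doubling in
    [sum_pot_drop_nth]. *)
Fixpoint conf_energy s := if s is x :: s' then pot s' x + conf_energy s' else 0.

Definition avg_pot nu x := \int[nu]_y G x y.

Definition kenergy nu := \int[nu]_x avg_pot nu x.

Lemma kernel_measurable x : measurable_fun setT (G x).
Proof. exact: (measurableT_comp Gm (pair1_measurable x)). Qed.

Lemma pot_ge0 s x : 0 <= pot s x.
Proof. exact: sume_ge0. Qed.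

Lemma conf_energy_ge0 s : 0 <= conf_energy s.
Proof. by elim: s => //= x s IH; rewrite adde_ge0 // pot_ge0. Qed.

Lemma measurable_pot s : measurable_fun setT (pot s).
Proof.
apply: emeasurable_sum => y; apply: eq_measurable_fun (kernel_measurable y) => x _.
exact: GC.
Qed.

Lemma avg_pot_ge0 nu x : 0 <= avg_pot nu x.
Proof. exact: integral_ge0. Qed.

Lemma measurable_avg_pot nu : measurable_fun setT (avg_pot nu).
Proof. exact: (@measurable_fun_fubini_tonelli_F _ _ T T R nu _ Gm (fun p => G0 _ _)). Qed.

Lemma pot_cons y s x : pot (y :: s) x = G x y + pot s x.
Proof. exact: big_cons. Qed.

Lemma integral_pot nu s : \int[nu]_x pot s x = \sum_(y <- s) avg_pot nu y.
Proof.
rewrite /pot ge0_integral_sum //; last first.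
  by move=> y; apply: eq_measurable_fun (kernel_measurable y) => x _; exact: GC.
by apply: eq_bigr => y _; apply: eq_integral => x _; exact: GC.
Qed.

Lemma probability_cst nu (c : \bar R) : \int[nu]_x c = c.
Proof.
rewrite integral_cst //.
have e : nu setT = 1 := probability_setT nu.
by rewrite [X in _ * X](_ : _ = 1) ?mule1.
Qed.

Lemma le_integral_supp nu B (f g : T -> \bar R) : measurable B -> nu (~` B) = 0 ->
  (forall x, 0 <= f x) -> measurable_fun setT f -> (forall x, 0 <= g x) -> measurable_fun setT g ->
  (forall x, B x -> f x <= g x) -> \int[nu]_x f x <= \int[nu]_x g x.
Proof.
move=> mB nB f0 mf g0 mg fg; apply: ae_ge0_le_integral => //.
exists (~` B); split => //; first exact: measurableC.
by move=> x /= h Bx; apply: h => _; exact: fg.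
Qed.

Lemma le_avg nu B (c : \bar R) (g : T -> \bar R) : measurable B -> nu (~` B) = 0 ->
  0 <= c -> (forall x, 0 <= g x) -> measurable_fun setT g ->
  (forall x, B x -> c <= g x) -> c <= \int[nu]_x g x.
Proof.
move=> mB nB c0 g0 mg cg; rewrite -[leLHS](probability_cst nu).
by apply: (le_integral_supp mB).
Qed.

(* Integrating the points of a configuration one at a time against [nu]. *)
Lemma conf_energy_avg nu B (m : \bar R) (k N : nat) s : measurable B -> nu (~` B) = 0 -> 0 <= m ->
  (forall t, size t = N -> {in t, forall x, B x} -> m <= conf_energy t) ->
  (size s + k = N)%N -> {in s, forall x, B x} ->
  m <= conf_energy s + k%:R%:E * \sum_(y <- s) avg_pot nu y + 'C(k, 2)%:R%:E * kenergy nu.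
Proof.
move=> mB nB m0 hm; elim: k s => [|k IH] s sk sB.
  by rewrite bin0n /= !mul0e !adde0; apply: hm => //; rewrite -sk addn0.
pose S := \sum_(y <- s) avg_pot nu y.
have S0 : 0 <= S by apply: sume_ge0 => y _; exact: avg_pot_ge0.
have I0 : 0 <= kenergy nu by apply: integral_ge0 => x _; exact: avg_pot_ge0.
have e0 := conf_energy_ge0 s.
have k0 : 0 <= k%:R%:E :> \bar R by rewrite lee_fin.
have b0 : 0 <= 'C(k, 2)%:R%:E :> \bar R by rewrite lee_fin.
have c0 : 0 <= conf_energy s + k%:R%:E * S + 'C(k, 2)%:R%:E * kenergy nu by rewrite !adde_ge0 ?mule_ge0.
pose g x := pot s x + (k%:R%:E * avg_pot nu x + (conf_energy s + k%:R%:E * S + 'C(k, 2)%:R%:E * kenergy nu)).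
have mka : measurable_fun setT (fun x => k%:R%:E * avg_pot nu x).
  by apply: measurable_funeM; exact: measurable_avg_pot.
have mg : measurable_fun setT g.
  apply: emeasurable_funD; first exact: measurable_pot.
  by apply: emeasurable_funD.
have a0 x : 0 <= k%:R%:E * avg_pot nu x by rewrite mule_ge0 // avg_pot_ge0.
have -> : conf_energy s + k.+1%:R%:E * S + 'C(k.+1, 2)%:R%:E * kenergy nu = \int[nu]_x g x.
  rewrite /g ge0_integralD //; [|by move=> x _; rewrite pot_ge0|exact: measurable_pot|
    by move=> x _; rewrite adde_ge0|exact: emeasurable_funD].
  rewrite ge0_integralD // integral_pot probability_cst ge0_integralZl_EFin //; [|by move=> x _; exact: avg_pot_ge0|
    exact: measurable_avg_pot].
  rewrite -/(kenergy nu) -/S binS bin1 natrD -natr1 EFinD EFinD !ge0_muleDl ?lee_fin // mul1e.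
  by rewrite [RHS](AC (1*(1*3))%AC ((3*(4*1))*(5*2))%AC).
have g0 x : 0 <= g x by apply: adde_ge0; [exact: pot_ge0|apply: adde_ge0; [exact: a0|exact: c0]].
apply: (le_avg mB nB m0 g0 mg) => x Bx.
apply: le_trans (IH (x :: s) _ _) _; [by rewrite /= addSnnS|by move=> y; rewrite inE => /predU1P[->//|/sB]|].
rewrite /g /= big_cons ge0_muleDr ?avg_pot_ge0 //.
by rewrite [leLHS](AC (2*2*1)%AC (1*(3*(2*4*5)))%AC).
Qed.

Lemma conf_energy_le_kenergy nu B (m : \bar R) N : measurable B -> nu (~` B) = 0 -> 0 <= m ->
  (forall t, size t = N -> {in t, forall x, B x} -> m <= conf_energy t) ->
  m <= 'C(N, 2)%:R%:E * kenergy nu.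
Proof.
move=> mB nB m0 hm; have := @conf_energy_avg nu B m N N [::] mB nB m0 hm erefl.
by rewrite big_nil mule0 adde0 add0e; apply.
Qed.

Definition drop_nth (i : nat) s := take i s ++ drop i.+1 s.

Lemma drop_nth_cons x i s : drop_nth i.+1 (x :: s) = x :: drop_nth i s.
Proof. by []. Qed.

Lemma size_drop_nth i s : (i < size s)%N -> size (drop_nth i s) = (size s).-1.
Proof.
elim: s i => //= x s IH [|i] // h; first by rewrite /drop_nth take0 /= drop0.
by rewrite drop_nth_cons /= IH // prednK // (leq_ltn_trans (leq0n i)).
Qed.

Lemma mem_drop_nth i s : {subset drop_nth i s <= s}.
Proof. by move=> x; rewrite mem_cat => /orP[/mem_take|/mem_drop]. Qed.

Lemma sum_drop_nth x0 (F : T -> \bar R) i s : (i < size s)%N ->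
  \sum_(y <- s) F y = F (nth x0 s i) + \sum_(y <- drop_nth i s) F y.
Proof.
elim: s i => //= x s IH [|i] h; first by rewrite /drop_nth take0 /= drop0 big_cons.
by rewrite drop_nth_cons !big_cons (IH i) // addeCA.
Qed.

Lemma conf_energy_drop_nth x0 i s : (i < size s)%N ->
  conf_energy s = pot (drop_nth i s) (nth x0 s i) + conf_energy (drop_nth i s).
Proof.
elim: s i => //= x s IH [|i] h; first by rewrite /drop_nth take0 /= drop0.
rewrite drop_nth_cons /= pot_cons {1}/pot (sum_drop_nth x0 _ h) -/(pot _ _) (IH i) // GC.
by rewrite [LHS](AC (2*2)%AC ((1*3)*(2*4))%AC).
Qed.

Lemma sum_pot_drop_nth x0 s :
  \sum_(i < size s) pot (drop_nth i s) (nth x0 s i) = conf_energy s + conf_energy s.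
Proof.
elim: s => [|x s IH]; first by rewrite big_ord0 adde0.
rewrite /= big_ord_recl /= {1}/drop_nth take0 /= drop0.
under eq_bigr do rewrite drop_nth_cons pot_cons GC add0n.
have p : pot s x = \sum_(i < size s) G x (nth x0 s i) by rewrite /pot (big_nth x0) big_mkord.
rewrite big_split /= IH -p.
by rewrite [LHS](AC (1*(1*2))%AC ((1*3)*(2*4))%AC).
Qed.

(** Near-minimizers with slack 1 replace Fekete points, so [B] need not be compact. The measure [nu]
    keeps the infimum finite. *)
Lemma near_fekete nu B N : measurable B -> nu (~` B) = 0 -> kenergy nu < +oo ->
  exists s, [/\ size s = N, {in s, forall x, B x}, conf_energy s < +oo,
    conf_energy s <= 'C(N, 2)%:R%:E * kenergy nu + 1 &
    forall t, size t = N -> {in t, forall x, B x} -> conf_energy s <= conf_energy t + 1].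
Proof.
move=> mB nB I1.
pose E := [set conf_energy t | t in [set t | size t = N /\ {in t, forall x, B x}]].
have E0 : 0 <= ereal_inf E by apply: le_ereal_inf_tmp => _ [t _ <-]; exact: conf_energy_ge0.
have EI : ereal_inf E <= 'C(N, 2)%:R%:E * kenergy nu.
  apply: (conf_energy_le_kenergy mB nB) => // t tN tB.
  by apply: ereal_inf_lbound; exists t.
have I0 : 0 <= kenergy nu by apply: integral_ge0 => x _; exact: avg_pot_ge0.
have If : kenergy nu \is a fin_num by rewrite ge0_fin_numE.
have Ef : ereal_inf E \is a fin_num.
  by rewrite ge0_fin_numE // (le_lt_trans EI) // -(fineK If) -EFinM ltry.
have [_ [s [sN sB] <-] hs] := lb_ereal_inf_adherent (@ltr01 R) Ef.
exists s; split => //; first by apply: lt_le_trans hs _; rewrite leey.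
  by apply: le_trans (ltW hs) _; rewrite leeD2r.
move=> t tN tB; apply: le_trans (ltW hs) _; rewrite leeD2r //.
by apply: ereal_inf_lbound; exists t.
Qed.

(** Moving the i-th point to [w] leaves the energy of the other points unchanged; that energy is
    finite and cancels. *)
Lemma near_fekete_swap x0 B s (N i : nat) w : size s = N -> {in s, forall x, B x} -> conf_energy s < +oo ->
  (forall t, size t = N -> {in t, forall x, B x} -> conf_energy s <= conf_energy t + 1) ->
  (i < N)%N -> B w -> pot (drop_nth i s) (nth x0 s i) <= pot (drop_nth i s) w + 1.
Proof.
move=> sN sB sf sm iN Bw; have iN' : (i < size s)%N by rewrite sN.
have := sm (w :: drop_nth i s); rewrite (conf_energy_drop_nth x0 iN') /= size_drop_nth // sN prednK; last first.
  exact: leq_ltn_trans iN.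
move=> /(_ erefl); have h : {in w :: drop_nth i s, forall x, B x}.
  by move=> x; rewrite inE => /predU1P[->//|/mem_drop_nth/sB].
move=> /(_ h); rewrite -addeAC leeD2rE //.
rewrite ge0_fin_numE ?conf_energy_ge0 //; apply: le_lt_trans sf.
by rewrite (conf_energy_drop_nth x0 iN') leeDr // pot_ge0.
Qed.

Lemma sum_cst_le (eta : R) (N : nat) s : (0 <= eta)%R -> (size s <= N)%N ->
  \sum_(y <- s) eta%:E <= (N%:R * eta)%:E.
Proof.
move=> e0 sN; rewrite sumEFin big_const_seq count_predT iter_addr_0 -[in leLHS]mulr_natl lee_fin.
by rewrite ler_wpM2r // ler_nat.
Qed.

(* [tau] replaces the point mass at [y]: its potential is nowhere large and exceeds that of [y] by at most [eta]. *)
Definition smears (tau : probability T R) B K (eta C : R) y :=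
  [/\ tau (~` B) = 0, forall z, K z -> avg_pot tau z <= G z y + eta%:E &
    forall z, K z -> avg_pot tau z <= C%:E].

Lemma exists_le_mean (f : nat -> \bar R) (N : nat) (c : R) : (0 < N)%N ->
  \sum_(i < N) f i <= (N%:R * c)%:E -> exists2 i, (i < N)%N & f i <= c%:E.
Proof.
move=> N0 h; apply: contrapT => hn; move: h; apply/negP; rewrite -ltNge.
have {}hn i : (i < N)%N -> c%:E < f i.
  by move=> iN; rewrite ltNge; apply/negP => h; apply: hn; exists i.
case: N N0 hn => // N _; elim: N => [|N IH] hn; first by rewrite big_ord1 mul1r hn.
rewrite big_ord_recr /= -natr1 mulrDl mul1r EFinD; apply: lteD; last exact: hn.
by apply: IH => i iN; apply: hn; exact: ltnW.
Qed.

Lemma exists_ge_mean (f : nat -> \bar R) (N : nat) (c : R) : (0 < N)%N ->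
  (N%:R * c)%:E <= \sum_(i < N) f i -> exists2 i, (i < N)%N & c%:E <= f i.
Proof.
move=> N0 h; apply: contrapT => hn; move: h; apply/negP; rewrite -ltNge.
have {}hn i : (i < N)%N -> f i < c%:E.
  by move=> iN; rewrite ltNge; apply/negP => h; apply: hn; exists i.
case: N N0 hn => // N _; elim: N => [|N IH] hn; first by rewrite big_ord1 mul1r hn.
rewrite big_ord_recr /= -natr1 mulrDl mul1r EFinD; apply: lteD; last exact: hn.
by apply: IH => i iN; apply: hn; exact: ltnW.
Qed.

(** Some point [j] has potential at most the mean, about [N * J]. Any other point may be moved to
    any place of [B], so its potential is at most an average over the smear of [j], which costs
    [eta] per remaining point and [C] for [j] itself. Of the final 3, two come from the slack in the
    energy, counted twice, and one from the swap. *)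
Lemma low_max_pot nu B (J eta C : R) N : measurable B -> nu (~` B) = 0 ->
  kenergy nu <= J%:E -> (0 <= eta)%R -> (forall y, B y -> exists tau, smears tau B B eta C y) -> (0 < N)%N ->
  exists s, [/\ size s = N, {in s, forall x, B x} & forall i, (i < N)%N ->
    pot (drop_nth i s) (nth point s i) <= (N%:R * (J + eta) + C + 3)%:E].
Proof.
move=> mB nB IJ eta0 hs N0; have If : kenergy nu < +oo by apply: le_lt_trans IJ _; rewrite ltry.
have [s [sN sB sf sI sm]] := near_fekete N mB nB If; exists s; split => // i iN.
have [j jN hj] : exists2 j, (j < N)%N & pot (drop_nth j s) (nth point s j) <= (N%:R * J + 2)%:E.
  apply: exists_le_mean => //; rewrite -sN sum_pot_drop_nth sN.
  have J0 : (0 <= J)%R.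
    by rewrite -lee_fin (le_trans _ IJ) //; apply: integral_ge0 => x _; exact: avg_pot_ge0.
  have h : conf_energy s <= ('C(N, 2)%:R * J + 1)%:E.
    by apply: le_trans sI _; rewrite EFinD EFinM leeD2r // lee_wpmul2l // lee_fin.
  apply: le_trans (leeD h h) _; rewrite -EFinD lee_fin.
  have c2 : ('C(N, 2) + 'C(N, 2) <= N * N)%N.
    rewrite bin2 addnn; apply: leq_trans (_ : N * N.-1 <= _)%N; last by rewrite leq_mul2l leq_pred orbT.
    by rewrite -[leqRHS]odd_double_half leq_addl.
  have {}c2 : ('C(N, 2)%:R + 'C(N, 2)%:R <= N%:R * N%:R :> R)%R by rewrite -natrD -natrM ler_nat.
  have N1 : (1 <= N%:R :> R)%R by rewrite ler1n.
  have := ler_wpM2r J0 c2; move: N1; move: 'C(N, 2)%:R N%:R => c n; lra.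
have jN' : (j < size s)%N by rewrite sN.
have [tau [tB t1 t2]] := hs (nth point s j) (sB _ (mem_nth _ jN')).
have : pot (drop_nth i s) (nth point s i) <= \int[tau]_w (pot (drop_nth i s) w + 1).
  apply: (le_avg mB tB).
  - exact: pot_ge0.
  - by move=> x; rewrite adde_ge0 // pot_ge0.
  - by apply: emeasurable_funD => //; exact: measurable_pot.
  - by move=> w Bw; apply: near_fekete_swap sm _ _.
move/le_trans; apply; rewrite ge0_integralD //; [|by move=> x _; exact: pot_ge0|exact: measurable_pot].
rewrite probability_cst integral_pot.
have : \sum_(y <- drop_nth i s) avg_pot tau y <= \sum_(y <- s) avg_pot tau y.
  by rewrite [leRHS](@sum_drop_nth point _ i) ?sN // leeDr // avg_pot_ge0.
have : \sum_(y <- s) avg_pot tau y <= C%:E + \sum_(y <- drop_nth j s) (G (nth point s j) y + eta%:E).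
  rewrite [leLHS](@sum_drop_nth point _ j) //; apply: leeD; first by apply/t2/sB/mem_nth.
  rewrite big_seq [leRHS]big_seq; apply: lee_sum => y /mem_drop_nth/sB By.
  by rewrite GC; exact: t1.
move=> h1 h2; apply: le_trans (leeD2r _ (le_trans h2 h1)) _.
rewrite [X in _ + X + _]big_split /= -/(pot _ _).
apply: le_trans (_ : C%:E + ((N%:R * J + 2)%:E + (N%:R * eta)%:E) + 1 <= _); last first.
  by rewrite -!EFinD lee_fin; lra.
rewrite leeD2r // leeD2l // leeD // sum_cst_le //.
by rewrite (leq_trans _ (leqnn N)) // size_drop_nth // sN leq_pred.
Qed.

Lemma mixture (tau : nat -> probability T R) (N : nat) : (0 < N)%N ->
  exists mu : probability T R, (forall f, measurable_fun setT f -> (forall x, 0 <= f x) ->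
      \int[mu]_x f x = (N%:R^-1)%:E * \sum_(i < N) \int[tau i]_x f x) /\
    (forall A, (forall i, (i < N)%N -> tau i A = 0) -> mu A = 0).
Proof.
move=> N0; have c0 : (0 <= N%:R^-1 :> R)%R by rewrite invr_ge0.
have [|mu [mu1 mu2]] := @probability_of_measure _ _ _ (mscale (NngNum c0) (msum tau N)).
  rewrite /= /mscale /= /msum /= (eq_bigr (fun=> 1)); last by move=> i _; exact: probability_setT.
  by rewrite sumEFin sumr_const card_ord -EFinM mulVf // pnatr_eq0 -lt0n.
exists mu; split => [f mf f0|A hA].
  by rewrite mu2 ge0_integral_mscale // ge0_integral_measure_sum.
by rewrite mu1 /= /mscale /= /msum /= big1 ?mule0 // => i _; exact: hA.
Qed.

(** Distinct positions lose [eta] twice, once for each smeared variable, by symmetry. Each diagonal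
    term, infinite for point masses, is at most [C]. *)
Lemma kenergy_mixture (tau : T -> probability T R) (eta C : R) B K s (N := size s) :
  (0 < N)%N -> (0 <= eta)%R -> measurable B -> B `<=` K -> (forall y, y \in s -> K y) ->
  (forall y, y \in s -> smears (tau y) B K eta C y) ->
  exists mu : probability T R, mu (~` B) = 0 /\
    (N%:R * N%:R)%:E * kenergy mu <= conf_energy s + conf_energy s + (N%:R * (N%:R * (2 * eta) + C))%:E.
Proof.
move=> N0 eta0 mB BK sK hs; pose x0 : T := point; have [mu [mu1 mu2]] := mixture (fun i => tau (nth x0 s i)) N0.
exists mu; split; first by apply: mu2 => i iN; have [] := hs _ (mem_nth x0 iN).
have Nn : N%:R != 0%R :> R by rewrite pnatr_eq0 -lt0n.
pose H x := \sum_(y <- s) avg_pot (tau y) x.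
have H0 x : 0 <= H x by apply: sume_ge0 => y _; exact: avg_pot_ge0.
have mH : measurable_fun setT H by apply: emeasurable_sum => y; exact: measurable_avg_pot.
have avE x : avg_pot mu x = (N%:R^-1)%:E * H x.
  rewrite /avg_pot mu1 //; last exact: kernel_measurable.
  by congr (_ * _); rewrite /H (big_nth x0) big_mkord.
have -> : (N%:R * N%:R)%:E * kenergy mu = \sum_(i < N) \int[tau (nth x0 s i)]_x H x.
  rewrite /kenergy (eq_integral (fun x => (N%:R^-1)%:E * H x)); last by move=> x _; exact: avE.
  rewrite ge0_integralZl_EFin // ?invr_ge0 // mu1 // !muleA -!EFinM mulfK // divff // mul1e //.
rewrite -(sum_pot_drop_nth x0) -/N.
apply: le_trans (_ : \sum_(i < N) (pot (drop_nth i s) (nth x0 s i) + (N%:R * (2 * eta) + C)%:E) <= _); last first.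
  by set c := (_ + C)%R; rewrite big_split /= leeD2l // sumEFin sumr_const card_ord mulr_natl.
apply: lee_sum => i _; set y := nth x0 s i.
have ys : y \in s by exact: mem_nth.
have [tB t1 t2] := hs _ ys.
have mA u : measurable_fun setT (avg_pot (tau u)) by exact: measurable_avg_pot.
rewrite /H ge0_integral_sum //; last by move=> u x _; exact: avg_pot_ge0.
rewrite (@sum_drop_nth x0 _ i) // -/y.
rewrite [leRHS](_ : _ = C%:E + (pot (drop_nth i s) y + (N%:R * (2 * eta))%:E)); last first.
  by rewrite EFinD [RHS]addeC addeA.
apply: leeD.
  apply: le_trans (_ : \int[tau y]_x C%:E <= _); last by rewrite probability_cst.
  apply: (le_integral_supp mB tB) => // [x|x|x Bx]; first exact: avg_pot_ge0.
    by apply: le_trans (t2 y (sK _ ys)); exact: avg_pot_ge0.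
  by apply: t2; exact: BK.
apply: le_trans (_ : \sum_(u <- drop_nth i s) (G y u + (2 * eta)%:E) <= _); last first.
  rewrite big_split /= leeD2l // sum_cst_le ?mulr_ge0 //.
  by rewrite size_drop_nth // leq_pred.
rewrite big_seq [leRHS]big_seq; apply: lee_sum => u /mem_drop_nth us.
have [uB u1 u2] := hs _ us.
have mGu : measurable_fun setT (fun x => G x u).
  by apply: eq_measurable_fun (kernel_measurable u) => x _; exact: GC.
apply: le_trans (_ : \int[tau y]_x (G x u + eta%:E) <= _).
  apply: (le_integral_supp mB tB) => // [x|x||x Bx]; first exact: avg_pot_ge0.
  - by rewrite adde_ge0 // lee_fin.
  - exact: emeasurable_funD.
  - by apply: u1; exact: BK.
rewrite ge0_integralD // probability_cst.
rewrite mulr2n mulrDl mul1r EFinD addeA leeD2r //.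
have -> : \int[tau y]_x G x u = avg_pot (tau y) u by apply: eq_integral => x _; exact: GC.
by rewrite GC; apply: t1; exact: sK.
Qed.

Lemma smears_sub (tau : probability T R) B B' K (eta C : R) y : measurable B -> measurable B' -> B `<=` B' ->
  smears tau B K eta C y -> smears tau B' K eta C y.
Proof.
move=> mB mB' BB' [tB t1 t2]; split => //; apply: (subset_measure0 _ _ _ tB).
- exact: measurableC.
- exact: measurableC.
- exact: subsetC.
Qed.

(** The mixture of smears has energy at least [v], so among [n.+1] near-minimizers one has a
    potential at least the corresponding mean. Removing it leaves [n] points whose potential
    anywhere on [K] is no smaller, up to 1. The points range over [K], but the competitor must live
    on some [Bn k]. *)
Lemma high_min_pot (K : set T) (Bn : nat -> set T) (eta C v : R) n : measurable K -> K !=set0 ->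
  (forall k, measurable (Bn k)) -> (forall k, Bn k `<=` K) -> (forall k l, (k <= l)%N -> Bn k `<=` Bn l) ->
  (0 <= eta)%R -> (forall y, K y -> exists tau k, smears tau (Bn k) K eta C y) ->
  (forall (mu : probability T R) k, mu (~` Bn k) = 0 -> v%:E <= kenergy mu) ->
  exists s, [/\ size s = n, {in s, forall x, K x} &
    forall w, K w -> (n.+1%:R * (v - 2 * eta) - C - 1)%:E <= pot s w].
Proof.
move=> mK [y0 Ky0] mB BK Bh eta0 hs hv.
have /choice[tau ht] y : exists tau : probability T R, K y -> exists k, smears tau (Bn k) K eta C y.
  have [/hs[t [k h]]|nK] := pselect (K y); first by exists t => _; exists k.
  by have [t [k h]] := hs y0 Ky0; exists t.
have /choice[kk hk] y : exists k, K y -> smears (tau y) (Bn k) K eta C y.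
  have [/ht[k h]|nK] := pselect (K y); first by exists k.
  by exists 0%N.
have [t0 t1 t2] := hk y0 Ky0.
have nK : tau y0 (~` K) = 0.
  by apply: (subset_measure0 _ _ _ t0); [exact: measurableC|exact: measurableC|exact: subsetC].
(* The smear of a single point already has finite energy, so near-minimizers exist on [K]. *)
have If : kenergy (tau y0) < +oo.
  apply: le_lt_trans (ltry C); rewrite -(probability_cst (tau y0) C%:E).
  apply: (le_integral_supp mK nK) => // [x||x]; [exact: avg_pot_ge0|exact: measurable_avg_pot|].
  by apply: le_trans (t2 y0 Ky0); exact: avg_pot_ge0.
have [s [sN sK sf _ sm]] := near_fekete n.+1 mK nK If.
(* There are finitely many points, so one member of the increasing family carries all their
   smears. *)
pose k := \max_(y <- s) kk y.
have sm' y : y \in s -> smears (tau y) (Bn k) K eta C y.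
  move=> ys; apply: smears_sub (hk y (sK _ ys)) => //; apply: Bh.
  by rewrite /k (big_rem y) //= leq_maxl.
have s0 : (0 < size s)%N by rewrite sN.
have [mu [muB muI]] := kenergy_mixture s0 eta0 (mB k) (BK k) sK sm'.
have [i iN hi] : exists2 i, (i < n.+1)%N & (n.+1%:R * (v - 2 * eta) - C)%:E <= pot (drop_nth i s) (nth point s i).
  apply: exists_ge_mean => //; have := sum_pot_drop_nth point s; rewrite sN => ->.
  move: muI; rewrite sN => muI; rewrite -(leeD2rE _ _ (isT : (n.+1%:R * (n.+1%:R * (2 * eta) + C))%:E \is a fin_num)).
  apply: le_trans muI; apply: le_trans (_ : (n.+1%:R * n.+1%:R)%:E * v%:E <= _); last first.
    by rewrite lee_wpmul2l // ?lee_fin ?mulr_ge0 //; exact: hv muB.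
  by rewrite -EFinM -EFinD lee_fin; set m := n.+1%:R; lra.
exists (drop_nth i s); split => [|x /mem_drop_nth/sK//|w Kw].
  by rewrite size_drop_nth sN.
have := le_trans hi (near_fekete_swap point sN sK sf sm iN Kw).
by rewrite -leeBlDr // -EFinB.
Qed.

End Kernel.

(** * The Green function as a nonnegative symmetric kernel *)

Section GreenKernel.
Variable R : realType.
Implicit Types (z w : cplx R) (mu : probability (R * R)%type R).
Local Open Scope ereal_scope.

(* Cut off outside the disk, where [green] may be negative. *)
Definition gker (z w : R * R) : \bar R :=
  if (cmod z < 1)%R && (cmod w < 1)%R then green z w else 0.

Lemma measurable_green : measurable_fun setT (fun p : (R * R) * (R * R) => green p.1 p.2).
Proof.
have m11 : measurable_fun setT (fun p : (R * R) * (R * R) => p.1.1).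
  exact: (measurableT_comp measurable_fst measurable_fst).
have m12 : measurable_fun setT (fun p : (R * R) * (R * R) => p.1.2).
  exact: (measurableT_comp measurable_snd measurable_fst).
have m21 : measurable_fun setT (fun p : (R * R) * (R * R) => p.2.1).
  exact: (measurableT_comp measurable_fst measurable_snd).
have m22 : measurable_fun setT (fun p : (R * R) * (R * R) => p.2.2).
  exact: (measurableT_comp measurable_snd measurable_snd).
have mc (f g : (R * R) * (R * R) -> R) : measurable_fun setT f -> measurable_fun setT g ->
    measurable_fun setT (fun p => cmod (f p, g p)).
  move=> mf mg; exact: (measurableT_comp (@measurable_cmod R) (measurable_fun_pair mf mg)).
have mz : measurable_fun setT (fun p : (R * R) * (R * R) => cmod (p.1 - p.2)%R).
  by apply: mc; apply: measurable_funB.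
have mb : measurable_fun setT (fun p : (R * R) * (R * R) => cmod (bden p.2 p.1)).
  have -> : (fun p : (R * R) * (R * R) => cmod (bden p.2 p.1)) =
    (fun p => cmod (1 - (p.2.1 * p.1.1 + p.2.2 * p.1.2), - (p.2.1 * p.1.2 - p.2.2 * p.1.1))%R).
    apply/funext => -[[a b] [c e]]; congr cmod; apply: cplx_eq;
      rewrite /bden /cconj !(cplxD1, cplxD2, cplxN1, cplxN2, cplxM1, cplxM2) /=; ring.
  apply: mc; first by apply: measurable_funB => //; apply: measurable_funD; apply: measurable_funM.
  by apply: measurableT_comp => //; apply: measurable_funB; apply: measurable_funM.
have -> : (fun p : (R * R) * (R * R) => green p.1 p.2) =
  (fun p => if (cmod (p.1 - p.2)%R == 0)%R then +oo else (gr p.1 p.2)%:E).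
  by apply/funext => -[z w]; rewrite greenE /= cmod_eq0 subr_eq0.
apply: measurable_fun_ifT => //.
  exact: measurable_fun_eqr.
apply/measurable_EFinP; apply: measurableT_comp; first exact: measurable_ln.
apply: measurable_funM => //.
have -> : (fun p : (R * R) * (R * R) => (cmod (p.1 - p.2))^-1)%R =
    (fun p => if cmod (p.1 - p.2) == 0 then 0 else expR (- ln (cmod (p.1 - p.2))))%R.
  apply/funext => p; case: eqP => [->|/eqP h]; first by rewrite invr0.
  by rewrite expRN lnK // posrE lt_def h cmod_ge0.
apply: measurable_fun_ifT => //; first exact: measurable_fun_eqr.
apply: (measurableT_comp (@measurable_expR R)); apply: measurableT_comp => //.
exact: (measurableT_comp (@measurable_ln R) mz).
Qed.

Lemma gker_ge0 z w : 0 <= gker z w.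
Proof. by rewrite /gker; case: ifP => // /andP[z1 w1]; exact: green_ge0. Qed.

Lemma gkerC z w : gker z w = gker w z.
Proof. by rewrite /gker andbC green_sym. Qed.

Lemma measurable_gker : measurable_fun setT (fun p : (R * R) * (R * R) => gker p.1 p.2).
Proof.
apply: measurable_fun_ifT => //; last exact: measurable_green.
have mc : measurable_fun setT (@cmod R : R * R -> R) := @measurable_cmod R.
apply: measurable_and; apply: measurable_fun_ltr => //.
  exact: measurableT_comp mc measurable_fst.
exact: measurableT_comp mc measurable_snd.
Qed.

(** [green] has no sign outside the disk, so Tonelli is applied to its positive and negative
    parts. *)
Lemma measurable_green_pot mu : measurable_fun setT (fun z : R * R => \int[mu]_w green z w).
Proof.
pose g (p : (R * R) * (R * R)) := green p.1 p.2.
have mp := @measurable_fun_fubini_tonelli_F _ _ _ _ R mu _ (measurable_funepos measurable_green) (funepos_ge0 _).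
have mn := @measurable_fun_fubini_tonelli_F _ _ _ _ R mu _ (measurable_funeneg measurable_green) (funeneg_ge0 _).
have -> : (fun z : R * R => \int[mu]_w green z w) = (fun z => fubini_F mu g^\+ z - fubini_F mu g^\- z).
  by apply/funext => z; rewrite integralE /fubini_F; congr (_ - _); apply: eq_integral => w _; rewrite ?funeposE ?funenegE.
exact: emeasurable_funB.
Qed.

Lemma green_energyE mu (B : set (R * R)) : measurable B -> B `<=` disk -> mu (~` B) = 0 ->
  green_energy mu = kenergy gker mu.
Proof.
move=> mB Bd nB; have BC : measurable (~` B) by exact: measurableC.
rewrite /green_energy /kenergy; apply: ae_eq_integral => //.
- exact: measurable_green_pot.
- exact: (@measurable_avg_pot _ _ _ gker gker_ge0 measurable_gker).
exists (~` B); split => // z /= h Bz; apply: h => _.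
rewrite /avg_pot; apply: ae_eq_integral => //.
- exact: (measurableT_comp measurable_green (pair1_measurable z)).
- exact: (measurableT_comp measurable_gker (pair1_measurable z)).
exists (~` B); split => // w /= h Bw; apply: h => _.
have := Bd _ Bz; have := Bd _ Bw; rewrite /disk /= /gker => -> ->; by [].
Qed.

End GreenKernel.

(** * Smearing a point along an arc of the image *)

Section Singularity.
Variable R : realType.
Implicit Types (x y t : R).
Local Notation mu := (@lebesgue_measure R).

(* [|x| ^ (-1/2) <= sing_weight x], written as a series of indicators so that its integral is elementary. *)
Definition sing_weight x : \bar R :=
  (1 + \sum_(0 <= k <oo) (2 * 2 ^+ k * (`|x| <= 4 ^- k)%R%:R)%:E)%E.

(** The logarithmic singularity is traded for an inverse square root, [c] playing the root of the
    modulus of [y]. The chain of lower bounds ends at [(c / (1 + c)) ^+ 2], and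
    [ln (1 + c^-1) <= c^-1]. *)
Lemma neg_ln_le (c y : R) : 0 < c -> c ^+ 2 <= `|y| -> - ln `|1 - expR (- y)| <= 2 / c.
Proof.
move=> c0 cy; have y0 : 0 < `|y| by apply: lt_le_trans cy; rewrite exprn_gt0.
have e1 : expR (- `|y|) <= (1 + `|y|)^-1.
  by rewrite expRN lef_pV2 ?posrE ?expR_gt0 ?expR_ge1Dx //; lra.
have e2 : `|y| / (1 + `|y|) <= 1 - expR (- `|y|).
  apply: le_trans (_ : 1 - (1 + `|y|)^-1 <= _); last by rewrite lerD2l lerN2.
  have : 1 + `|y| != 0 by rewrite gt_eqF //; lra.
  by move=> h; rewrite le_eqVlt; apply/orP; left; apply/eqP; field.
have e3 : 1 - expR (- `|y|) <= `|1 - expR (- y)|.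
  have [yp|yn] := leP 0 y; first by rewrite (ger0_norm yp) ler_norm.
  rewrite (ltr0_norm yn) opprK; apply: le_trans (_ : expR (- y) - 1 <= _); last first.
    by rewrite -normrN opprB ler_norm.
  rewrite expRN; have := expR_gt0 y; set a := expR y => a0.
  rewrite -subr_ge0 (_ : _ - _ = (a - 1) ^+ 2 / a); first by rewrite divr_ge0 ?sqr_ge0 // ltW.
  by field; rewrite gt_eqF.
have e4 : (c / (1 + c)) ^+ 2 <= `|y| / (1 + `|y|).
  apply: le_trans (_ : c ^+ 2 / (1 + c ^+ 2) <= _).
    rewrite expr_div_n ler_wpM2l ?sqr_ge0 // lef_pV2 ?posrE ?exprn_gt0 ?addr_gt0 ?exprn_gt0 //.
    by rewrite sqrrD expr1n mul1r -addrA lerD2l lerDr mulrn_wge0 // ltW.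
  rewrite ler_pdivrMr ?addr_gt0 ?exprn_gt0 // mulrAC ler_pdivlMr ?addr_gt0 //; lra.
have p0 : 0 < c / (1 + c) by rewrite divr_gt0 // addr_gt0.
have := le_trans e4 (le_trans e2 e3); rewrite -ler_ln ?posrE ?exprn_gt0 //; last first.
  by apply: lt_le_trans (le_trans e4 (le_trans e2 e3)); rewrite exprn_gt0.
rewrite lnXn // => h; rewrite lerNl; apply: le_trans h.
have : ln (c / (1 + c)) = - ln (1 + c^-1).
  rewrite -lnV ?posrE ?addr_gt0 ?invr_gt0 //; congr ln; field; rewrite !gt_eqF //=; lra.
move=> ->; have := @le_ln1Dx R c^-1; rewrite -mulr_natl => /(_ _) h.
have : ln (1 + c^-1) <= c^-1 by apply: h; apply: lt_trans (_ : 0 < _); rewrite ?invr_gt0 // ltrN10.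
lra.
Qed.

Let pow4 (k : nat) : 4 ^+ k = (2 ^+ k) ^+ 2 :> R.
Proof. by rewrite -exprM mulnC exprM (_ : 2 ^+ 2 = 4) // -natrX. Qed.

Let term x (k : nat) : \bar R := (2 * 2 ^+ k * (`|x| <= 4 ^- k)%R%:R)%:E.

Let term_ge0 x k : (0 <= term x k)%E.
Proof. by rewrite lee_fin !mulr_ge0 ?exprn_ge0. Qed.

Lemma sing_weight_term x (k : nat) : `|x| <= 4 ^- k -> ((2 * 2 ^+ k)%:E <= sing_weight x)%E.
Proof.
move=> xk; apply: le_trans (_ : \sum_(0 <= i <oo) term x i <= _)%E; last by rewrite leeDr.
apply: le_trans (nneseries_lim_ge k.+1 _) => //.
rewrite big_nat_recr //= [X in (_ <= _ + X)%E](_ : _ = (2 * 2 ^+ k)%:E); last by rewrite /term xk mulr1.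
by rewrite leeDr // sume_ge0.
Qed.

Lemma sing_weight_ge1 x : (1 <= sing_weight x)%E.
Proof. by rewrite leeDl // nneseries_ge0. Qed.

Lemma sing_weight_ge0 x : (0 <= sing_weight x)%E.
Proof. exact: le_trans (sing_weight_ge1 x). Qed.

Lemma sing_weight0 : sing_weight 0 = +oo%E.
Proof.
apply: eq_infty => A; have [k Ak] : exists k : nat, A <= 2 ^+ k.
  exists (Num.truncn A).+1; apply: le_trans (_ : (Num.truncn A).+1%:R <= _); last first.
    by rewrite -natrX ler_nat ltnW // ltn_expl.
  have [A0|A0] := leP 0 A; first by rewrite ltW // truncnS_gt.
  by apply: le_trans (ltW A0) _.
apply: le_trans (_ : (2 * 2 ^+ k)%:E <= _)%E; last first.
  by apply: sing_weight_term; rewrite normr0 invr_ge0 exprn_ge0.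
by rewrite lee_fin; apply: le_trans Ak _; rewrite ler_peMl ?exprn_ge0 // ler1n.
Qed.

(** When [x] has modulus between [4 ^- k.+1] and [4 ^- k], [neg_ln_le] with [c = M / 2 ^+ k.+1]
    gives exactly the k-th term; beyond modulus 1 the constant term is enough. *)
Lemma sing_weight_ge (M x : R) : 0 < M -> x != 0 ->
  ((- ln `|1 - expR (- (M ^+ 2 * x))|)%:E <= (2 / M)%:E * sing_weight x)%E.
Proof.
move=> M0 x0; have xp : 0 < `|x| by rewrite normr_gt0.
have c0 : (0 <= (2 / M)%:E :> \bar R)%E by rewrite lee_fin divr_ge0 // ltW.
have nM : `|M ^+ 2 * x| = M ^+ 2 * `|x| by rewrite normrM ger0_norm ?sqr_ge0.
have [x1|x1] := ltP 1 `|x|.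
  apply: le_trans (lee_wpmul2l c0 (sing_weight_ge1 x)); rewrite mule1 lee_fin.
  by apply: neg_ln_le => //; rewrite nM ler_peMr ?sqr_ge0 // ltW.
have ex : exists k : nat, 4 ^- k.+1 < `|x|.
  exists (Num.truncn `|x|^-1); rewrite invf_plt ?posrE ?exprn_gt0 //.
  apply: lt_trans (truncnS_gt _) _; rewrite -natrX ltr_nat.
  by rewrite ltn_expl.
have [k kx km] := ex_minnP ex.
have xk : `|x| <= 4 ^- k.
  case: k kx km => [|k] kx km; first by rewrite expr0 invr1.
  by rewrite leNgt; apply/negP => /km; rewrite ltnn.
apply: le_trans (lee_wpmul2l c0 (sing_weight_term xk)); rewrite -EFinM lee_fin.
have -> : 2 / M * (2 * 2 ^+ k) = 2 / (M / 2 ^+ k.+1) by rewrite invf_div [RHS]mulrA [LHS]mulrAC exprS.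
apply: neg_ln_le; first by rewrite divr_gt0 // exprn_gt0.
rewrite nM expr_div_n ler_wpM2l ?sqr_ge0 //; apply: le_trans (ltW kx).
by rewrite pow4.
Qed.

Let mterm a k : measurable_fun setT (fun t : R => term (t - a) k).
Proof.
apply/measurable_EFinP; apply: measurable_funM => //.
have -> : (fun t : R => (`|t - a| <= 4 ^- k)%R%:R : R) = (fun t => if `|t - a| <= 4 ^- k then 1 else 0).
  by apply/funext => t; case: ifP.
apply: measurable_fun_ifT => //; apply: measurable_fun_ler => //.
by apply: measurableT_comp => //; exact: measurable_funB.
Qed.

Lemma measurable_sing_weight a : measurable_fun setT (fun t => sing_weight (t - a)).
Proof.
by apply: emeasurable_funD => //; apply: ge0_emeasurable_sum => [k t _ _|k _]; [exact: term_ge0|exact: mterm].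
Qed.

Lemma sing_weightN x : sing_weight (- x) = sing_weight x.
Proof. by rewrite /sing_weight normrN. Qed.

Lemma integral_cst_itv (a b c : R) : a <= b -> (\int[mu]_(t in `[a, b]) c%:E = (c * (b - a))%:E)%E.
Proof. by move=> ab; rewrite integral_cst // EFinM -(lebesgue_itv ab). Qed.

(** The constant contributes 1. The k-th indicator has integral at most [2 * 2 ^+ k * (2 * 4 ^- k) =
    8 / 2 ^+ k.+1], and these sum to 8. *)
Lemma integral_sing_weight (a : R) : (\int[mu]_(t in `[0%R, 1%R]) sing_weight (t - a) <= 9%:E)%E.
Proof.
have mi : measurable (`[0%R, 1%R]%classic : set R) by exact: measurable_itv.
have mT k : measurable_fun (`[0%R, 1%R]%classic : set R) (fun t : R => term (t - a) k) by apply: measurable_funTS; exact: mterm.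
rewrite ge0_integralD //; last 2 first.
- by move=> t _; apply: nneseries_ge0.
- by apply: ge0_emeasurable_sum => [k t _ _|k _]; [exact: term_ge0|exact: mT].
rewrite [X in (X + _ <= _)%E](integral_cst_itv 1 ler01) mul1r subr0 integral_nneseries //.
have -> : 9%:E = (1%:E + 8%:E)%E :> \bar R by rewrite -EFinD; congr EFin; ring.
rewrite leeD2l //; apply: le_trans (epsilon_trick0 xpredT (_ : 0 <= 8)) => //.
apply: lee_nneseries => [k _ _|k _]; first by apply: integral_ge0.
apply: le_trans (_ : \int[mu]_(t in `[(a - 4 ^- k)%R, (a + 4 ^- k)%R]) (2 * 2 ^+ k)%R%:E <= _)%E; last first.
  rewrite integral_cst_itv; last by rewrite lerD2l ge0_cp // invr_ge0 exprn_ge0.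
  rewrite lee_fin natrX exprS (_ : 4 ^- k = (2 ^+ k)^-1 ^+ 2); last first.
    by rewrite exprVn pow4.
  have k0 : (2 ^+ k : R) != 0 by rewrite expf_neq0.
  by rewrite le_eqVlt; apply/orP; left; apply/eqP; field.
apply: le_trans (_ : \int[mu]_(t in setT) term (t - a) k <= _)%E.
  by apply: ge0_subset_integral => //; exact: mterm.
rewrite [leRHS]integral_mkcond le_eqVlt; apply/orP; left; apply/eqP; apply: eq_integral => t _.
by rewrite /patch /term mem_setE in_itv /= -ler_distl; case: ifP => _; rewrite ?mulr1 ?mulr0.
Qed.

End Singularity.

(** * The Green function along points at logarithmic distances *)

Section SmearBounds.
Variable R : realType.
Implicit Types (z w X : cplx R).

Lemma gr_sub z w : cmod z < 1 -> cmod w < 1 -> z != w ->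
  gr z w = ln (cmod (bden w z)) - ln (cmod (z - w)).
Proof.
by move=> z1 w1 zw; rewrite /gr ln_div // posrE ?bden_gt0 ?(ltW z1) // cmod_gt0 subr_eq0.
Qed.

Lemma bden_move z w X (r d : R) : cmod z <= r -> r < 1 -> cmod w <= 1 -> cmod (X - w) <= d -> 0 <= d ->
  cmod (bden X z) <= cmod (bden w z) * (1 + d / (1 - r)).
Proof.
move=> zr r1 w1 Xd d0; have b1 : 1 - r <= cmod (bden w z) by rewrite bden_sym bden_ge1.
have r0 : 0 < 1 - r by rewrite subr_gt0.
have h : cmod (bden X z) <= cmod (bden w z) + d.
  have -> : bden X z = bden w z + (- (cconj (X - w) : cplx R) * z).
    by apply: cplx_eq; rewrite /bden /cconj !(cplxD1, cplxD2, cplxN1, cplxN2, cplxM1, cplxM2) /=; ring.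
  apply: le_trans (ler_cmodD _ _) _; rewrite lerD2l cmodM cmodN cmod_conj.
  by apply: le_trans Xd; rewrite ler_piMr ?cmod_ge0 // (le_trans zr) // ltW.
apply: le_trans h _; rewrite mulrDr mulr1 lerD2l mulrCA -[leLHS]mulr1 ler_wpM2l //.
by rewrite ler_pdivlMr // mul1r.
Qed.

Lemma dist_ge z w X : `|cmod (z - w) - cmod (X - w)| <= cmod (z - X).
Proof.
have -> : z - X = (z - w) - (X - w) by ring.
rewrite ler_norml; apply/andP; split; last exact: ler_cmodB.
by rewrite lerNl opprB (cmodBC (z - w) (X - w)) ler_cmodB.
Qed.

Lemma log_dist (d p M : R) : 0 < d -> 0 < p -> 0 < M -> exists t0 : R, p = d * expR (- (M ^+ 2 * t0)).
Proof.
move=> d0 p0 M0; exists (- ln (p / d) / M ^+ 2).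
rewrite mulrCA divff ?mulr1 ?opprK ?lnK ?posrE ?divr_gt0 // 1?expf_neq0 ?gt_eqF //.
by rewrite mulrCA divff ?mulr1 // gt_eqF.
Qed.

Let expR_split (m t t0 : R) : expR (- (m * t)) = expR (- (m * t0)) * expR (- (m * (t - t0))).
Proof. by rewrite -expRD; congr expR; ring. Qed.

(** [t0] is the logarithmic radius of [z] about [w]. By the reverse triangle inequality the distance
    from [z] to [X] is at least that from [z] to [w] times [1 - expR (- (M ^+ 2 * (t - t0)))] in
    modulus. The term [d / (1 - r)] comes from the numerators, by [bden_move]. *)
Lemma smear_point_near z w (r d M : R) : cmod z <= r -> r < 1 -> cmod w < 1 -> 0 < d -> 0 < M -> z != w ->
  exists t0 : R, forall (t : R) X, 0 <= t -> cmod X < 1 -> cmod (X - w) = d * expR (- (M ^+ 2 * t)) ->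
  (gker z X <= (gr z w + d / (1 - r))%:E + (2 / M)%:E * sing_weight (t - t0))%E.
Proof.
move=> zr r1 w1 d0 M0 zw; have z1 := le_lt_trans zr r1.
have p0 : 0 < cmod (z - w) by rewrite cmod_gt0 subr_eq0.
have [t0 pE] := log_dist d0 p0 M0; exists t0 => t X t_ge0 X1 XE.
have [->|tt] := eqVneq t t0.
  by rewrite subrr sing_weight0 gt0_muley ?lte_fin ?divr_gt0 // addey // leey.
have r0 : 0 < 1 - r by rewrite subr_gt0.
have qd : cmod (X - w) <= d.
  by rewrite XE ler_piMr ?(ltW d0) // -expR0 ler_expR oppr_le0 mulr_ge0 ?sqr_ge0.
have E : `|cmod (z - w) - cmod (X - w)| = cmod (z - w) * `|1 - expR (- (M ^+ 2 * (t - t0)))|.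
  by rewrite XE (expR_split _ t t0) mulrA -pE -{1}[cmod (z - w)]mulr1 -mulrBr normrM (gtr0_norm p0).
have e0 : 0 < `|1 - expR (- (M ^+ 2 * (t - t0)))|.
  rewrite normr_gt0 subr_eq0 eq_sym -expR0 (inj_eq (@expR_inj R)) oppr_eq0 mulf_neq0 ?subr_eq0 // expf_neq0 // gt_eqF //.
have zX0 : 0 < cmod (z - X) by apply: lt_le_trans (dist_ge z w X); rewrite E mulr_gt0.
have zX : z != X by rewrite -subr_eq0 -cmod_gt0.
rewrite /gker z1 X1 /= greenE (negPf zX).
apply: le_trans (_ : ((gr z w + d / (1 - r)) - ln `|1 - expR (- (M ^+ 2 * (t - t0)))|)%:E <= _)%E; last first.
  by rewrite EFinD leeD2l // sing_weight_ge // subr_eq0.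
rewrite lee_fin !gr_sub //.
have h1 : ln (cmod (bden X z)) <= ln (cmod (bden w z)) + d / (1 - r).
  have b0 := bden_gt0 w1 (ltW z1); have c0 : 0 < 1 + d / (1 - r) by rewrite addr_gt0 // divr_gt0.
  apply: le_trans (_ : ln (cmod (bden w z) * (1 + d / (1 - r))) <= _).
    by rewrite ler_ln ?posrE ?mulr_gt0 ?bden_gt0 ?(ltW z1) // bden_move // ltW.
  rewrite lnM ?posrE // lerD2l le_ln1Dx //; apply: lt_trans (_ : 0 < _); rewrite ?divr_gt0 // ltrN10.
have h2 : ln (cmod (z - w)) + ln `|1 - expR (- (M ^+ 2 * (t - t0)))| <= ln (cmod (z - X)).
  by rewrite -lnM ?posrE // ler_ln ?posrE ?mulr_gt0 // -E dist_ge.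
move: h1 h2; set A := ln _; set B := ln _; set F := ln _; set D := ln _; set K := ln _; lra.
Qed.

(** The same comparison with [z] and [X] exchanged: the reference distance is now that of [X] to
    [w], at least [d * expR (- M ^+ 2)], so the bound is uniform in [z]. *)
Lemma smear_point_unif z w (d M : R) : cmod z < 1 -> cmod w < 1 -> 0 < d -> 0 < M ->
  exists t0 : R, forall (t : R) X, 0 <= t <= 1 -> cmod X < 1 -> cmod (X - w) = d * expR (- (M ^+ 2 * t)) ->
  (gker z X <= (ln 2 - ln d + M ^+ 2)%:E + (2 / M)%:E * sing_weight (t - t0))%E.
Proof.
move=> z1 w1 d0 M0; have [zw|zw] := eqVneq z w.
  exists 0 => t X /andP[t_ge0 t1] X1 XE.
  have zX0 : 0 < cmod (z - X) by rewrite zw cmodBC XE mulr_gt0 ?expR_gt0.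
  have zX : z != X by rewrite -subr_eq0 -cmod_gt0.
  apply: le_trans (_ : (ln 2 - ln d + M ^+ 2)%:E <= _)%E; last first.
    by rewrite leeDl // mule_ge0 ?sing_weight_ge0 // lee_fin divr_ge0 // ltW.
  rewrite /gker z1 X1 /= greenE (negPf zX) lee_fin gr_sub //.
  have h1 : ln (cmod (bden X z)) <= ln 2 by rewrite ler_ln ?posrE ?bden_gt0 ?bden_le ?ltW.
  have h2 : ln (cmod (z - X)) = ln d - M ^+ 2 * t.
    by rewrite zw cmodBC XE lnM ?posrE ?expR_gt0 // expRK.
  have : M ^+ 2 * t <= M ^+ 2 by rewrite ler_piMr // sqr_ge0.
  rewrite h2; move: h1; set A := ln _; set B := ln _; set F := ln _; set D := _ ^+ 2; set E := _ * t; lra.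
have p0 : 0 < cmod (z - w) by rewrite cmod_gt0 subr_eq0.
have [t0 pE] := log_dist d0 p0 M0; exists t0 => t X /andP[t_ge0 t1] X1 XE.
have [->|tt] := eqVneq t t0.
  by rewrite subrr sing_weight0 gt0_muley ?lte_fin ?divr_gt0 // addey // leey.
have q0 : 0 < cmod (X - w) by rewrite XE mulr_gt0 ?expR_gt0.
have E : `|cmod (z - w) - cmod (X - w)| = cmod (X - w) * `|1 - expR (- (M ^+ 2 * (t0 - t)))|.
  by rewrite distrC pE (expR_split _ t0 t) mulrA -XE -{1}[cmod (X - w)]mulr1 -mulrBr normrM (gtr0_norm q0).
have e0 : 0 < `|1 - expR (- (M ^+ 2 * (t0 - t)))|.
  rewrite normr_gt0 subr_eq0 eq_sym -expR0 (inj_eq (@expR_inj R)) oppr_eq0 mulf_neq0 // ?subr_eq0 1?[t0 == t]eq_sym // expf_neq0 // gt_eqF //.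
have zX0 : 0 < cmod (z - X) by apply: lt_le_trans (dist_ge z w X); rewrite E mulr_gt0.
have zX : z != X by rewrite -subr_eq0 -cmod_gt0.
rewrite /gker z1 X1 /= greenE (negPf zX).
apply: le_trans (_ : ((ln 2 - ln d + M ^+ 2) - ln `|1 - expR (- (M ^+ 2 * (t0 - t)))|)%:E <= _)%E; last first.
  by rewrite EFinD leeD2l // -sing_weightN opprB sing_weight_ge // subr_eq0 eq_sym.
rewrite lee_fin gr_sub //.
have h1 : ln (cmod (bden X z)) <= ln 2 by rewrite ler_ln ?posrE ?bden_gt0 ?bden_le ?ltW.
have h2 : ln (cmod (X - w)) + ln `|1 - expR (- (M ^+ 2 * (t0 - t)))| <= ln (cmod (z - X)).
  by rewrite -lnM ?posrE // ler_ln ?posrE ?mulr_gt0 // -E dist_ge.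
have h3 : ln (cmod (X - w)) = ln d - M ^+ 2 * t.
  by rewrite XE lnM ?posrE ?expR_gt0 // expRK.
have : M ^+ 2 * t <= M ^+ 2 by rewrite ler_piMr // sqr_ge0.
move: h1 h2; rewrite h3; set A := ln _; set B := ln _; set F := ln _; set D := ln _; set K := ln _; set N := _ ^+ 2; set P := _ * t; lra.
Qed.

End SmearBounds.

(** * First hitting times *)

Section Hitting.
Variable R : realType.
Variables (h l : R -> R).
Hypothesis hc : continuous h.
Hypothesis ldec : forall s t, s <= t -> l t <= l s.
Hypothesis h0 : h 0 <= l 1.
Hypothesis h1 : l 0 <= h 1.

(* First time at which [h] reaches the level [l t]; the alternative [s = 1] makes [hit] monotone on all of [R]. *)
Definition hit (t : R) := inf [set s | 0 <= s <= 1 /\ (l t <= h s \/ s = 1)].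

Let S (t : R) := [set s : R | 0 <= s <= 1 /\ (l t <= h s \/ s = 1)].

Let S1 t : S t 1. Proof. by split; [rewrite ler01 lexx|right]. Qed.

Let S0 t : has_inf (S t).
Proof. by split; [exists 1|exists 0 => s [/andP[]]]. Qed.

Lemma hit_itv t : 0 <= hit t <= 1.
Proof.
apply/andP; split; first by apply: lb_le_inf; [exists 1; exact: (S1 t)|move=> s [/andP[]]].
by apply: ge_inf; [exact: (S0 t).2|exact: (S1 t)].
Qed.

(** Monotonicity makes the hitting time measurable, so the points chosen on the circles have a law
    and no selection theorem is called for. *)
Lemma hit_noninc s t : s <= t -> hit t <= hit s.
Proof.
move=> st; apply: lb_le_inf; first by exists 1; exact: (S1 s).
move=> x [x01 hx]; apply: ge_inf; first exact: (S0 t).2.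
by split => //; case: hx => [hx|->]; [left; exact: le_trans (ldec st) hx|right].
Qed.

Lemma hit_level t : 0 <= t <= 1 -> h (hit t) = l t.
Proof.
move=> /andP[t0 t1]; have /andP[s0 s1] := hit_itv t.
have cont e : 0 < e -> exists2 d : R, 0 < d & forall s, `|s - hit t| < d -> `|h s - h (hit t)| < e.
  move=> e0; have /cvgrPdist_lt/(_ e e0) := hc (x := hit t); rewrite -nbhs_ballE => -[d d0 hd].
  by exists d => // s sd; rewrite distrC; apply: hd; rewrite /ball /= distrC.
apply/eqP; rewrite eq_le; apply/andP; split; rewrite leNgt; apply/negP => hl.
- have [d d0 hd] := cont (h (hit t) - l t) ltac:(by rewrite subr_gt0).
  have hp : 0 < hit t.
    rewrite lt_def s0 andbT; apply/eqP => e; move: hl; rewrite e; apply/negP; rewrite -leNgt.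
    by apply: le_trans h0 _; exact: ldec.
  pose s := Num.max 0 (hit t - d / 2).
  have sh : s < hit t by rewrite /s gt_max hp /= ltrBlDr ltrDl divr_gt0.
  have : S t s.
    split; first by rewrite le_max lexx /= (le_trans (ltW sh)).
    left; have : `|h s - h (hit t)| < h (hit t) - l t.
      apply: hd; rewrite distrC ger0_norm ?subr_ge0 1?ltW // ltrBlDr -ltrBlDl lt_max.
      by apply/orP; right; rewrite ltrD2l ltrN2 ltr_pdivrMr // ltr_pMr // ltr1n.
    by rewrite ltr_norml => /andP[]; lra.
  by move=> /(ge_inf (S0 t).2); rewrite -/(hit t) leNgt sh.
- have [d d0 hd] := cont (l t - h (hit t)) ltac:(by rewrite subr_gt0).
  have [s [/andP[sa sb] hs] sd] := inf_adherent d0 (S0 t).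
  have hts : hit t <= s by apply: ge_inf => //; [exact: (S0 t).2|split => //; rewrite sa sb].
  have ls : l t <= h s by case: hs => // ->; apply: le_trans h1; exact: ldec.
  have : `|h s - h (hit t)| < l t - h (hit t).
    by apply: hd; rewrite ger0_norm ?subr_ge0 // ltrBlDl.
  by rewrite ltr_norml => /andP[]; lra.
Qed.

End Hitting.

(** * The smear of a point along the image of a segment *)

Section Smear.
Variable R : realType.
Variables (phi : cplx R -> cplx R) (rho : R) (u v : cplx R).
Hypothesis hphi : analytic_on_disk phi.
Hypothesis rho1 : rho < 1.
Hypothesis ur : cmod u <= rho.
Hypothesis vr : cmod v <= rho.

(** Clamping the parameter extends the path continuously to the whole line, as the section on
    hitting times requires. *)
Let clamp (s : R) := Num.max 0 (Num.min s 1).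

Let clamp_itv s : 0 <= clamp s <= 1.
Proof. by rewrite /clamp le_max lexx /= ge_max ler01 ge_min lexx orbT. Qed.

Let seg (s : R) : cplx R := u + rc (clamp s) * (v - u).

Let seg_le s : cmod (seg s) <= rho.
Proof.
have /andP[s0 s1] := clamp_itv s.
have -> : seg s = rc (1 - clamp s) * u + rc (clamp s) * v by rewrite /seg rcB (_ : rc 1 = 1) //; ring.
apply: le_trans (ler_cmodD _ _) _; rewrite !cmodM !cmod_rc !ger0_norm ?subr_ge0 //.
have := ler_wpM2l s0 vr; have := @ler_wpM2l _ (1 - clamp s) _ _ _ ur; rewrite subr_ge0 => /(_ s1); lra.
Qed.

Let clamp_lip s t : `|clamp s - clamp t| <= `|s - t|.
Proof.
have c x : [\/ x <= 0 /\ clamp x = 0, [/\ 0 <= x, x <= 1 & clamp x = x] | 1 <= x /\ clamp x = 1].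
  rewrite /clamp; have [x1|/ltW x1] := leP x 1; last by apply: Or33; split => //; exact/max_r.
  have [x0|/ltW x0] := leP 0 x; first by apply: Or32; split => //; exact/max_r.
  by apply: Or31; split => //; exact/max_l.
move: (c s) (c t) => {c}; move: (clamp s) (clamp t) => a b cs ct.
have [st|/ltW st] := leP s t; [rewrite [leRHS]ler0_norm ?subr_le0 //|rewrite [leRHS]ger0_norm ?subr_ge0 //];
  rewrite ler_norml; case: cs => [[s0 ->]|[s0 s1 ->]|[s1 ->]]; case: ct => [[t0 ->]|[t0 t1 ->]|[t1 ->]];
  apply/andP; split; lra.
Qed.

Lemma path_cont (s e : R) : 0 < e -> exists2 d : R, 0 < d &
  forall t, `|t - s| < d -> cmod (phi (seg t) - phi (seg s)) < e.
Proof.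
have s1 : cmod (seg s) < 1 := le_lt_trans (seg_le s) rho1.
move=> /(analytic_cont hphi s1)[d d0 hd]; exists (d / (1 + cmod (v - u))).
  by rewrite divr_gt0 // ltr_pwDl // cmod_ge0.
move=> t ts; apply: hd.
have -> : seg t - seg s = rc (clamp t - clamp s) * (v - u) by rewrite /seg rcB; ring.
rewrite cmodM cmod_rc; move: ts; rewrite ltr_pdivlMr ?ltr_pwDl ?cmod_ge0 //.
apply: le_lt_trans; apply: ler_pM; rewrite ?cmod_ge0 ?lerDr //.
Qed.

(** The path starts within [d * expR (- M ^+ 2)] of [w] and ends at distance at least [d], so it
    meets every circle of radius [d * expR (- (M ^+ 2 * t))]. The smear is the law of the first
    meeting point for uniform [t], and [18 / M] is [2 / M] times the 9 of [integral_sing_weight]. *)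
Lemma smear_prob (w : cplx R) (d M r : R) : 0 < d -> 0 < M -> r < 1 -> (forall z, cmod z < 1 -> cmod (phi z) < 1) ->
  cmod w < 1 -> cmod (phi u - w) <= d * expR (- M ^+ 2) -> d <= cmod (phi v - w) ->
  exists tau, smears (@gker R) tau (phi @` [set z | cmod z <= rho]) [set z | cmod z <= r]
    (d / (1 - r) + 18 / M) (ln 2 - ln d + M ^+ 2 + 18 / M) w.
Proof.
move=> d0 M0 r1 phi1 w1 hu hv.
pose h s := cmod (phi (seg s) - w); pose l (t : R) := d * expR (- (M ^+ 2 * t)).
have hc : continuous h.
  move=> s; apply/cvgrPdist_lt => e e0; have [c c0 hcc] := path_cont s e0.
  exists c => // t; rewrite /= distrC => /hcc ht.
  rewrite distrC; apply: le_lt_trans ht; have := dist_ge (phi (seg t)) w (phi (seg s)).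
  by [].
have ldec s t : s <= t -> l t <= l s.
  by move=> st; rewrite /l ler_wpM2l ?(ltW d0) // ler_expR lerN2 ler_wpM2l ?sqr_ge0.
have seg0 : seg 0 = u by rewrite /seg /clamp min_l // max_l // (_ : rc 0 = 0) // mul0r addr0.
have seg1 : seg 1 = v by rewrite /seg /clamp min_l // max_r // (_ : rc 1 = 1) // mul1r addrC subrK.
have h0 : h 0 <= l 1 by rewrite /h /l seg0 mulr1.
have h1 : l 0 <= h 1 by rewrite /h /l seg1 mulr0 oppr0 expR0 mulr1.
pose X t : R * R := phi (seg (hit h l t)).
have XE t : 0 <= t <= 1 -> cmod ((X t : cplx R) - w) = d * expR (- (M ^+ 2 * t)).
  by move=> t01; exact: (hit_level hc ldec h0 h1 t01).
have X1 t : cmod (X t) < 1 by apply: phi1; exact: le_lt_trans (seg_le _) rho1.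
have mhit : measurable_fun setT (hit h l) by apply: nonincreasing_measurable => // s t st; exact: hit_noninc.
have mpr (p : cplx R -> R) : (forall z z', `|p z - p z'| <= cmod (z - z')) -> measurable_fun setT (fun t => p (X t)).
  move=> hp; suff mp : measurable_fun setT (fun s : R => p (phi (seg s))) by exact: (measurableT_comp mp mhit).
  apply: continuous_measurable_fun => s.
  apply/cvgrPdist_lt => e e0; have [c c0 hcc] := path_cont s e0.
  exists c => // t; rewrite /= distrC => /hcc ht.
  by rewrite distrC; apply: le_lt_trans ht.
have mX : measurable_fun setT X.
  have -> : X = (fun t => ((X t).1, (X t).2)) by apply/funext => t; case: (X t).
  apply: measurable_fun_pair; apply: mpr => z z'; [exact: (re_le_cmod (z - z'))|exact: (im_le_cmod (z - z'))].
pose m := measure_function_pushforward__canonical__measure_function_Measure (uniform_prob (@ltr01 R)) mX.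
have m1 : m setT = 1%E by exact: (probability_setT (uniform_prob (@ltr01 R))).
have [tau [tA tI]] := probability_of_measure m1; exists tau.
have mi : measurable (`[0, 1]%classic : set R) by exact: measurable_itv.
have int_tau (f : R * R -> \bar R) : measurable_fun setT f -> (forall x, 0 <= f x)%E ->
    (\int[tau]_x f x = \int[@lebesgue_measure R]_(t in `[0%R, 1%R]) f (X t))%E.
  move=> mf f0; rewrite tI ge0_integral_pushforward // preimage_setT integral_uniform //.
    by rewrite subr0 invr1 mul1e.
    exact: (measurableT_comp mf mX).
  by move=> t; exact: f0.
have bound (z : cplx R) (A t0 : R) : 0 <= A -> (forall t : R, 0 <= t <= 1 -> (gker z (X t) <= A%:E + (2 / M)%:E * sing_weight (t - t0))%E) ->
    (avg_pot (@gker R) tau z <= (A + 18 / M)%:E)%E.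
  move=> A0 hA; have mg := kernel_measurable (@measurable_gker R) z.
  rewrite /avg_pot int_tau //; last by move=> x; exact: gker_ge0.
  have c0 : 0 <= 2 / M by rewrite divr_ge0 // ltW.
  have mS : measurable_fun (`[0, 1]%classic : set R) (fun t => (2 / M)%:E * sing_weight (t - t0))%E.
    by apply: measurable_funeM; apply: measurable_funTS; exact: measurable_sing_weight.
  apply: le_trans (_ : \int[@lebesgue_measure R]_(t in `[0%R, 1%R]) (A%:E + (2 / M)%:E * sing_weight (t - t0)) <= _)%E.
    apply: ge0_le_integral => //.
    - by move=> t _; exact: gker_ge0.
    - by apply: measurable_funTS; exact: (measurableT_comp mg mX).
    - exact: emeasurable_funD.
  rewrite ge0_integralD //; [|by move=> t _; rewrite mule_ge0 // sing_weight_ge0].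
  rewrite [X in (X + _ <= _)%E](integral_cst_itv _ ler01) subr0 mulr1 EFinD leeD2l //.
  rewrite ge0_integralZl_EFin //; [|by move=> t _; exact: sing_weight_ge0|
    by apply: measurable_funTS; exact: measurable_sing_weight].
  apply: le_trans (lee_wpmul2l _ (integral_sing_weight t0)) _; rewrite ?lee_fin //.
  by rewrite mulrAC -natrM.
have r0 : 0 <= d / (1 - r) by rewrite divr_ge0 ?subr_ge0 ?ltW.
split.
- rewrite tA /= /pushforward /=; have -> : X @^-1` (~` (phi @` [set z | cmod z <= rho])) = set0.
    by rewrite -subset0 => t; apply; exists (seg (hit h l t)) => //; exact: seg_le.
  exact: measure0.
- move=> z zr; have z1 : cmod z < 1 := le_lt_trans zr r1.
  have [->|zw] := eqVneq z w; first by rewrite /gker w1 /= greenE eqxx addye // leey.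
  have [t0 ht] := smear_point_near zr r1 w1 d0 M0 zw.
  rewrite /gker z1 w1 /= greenE (negPf zw) -EFinD addrA; apply: (bound z _ t0).
    by rewrite addr_ge0 // gr_ge0.
  by move=> t t01; apply: ht => //; [case/andP: t01|exact: XE].
- move=> z zr; have z1 : cmod z < 1 := le_lt_trans zr r1.
  have [t0 ht] := smear_point_unif z1 w1 d0 M0.
  apply: (bound z _ t0); last by move=> t t01; apply: ht => //; exact: XE.
  have d2 : d <= 2.
    apply: le_trans hv _; apply: le_trans (ler_cmodB' _ _) _.
    by have := phi1 v (le_lt_trans vr rho1); lra.
  by rewrite addr_ge0 ?sqr_ge0 // subr_ge0 ler_ln ?posrE.
Qed.

End Smear.

(** * Conditioning a measure on a subset *)

Section Conditioning.
Context {d : measure_display} {T : measurableType d} {R : realType}.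
Variable G : T -> T -> \bar R.
Hypothesis G0 : forall x y, (0 <= G x y)%E.
Hypothesis Gm : measurable_fun setT (fun p : T * T => G p.1 p.2).
Local Open Scope ereal_scope.

(** Restriction cannot increase the energy of a nonnegative kernel; normalization costs [a^-1] in
    each variable. *)
Lemma condition_prob (mu : probability T R) B (a : R) : measurable B -> (0 < a)%R -> mu B = a%:E ->
  exists nu : probability T R, nu (~` B) = 0 /\ kenergy G nu <= (a^-1 * a^-1)%:E * kenergy G mu.
Proof.
move=> mB a0 muB; have c0 : (0 <= a^-1)%R by rewrite invr_ge0 ltW.
have [|nu [nuA nuI]] := @probability_of_measure _ _ _ (mscale (NngNum c0) (mrestr mu mB)).
  by rewrite /= /mscale /= /mrestr setTI [X in _ * X]muB -EFinM mulVf // gt_eqF.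
have int_le (f : T -> \bar R) : measurable_fun setT f -> (forall x, 0 <= f x) ->
    \int[nu]_x f x <= (a^-1)%:E * \int[mu]_x f x.
  move=> mf f0; rewrite nuI ge0_integral_mscale // lee_wpmul2l ?lee_fin //.
  apply: ge0_le_measure_integral => //= A mA; rewrite /mrestr le_measure ?inE //; exact: measurableI.
exists nu; split.
  by rewrite nuA /= /mscale /= /mrestr setICl measure0 mule0.
have mA : measurable_fun setT (avg_pot G mu) := measurable_avg_pot G0 Gm mu.
rewrite EFinM -muleA; apply: le_trans (_ : \int[nu]_x ((a^-1)%:E * avg_pot G mu x) <= _).
  apply: ge0_le_integral => //.
  - by move=> x _; exact: avg_pot_ge0.
  - exact: measurable_avg_pot.
  - exact: measurable_funeM.
  - by move=> x _; apply: int_le => //; exact: kernel_measurable.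
rewrite ge0_integralZl_EFin //; last by move=> x _; exact: avg_pot_ge0.
rewrite lee_wpmul2l ?lee_fin //; apply: int_le => // x; exact: avg_pot_ge0.
Qed.

End Conditioning.

(** * Point configurations near the image of the disk *)

Section ImagePoints.
Variable R : realType.
Variables (phi : cplx R -> cplx R).
Hypothesis hphi : analytic_on_disk phi.
Hypothesis phiD : forall z, disk z -> disk (phi z).
Hypothesis phicl : closure (phi @` (@disk R)) `<=` (disk : set (R * R)).
Local Notation E := (phi @` (@disk R)).

Lemma phi_bound : exists r0 : R, [/\ 0 <= r0, r0 < 1 & forall z, cmod z < 1 -> cmod (phi z) <= r0].
Proof.
have cE : compact (closure E : set (R * R)).
  apply: (subclosed_compact _ (@compact_cdisc R 1)); first exact: closed_closure.
  by move=> z /phicl /ltW.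
have [||c /set_mem cin cm] := @compact_EVT_max _ R (@cmod R) _ _ cE.
- by exists (phi 0); apply: subset_closure; exists 0 => //; exact: disk0.
- by apply: continuous_subspaceT => x; exact: cmod_continuous.
exists (cmod c); split; [exact: cmod_ge0|exact: phicl|move=> z z1].
by apply: cm; rewrite inE; apply: subset_closure; exists z.
Qed.

(** These compact sets exhaust the image, and each of their points has a preimage of modulus at most
    [rho], where evaluation is bounded. *)
Definition phi_ball (rho : R) : set (R * R) := phi @` [set z | cmod z <= rho].

Lemma compact_phi_ball rho : rho < 1 -> compact (phi_ball rho).
Proof.
move=> r1; apply: continuous_compact; last exact: compact_cdisc.
apply: continuous_in_subspaceT => z; rewrite inE /= => zr.
have z1 : cmod z < 1 := le_lt_trans zr r1.
move=> A /nbhs_cmodP[e e0 he]; have [d d0 hd] := analytic_cont hphi z1 e0.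
by apply/nbhs_cmodP; exists d => // w /hd wz; exact: he.
Qed.

Lemma measurable_phi_ball rho : rho < 1 -> measurable (phi_ball rho).
Proof. by move=> r1; apply: compact_measurable2; exact: compact_phi_ball. Qed.

Definition radius (k : nat) : R := 1 - k.+1%:R^-1.

Lemma radius_lt1 k : radius k < 1.
Proof. by rewrite /radius ltrBlDr ltrDl invr_gt0. Qed.

Lemma radius_ge0 k : 0 <= radius k.
Proof. by rewrite /radius subr_ge0 invf_le1 ?ler1n. Qed.

Lemma radius_mono k l : (k <= l)%N -> radius k <= radius l.
Proof. by move=> kl; rewrite /radius lerD2l lerN2 lef_pV2 ?posrE // ler_nat. Qed.

Lemma radius_ge (x : R) : x < 1 -> exists k, forall l, (k <= l)%N -> x <= radius l.
Proof.
move=> x1; exists (Num.truncn (1 - x)^-1) => l kl; apply: le_trans (radius_mono kl).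
rewrite /radius lerBrDr addrC -lerBrDr invf_ple ?posrE ?subr_gt0 //.
by apply: ltW; exact: truncnS_gt.
Qed.

Lemma phi_ball_mono rho rho' : rho <= rho' -> phi_ball rho `<=` phi_ball rho'.
Proof. by move=> rr _ [z zr <-]; exists z => //; exact: le_trans zr rr. Qed.

Lemma bigcup_phi_ball : \bigcup_k phi_ball (radius k) = E.
Proof.
apply/seteqP; split => [_ [k _ [z zr <-]]|_ [z z1 <-]].
  by exists z => //; exact: le_lt_trans zr (radius_lt1 k).
by have [k hk] := radius_ge z1; exists k => //; exists z => //; exact: hk.
Qed.

Lemma phi_ball_sub rho : rho < 1 -> phi_ball rho `<=` E.
Proof. by move=> r1 _ [z zr <-]; exists z => //; exact: le_lt_trans zr r1. Qed.

Lemma image_sub_disk : E `<=` disk.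
Proof. by move=> _ [z z1 <-]; exact: phiD. Qed.

Lemma green_V_le (mu : probability (R * R)%type R) rho : rho < 1 -> (mu (~` phi_ball rho) = 0)%E ->
  (green_V E <= kenergy (@gker R) mu)%E.
Proof.
move=> r1 mu0; rewrite -(green_energyE _ _ mu0).
- apply: ereal_inf_lbound; exists mu => //; exists (phi_ball rho); split => //.
    exact: compact_phi_ball.
  exact: phi_ball_sub.
- exact: measurable_phi_ball.
- by move=> z /phi_ball_sub -/(_ r1)/image_sub_disk.
Qed.

Variables a b : cplx R.
Hypothesis a1 : cmod a < 1.
Hypothesis b1 : cmod b < 1.
Hypothesis ab : phi a != phi b.

Let d1 := cmod (phi a - phi b) / 2.

Let d1_gt0 : 0 < d1.
Proof. by rewrite divr_gt0 // cmod_gt0 subr_eq0. Qed.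

(** Supplies the far end of an arc: no point is closer than half their distance to both [phi a] and
    [phi b]. *)
Lemma far_point (w : cplx R) : exists2 v : cplx R, v = a \/ v = b & d1 <= cmod (phi v - w).
Proof.
have [h|h] := leP d1 (cmod (phi a - w)); first by exists a => //; left.
exists b; first by right.
have : cmod (phi a - phi b) <= cmod (phi a - w) + cmod (phi b - w).
  have -> : phi a - phi b = (phi a - w) - (phi b - w) by ring.
  exact: ler_cmodB'.
by move: h; rewrite /d1; lra.
Qed.

Lemma smear_parameters (r eta : R) : r < 1 -> 0 < eta -> exists d M : R,
  [/\ 0 < d, 0 < M, d <= d1 & d / (1 - r) + 18 / M <= eta].
Proof.
move=> r1 eta0; have r0 : 0 < 1 - r by rewrite subr_gt0.
exists (Num.min d1 (eta / 2 * (1 - r))), (36 / eta); split.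
- by rewrite lt_min d1_gt0 mulr_gt0 // divr_gt0.
- by rewrite divr_gt0.
- by rewrite ge_min lexx.
rewrite [leRHS](_ : _ = eta / 2 + eta / 2); last by field.
apply: lerD; first by rewrite ler_pdivrMr // ge_min lexx orbT.
by rewrite invf_div le_eqVlt; apply/orP; left; apply/eqP; field; rewrite ?gt_eqF.
Qed.

Lemma smears_weaken (tau : probability (R * R)%type R) B (K K' : set (R * R)) (eta eta' C : R) y :
  K' `<=` K -> eta <= eta' ->
  smears (@gker R) tau B K eta C y -> smears (@gker R) tau B K' eta' C y.
Proof.
move=> KK ee [t0 t1 t2]; split => // z /KK Kz; last exact: t2.
by apply: le_trans (t1 z Kz) _; rewrite leeD2l // lee_fin.
Qed.

Lemma low_potential_points (v : R) : (green_V E < v%:E)%E -> exists (rho C : R), [/\ 0 <= rho, rho < 1 &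
  forall N, (0 < N)%N -> exists s : seq (R * R), [/\ size s = N, {in s, forall x, phi_ball rho x} &
    forall i, (i < N)%N -> (pot (@gker R) (drop_nth i s) (nth point s i) <= (N%:R * v + C)%:E)%E]].
Proof.
move=> /ereal_inf_lt[_ [mu [K [cK KE muK] <-]] Iv].
have [r0 [r00 r01 phir]] := phi_bound.
have mK : measurable K by exact: compact_measurable2.
rewrite (green_energyE mK (subset_trans KE image_sub_disk) muK) in Iv.
have I0 : (0 <= kenergy (@gker R) mu)%E.
  by apply: integral_ge0 => x _; apply: avg_pot_ge0; exact: gker_ge0.
have [I IE] : exists I : R, kenergy (@gker R) mu = I%:E.
  exists (fine (kenergy (@gker R) mu)); rewrite fineK // ge0_fin_numE //.
  by apply: lt_trans Iv _; rewrite ltry.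
rewrite IE lte_fin in Iv; rewrite IE lee_fin in I0.
have mB k : measurable (phi_ball (radius k)) by apply: measurable_phi_ball; exact: radius_lt1.
have mE : measurable E by rewrite -bigcup_phi_ball; exact: bigcup_measurable.
have muE : mu E = 1%E.
  apply/eqP; rewrite eq_le probability_le1 //= -(probability_setT mu).
  have -> : mu setT = (mu K)%E.
    have e := measureU mu mK (measurableC mK) (setICr K).
    by rewrite setUv in e; rewrite e [X in (_ + X)%E](_ : _ = 0%E) ?adde0.
  by rewrite le_measure ?inE.
have cv : ((mu \o (fun k => phi_ball (radius k))) x @[x --> \oo] --> 1%:E)%E.
  rewrite -muE -bigcup_phi_ball; apply: nondecreasing_cvg_mu => //.
    exact: bigcup_measurable.
  by move=> k l kl; apply/subsetPset; apply: phi_ball_mono; exact: radius_mono.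
(* Half of the gap pays for conditioning and half for smearing: [J + eta = v]. *)
pose J := (I + v) / 2; pose eta := (v - I) / 2.
have eta0 : 0 < eta by rewrite divr_gt0 // subr_gt0.
have J0 : 0 < J by rewrite /J; lra.
have IJ : I < J by rewrite /J; lra.
pose x := I / J; have x0 : 0 <= x by rewrite divr_ge0 // ltW.
have x1 : x < 1 by rewrite ltr_pdivrMr // mul1r.
(* Since [t * t >= x = I / J], mass above [t] keeps the conditioned energy below [J]. *)
pose t := (1 + x) / 2; have t1 : t < 1 by rewrite /t; lra.
have tx : x <= t * t by rewrite /t; have := sqr_ge0 (1 - x); lra.
have [k1 _ hk1] : \forall k \near \oo, (t%:E < mu (phi_ball (radius k)))%E.
  by apply: (cv [set y | (t%:E < y)%E]); apply: open_nbhs_nbhs; split; [exact: open_ereal_gt_ereal|rewrite /= lte_fin].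
have [ka hka] := radius_ge a1; have [kb hkb] := radius_ge b1.
pose k := maxn k1 (maxn ka kb); pose rho := radius k.
have r1 : rho < 1 by exact: radius_lt1.
have ar : cmod a <= rho by apply: hka; rewrite /k !leq_max leqnn orbT.
have br : cmod b <= rho by apply: hkb; rewrite /k !leq_max leqnn !orbT.
have tm : (t%:E < mu (phi_ball rho))%E by apply: hk1; rewrite /= /k leq_max leqnn.
have [c cE] : exists c : R, mu (phi_ball rho) = c%:E.
  by exists (fine (mu (phi_ball rho))); rewrite fineK //; apply: fin_num_measure; exact: mB.
rewrite cE lte_fin in tm; have c0 : 0 < c by apply: le_lt_trans tm; rewrite /t; lra.
have [nu [nuB nuI]] := condition_prob (@gker_ge0 R) (@measurable_gker R) (mB k) c0 cE.
have nuJ : (kenergy (@gker R) nu <= J%:E)%E.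
  apply: le_trans nuI _; rewrite IE -EFinM lee_fin -invfM mulrC ler_pdivrMr ?mulr_gt0 //.
  rewrite mulrC -ler_pdivrMr // -/x; apply: le_trans tx _.
  by apply: ler_pM => //; rewrite ?(ltW tm) // /t; lra.
have [d [M [d0 M0 dd dM]]] := smear_parameters r01 eta0.
exists rho, (ln 2 - ln d + M ^+ 2 + 18 / M + 3); split => //; first exact: radius_ge0.
have phi1 z : cmod z < 1 -> cmod (phi z) < 1 by move=> /phir h; exact: le_lt_trans h r01.
have hs y : phi_ball rho y -> exists tau, smears (@gker R) tau (phi_ball rho) (phi_ball rho) eta (ln 2 - ln d + M ^+ 2 + 18 / M) y.
  move=> [u ur <-]; have [v' v'E hv'] := far_point (phi u).
  have v'r : cmod v' <= rho by case: v'E => ->.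
  have u1 : cmod u < 1 := le_lt_trans ur r1.
  have [||tau ht] := @smear_prob R phi rho u v' hphi r1 ur v'r (phi u) d M r0 d0 M0 r01 phi1 (phi1 _ u1).
  - by rewrite subrr cmod0 mulr_ge0 ?expR_ge0 // ltW.
  - exact: le_trans dd hv'.
  exists tau; apply: smears_weaken ht => // z [u' u'r <-]; apply: phir; exact: le_lt_trans u'r r1.
move=> N N0; have [s [sN sB sp]] := low_max_pot (@gker_ge0 R) (@gkerC R) (@measurable_gker R) (mB k) nuB nuJ (ltW eta0) hs N0.
exists s; split => // i iN; apply: le_trans (sp i iN) _; rewrite lee_fin.
have -> : J + eta = v by rewrite /J /eta; field.
by rewrite !addrA.
Qed.

Definition phi_nbhd (delta : R) : set (R * R) := [set w | exists2 u, cmod u < 1 & cmod ((w : cplx R) - phi u) < delta].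

Lemma high_potential_points (v : R) : (v%:E < green_V E)%E -> exists (delta C r : R), [/\ 0 < delta, 0 <= r, r < 1,
  phi_nbhd delta `<=` [set z | cmod z <= r] &
  forall n, exists s : seq (R * R), [/\ size s = n, {in s, forall x, cmod x <= r} &
    forall w, phi_nbhd delta w -> ((n%:R * v - C)%:E <= pot (@gker R) s w)%E]].
Proof.
move=> vV; have [v' vv' v'V] : exists2 v' : R, v < v' & (v'%:E < green_V E)%E.
  case: (green_V E) vV => [V||] //; rewrite ?lte_fin => vV.
  - by exists ((v + V) / 2); rewrite ?lte_fin; lra.
  - by exists (v + 1); rewrite ?ltry //; lra.
have [r0 [r00 r01 phir]] := phi_bound.
pose r := (1 + r0) / 2; have r1 : r < 1 by rewrite /r; lra.
have eta0 : 0 < (v' - v) / 2 by rewrite divr_gt0 // subr_gt0.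
have [d [M [d0 M0 dd dM]]] := smear_parameters r1 eta0.
(* The first term lets an arc of the image start close enough to any point of the neighbourhood; the
   second keeps the neighbourhood in the disc of radius [r]. *)
pose delta := Num.min (d * expR (- M ^+ 2)) ((1 - r0) / 2).
have delta0 : 0 < delta by rewrite lt_min mulr_gt0 ?expR_gt0 //= divr_gt0 // subr_gt0.
pose C := ln 2 - ln d + M ^+ 2 + 18 / M.
have Kr : phi_nbhd delta `<=` [set z | cmod z <= r].
  move=> w [u u1 wu] /=; have -> : w = (w : cplx R) - phi u + phi u by rewrite subrK.
  apply: le_trans (ler_cmodD _ _) _.
  by have := phir _ u1; move: wu; rewrite lt_min => /andP[_]; rewrite /r; lra.
(* The bound [n.+1%:R * v - C - 1] rewritten with [n]. *)
exists delta, (C + 1 - v), r; split => //; first by rewrite /r; lra.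
have phi1 z : cmod z < 1 -> cmod (phi z) < 1 by move=> /phir h; exact: le_lt_trans h r01.
have BK k : phi_ball (radius k) `<=` phi_nbhd delta.
  by move=> _ [u ur <-]; exists u; [exact: le_lt_trans ur (radius_lt1 k)|rewrite subrr cmod0].
have mB k : measurable (phi_ball (radius k)) by apply: measurable_phi_ball; exact: radius_lt1.
have mK : measurable (phi_nbhd delta).
  apply: open_measurable2; rewrite openE => w [u u1 wu]; apply/nbhs_cmodP.
  exists (delta - cmod ((w : cplx R) - phi u)); first by rewrite subr_gt0.
  move=> w' ww; exists u => //.
  have -> : w' - phi u = (w' - w) + ((w : cplx R) - phi u) by ring.
  by apply: le_lt_trans (ler_cmodD _ _) _; rewrite -ltrBrDr.
have hs y : phi_nbhd delta y -> exists tau k, smears (@gker R) tau (phi_ball (radius k)) (phi_nbhd delta) ((v' - v) / 2) C y.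
  move=> Ky; have yr := Kr _ Ky; case: Ky => u u1 yu; have [w wE hw] := far_point y.
  have [ka hka] := radius_ge a1; have [kb hkb] := radius_ge b1; have [ku hku] := radius_ge u1.
  pose k := maxn ku (maxn ka kb); pose rho := radius k.
  have ar : cmod a <= rho by apply: hka; rewrite /k !leq_max leqnn orbT.
  have br : cmod b <= rho by apply: hkb; rewrite /k !leq_max leqnn !orbT.
  have ur : cmod u <= rho by apply: hku; rewrite /k leq_max leqnn.
  have wr : cmod w <= rho by case: wE => ->.
  have [||tau ht] := @smear_prob R phi rho u w hphi (radius_lt1 k) ur wr y d M r d0 M0 r1 phi1 (le_lt_trans yr r1).
  - by rewrite cmodBC; move: yu; rewrite lt_min => /andP[/ltW].
  - exact: le_trans dd hw.
  by exists tau, k; apply: smears_weaken ht.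
have hv (mu : probability (R * R)%type R) k : (mu (~` phi_ball (radius k)) = 0 -> v'%:E <= kenergy (@gker R) mu)%E.
  by move=> mu0; apply: le_trans (ltW v'V) _; exact: green_V_le (radius_lt1 k) mu0.
have K0 : phi_nbhd delta !=set0 by exists (phi a); exists a => //; rewrite subrr cmod0.
move=> n; have [s [sn sK sp]] := high_min_pot (@gker_ge0 R) (@gkerC R) (@measurable_gker R) n mK K0 mB BK
  (fun k l kl => phi_ball_mono (radius_mono kl)) (ltW eta0) hs hv.
exists s; split => // [x /sK/Kr//|w Kw]; apply: le_trans (sp w Kw); rewrite lee_fin.
have -> : v' - 2 * ((v' - v) / 2) = v by field.
by rewrite -natr1; lra.
Qed.

End ImagePoints.

(** * Operators and approximation numbers *)

Section Operators.
Variable R : realType.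
Variable omega : R -> R.
Hypothesis omc : {within `[0, 1[, continuous omega}.
Hypothesis om0 : forall r : R, 0 <= r < 1 -> 0 < omega r.
Hypothesis omi : (@lebesgue_measure R).-integrable `[0, 1[ (EFin \o omega).
Implicit Types (f g : cplx R -> cplx R) (S T : (R * R -> R * R) -> R * R -> R * R).

Lemma in_H_sum (I : Type) (r : seq I) (c : I -> cplx R) (f : I -> cplx R -> cplx R) :
  (forall i, in_H omega (f i)) -> in_H omega (fun z => \sum_(i <- r) c i * f i z).
Proof.
move=> hf; elim: r => [|i r IH].
  by apply: in_H_eq (in_H_cst omega 0) => z _; rewrite big_nil.
by apply: in_H_eq (in_H_comb omc om0 (c i) (hf i) IH).1 => z _; rewrite big_cons.
Qed.

(** Linearity is only given for [a * f + g]; taking [a = -1] and both functions zero yields it. *)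
Lemma op_zero S : bounded_op omega S -> eq_on_disk (S (fun=> 0)) (fun=> 0).
Proof.
move=> [_ Se Sl _] z z1; have h0 := in_H_cst omega (0 : cplx R).
have := Sl (-1 : cplx R) _ _ h0 h0 z z1.
have -> : S (fun z0 => cmul (-1 : cplx R) 0 + 0) z = S (fun=> 0) z.
  apply: (Se _ _ _ h0 _ z z1); last by move=> w _; rewrite cmulE mulr0 addr0.
  by apply: in_H_eq h0 => w _; rewrite cmulE mulr0 addr0.
by rewrite cmulE mulN1r addNr.
Qed.

Lemma op_lin S (a : cplx R) f g : bounded_op omega S -> in_H omega f -> in_H omega g ->
  eq_on_disk (S (fun z => a * f z + g z)) (fun z => a * (S f z : cplx R) + S g z).
Proof. by move=> [_ _ Sl _] hf hg; exact: Sl. Qed.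

Lemma op_scale S (a : cplx R) f : bounded_op omega S -> in_H omega f ->
  eq_on_disk (S (fun z => a * f z)) (fun z => a * (S f z : cplx R)).
Proof.
move=> hS hf z z1; have h0 := in_H_cst omega (0 : cplx R).
have [_ Se _ _] := hS; rewrite -[RHS]addr0 -[X in _ + X](op_zero hS z1) -(op_lin _ hS hf h0 z1).
apply: (Se _ _ (in_H_scale omc om0 a hf).1 _ _ z z1); last by move=> w _; rewrite addr0.
by apply: in_H_eq (in_H_scale omc om0 a hf).1 => w _; rewrite addr0.
Qed.

Lemma op_sum S (I : Type) (r : seq I) (c : I -> cplx R) (f : I -> cplx R -> cplx R) : bounded_op omega S ->
  (forall i, in_H omega (f i)) ->
  eq_on_disk (S (fun z => \sum_(i <- r) c i * f i z)) (fun z => \sum_(i <- r) c i * (S (f i) z : cplx R)).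
Proof.
move=> hS hf; have [_ Se _ _] := hS; elim: r => [|i r IH] z z1.
  rewrite [RHS]big_nil; apply: etrans (op_zero hS z1).
  apply: (Se _ _ (@in_H_sum _ [::] c f hf) (in_H_cst omega (0 : cplx R)) _ z z1).
  by move=> w _; rewrite big_nil.
rewrite big_cons -IH // -(op_lin (c i) hS (hf i) (in_H_sum r c hf) z1).
apply: (Se _ _ (@in_H_sum _ (i :: r) c f hf) _ _ z z1); last by move=> w _; rewrite big_cons.
by apply: in_H_eq (@in_H_sum _ (i :: r) c f hf) => w _; rewrite big_cons.
Qed.

Lemma in_H_sub f g : in_H omega f -> in_H omega g -> in_H omega (f - g) /\
  Hnorm2 omega (f - g) <= 2 * Hnorm2 omega f + 2 * Hnorm2 omega g.
Proof.
move=> hf hg; have [h1 h2] := in_H_comb omc om0 (-1) hg hf.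
have e : eq_on_disk (fun z => -1 * g z + f z) (f - g) by move=> z _; rewrite mulN1r addrC.
split; first exact: in_H_eq e h1.
have -> : Hnorm2 omega (f - g) = Hnorm2 omega (fun z => -1 * g z + f z).
  by rewrite -!(Hnorm_sqr om0) (Hnorm_eq _ e).
have c1 : cmod (-1 : cplx R) = 1 by rewrite cmodN cmod1.
rewrite c1 in h2; move: h2; move: (Hnorm2 _ _) (Hnorm2 omega g) (Hnorm2 omega f) => x y w.
by rewrite expr1n mulr1 addrC.
Qed.

Lemma op_norm_ge0 T : 0 <= op_norm omega T.
Proof.
rewrite /op_norm; set A := [set _ | _ in _].
(* For an unbounded operator the supremum takes the default value 0. *)
have [hA|hA] := pselect (has_sup A); last by rewrite sup_out.
have [[x Ax] ubA] := hA; apply: le_trans (_ : x <= _); last exact: ub_le_sup.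
by case: Ax => f _ <-; exact: Hnorm_ge0.
Qed.

Lemma sqr_sum_le (x y u v : R) : 0 <= x -> 0 <= y -> x <= u -> y <= v ->
  2 * x ^+ 2 + 2 * y ^+ 2 <= (2 * u + 2 * v) ^+ 2.
Proof.
move=> x0 y0 xu yv; have := ler_pM x0 x0 xu xu; have := ler_pM y0 y0 yv yv.
have : 0 <= u * v by rewrite (mulr_ge0 (le_trans x0 xu) (le_trans y0 yv)).
have := sqr_ge0 u; have := sqr_ge0 v; have -> : (2 * u + 2 * v) ^+ 2 = 4 * u ^+ 2 + 8 * (u * v) + 4 * v ^+ 2 by ring.
rewrite !expr2; lra.
Qed.

(** Boundedness of both operators makes the supremum genuine. Scaling by a positive bound [K]
    instead of the norm avoids dividing by zero. *)
Lemma op_norm_ub T S f (K : R) : bounded_op omega T -> bounded_op omega S -> in_H omega f -> 0 < K -> Hnorm omega f <= K ->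
  Hnorm omega (T f - S f) <= K * op_norm omega (fun f => T f - S f).
Proof.
move=> hT hS hf K0 fK; have [T1 _ _ [M1 hM1]] := hT; have [S1 _ _ [M2 hM2]] := hS.
have ub : has_ubound [set Hnorm omega (T f - S f) | f in [set f | in_H omega f /\ Hnorm omega f <= 1]].
  exists (2 * `|M1| + 2 * `|M2|) => _ [g [hg g1] <-].
  have [_] := in_H_sub (T1 _ hg) (S1 _ hg); rewrite -!(Hnorm_sqr om0) => h.
  have n1 : Hnorm omega (T g) <= `|M1|.
    apply: le_trans (hM1 _ hg) _; apply: le_trans (ler_norm _) _; rewrite normrM.
    by rewrite (ger0_norm (Hnorm_ge0 omega g)) ler_piMr.
  have n2 : Hnorm omega (S g) <= `|M2|.
    apply: le_trans (hM2 _ hg) _; apply: le_trans (ler_norm _) _; rewrite normrM.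
    by rewrite (ger0_norm (Hnorm_ge0 omega g)) ler_piMr.
  apply: (Hnorm_le om0); first by rewrite addr_ge0 // mulr_ge0.
  rewrite -(Hnorm_sqr om0); apply: le_trans h _.
  exact: sqr_sum_le (Hnorm_ge0 _ _) (Hnorm_ge0 _ _) n1 n2.
pose F : cplx R -> cplx R := fun z => rc K^-1 * f z.
have Kn : K != 0 by rewrite gt_eqF.
have [hF FK] := in_H_scale omc om0 (rc K^-1) hf.
have F1 : Hnorm omega F <= 1.
  apply: le_trans FK _; rewrite cmod_rc gtr0_norm ?invr_gt0 // mulrC ler_pdivrMr // mul1r //.
have hle : Hnorm omega (T F - S F) <= op_norm omega (fun f => T f - S f) by apply: (ub_le_sup ub); exists F; [split|].
have hTSF := (in_H_sub (T1 _ hF) (S1 _ hF)).1.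
have [_ h2] := in_H_scale omc om0 (rc K) hTSF.
rewrite cmod_rc (gtr0_norm K0) in h2.
apply: le_trans (le_trans h2 _); last by rewrite (ler_wpM2l (ltW K0)).
rewrite le_eqVlt; apply/orP; left; apply/eqP; apply: Hnorm_eq => z z1.
have e1 : T F z = rc K^-1 * (T f z : cplx R) := op_scale (rc K^-1) hT hf z1.
have e2 : S F z = rc K^-1 * (S f z : cplx R) := op_scale (rc K^-1) hS hf z1.
have -> : (T F - S F) z = T F z - S F z by [].
have -> : (T f - S f) z = T f z - S f z by [].
have alg (x y : cplx R) : x - y = rc K * (rc K^-1 * x - rc K^-1 * y).
  by rewrite -mulrBr mulrA -rcM divff // (_ : rc 1 = 1) // mul1r.
rewrite e1 e2; exact: alg.
Qed.

Lemma Hnorm_zero : Hnorm omega (fun=> 0) <= 0.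
Proof.
have [_ h] := in_H_scale omc om0 0 (in_H_cst omega (0 : cplx R)).
rewrite cmod0 [leRHS]mul0r in h; apply: le_trans h; rewrite le_eqVlt; apply/orP; left; apply/eqP.
by apply: Hnorm_eq => z _; rewrite mulr0.
Qed.

Lemma op_norm_le T (B : R) : (forall f, in_H omega f -> Hnorm omega f <= 1 -> Hnorm omega (T f) <= B) ->
  op_norm omega T <= B.
Proof.
move=> h; apply: ge_sup.
  exists (Hnorm omega (T (fun=> 0))); exists (fun=> 0) => //; split; first exact: in_H_cst.
  exact: le_trans Hnorm_zero ler01.
by move=> _ [f [hf f1] <-]; exact: h.
Qed.

Lemma approx_number_le T S n : bounded_op omega S -> rank_lt omega S n ->
  approx_number omega T n <= op_norm omega (fun f => T f - S f).
Proof.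
move=> hS rS; apply: ge_inf; last by exists S.
by exists 0 => _ [U _ <-]; exact: op_norm_ge0.
Qed.

Lemma bounded_op_zero : bounded_op omega (fun _ _ => 0).
Proof.
split.
- by move=> f _; exact: in_H_cst.
- by move=> f g _ _ _ z _.
- by move=> a f g _ _ z _; rewrite cmulE mulr0 addr0.
by exists 0 => f _; rewrite mul0r; exact: Hnorm_zero.
Qed.

Lemma approx_number_ge T n (c : R) : (0 < n)%N ->
  (forall S, bounded_op omega S -> rank_lt omega S n -> c <= op_norm omega (fun f => T f - S f)) ->
  c <= approx_number omega T n.
Proof.
move=> n0 h; apply: lb_le_inf; last by move=> _ [S [hS rS] <-]; exact: h.
(* The infimum needs a nonempty set: the zero operator, of rank 0, is always admissible. *)
exists (op_norm omega (fun f => T f - (fun _ => 0))), (fun _ _ => 0); last by []; split; first exact: bounded_op_zero.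
exists 0%N; split => //; exists (fun _ _ => 0); split; first by case.
by move=> f _; exists (fun=> 0) => z _; rewrite big_ord0.
Qed.

Lemma approx_number_ge0 T n : 0 <= approx_number omega T n.
Proof.
rewrite /approx_number; set A := [set _ | _ in _].
have [A0|A0] := pselect (A !=set0); first by apply: lb_le_inf => // _ [S _ <-]; exact: op_norm_ge0.
suff -> : A = set0 by rewrite inf0.
by rewrite -subset0 => x Ax; apply: A0; exists x.
Qed.

End Operators.

(** * Blaschke products and discrete potentials *)

Section BlaschkeProducts.
Variable R : realType.
Implicit Types (a z w : cplx R) (s : seq (R * R)).

Lemma blasp_cons a s z : blasp (a :: s) z = blas a z * blasp s z.
Proof. exact: big_cons. Qed.

(** All factors are at most 1 in modulus, so the derivative grows only linearly in their number. *)
Lemma blasp_deriv s z (r : R) : {in s, forall a, cmod a <= r} -> r < 1 -> cmod z <= 1 ->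
  exists2 l : cplx R, is_cderiv (blasp s) z l & cmod l <= (size s)%:R * (1 - r) ^- 2.
Proof.
move=> + r1 z1; elim: s => [_|a s IH hs].
  exists 0; last by rewrite cmod0 mul0r.
  have -> : blasp [::] = (fun _ : cplx R => 1 : cplx R) by apply/funext => w; exact: big_nil.
  exact: is_cderiv_cst.
have ar : cmod a <= r by apply: hs; rewrite inE eqxx.
have [|l hl lb] := IH; first by move=> b bs; apply: hs; rewrite inE bs orbT.
have a1 : cmod a < 1 := le_lt_trans ar r1.
have -> : blasp (a :: s) = (fun w : cplx R => blas a w * blasp s w) by apply/funext => w; exact: blasp_cons.
exists (rc (1 - cmod a ^+ 2) / bden a z ^+ 2 * blasp s z + blas a z * l).
  exact: (is_cderivM (blas_deriv a1 z1) hl).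
apply: le_trans (ler_cmodD _ _) _; rewrite (cmodM (_ / _)) (cmodM (blas a z)).
rewrite [(size (a :: s))%:R](_ : _ = 1 + (size s)%:R); last by rewrite nat1r.
rewrite mulrDl mul1r.
apply: lerD.
  apply: le_trans (blas_deriv_le ar r1 z1); rewrite ler_piMr ?cmod_ge0 // blasp_le1 // => b bs.
  by apply: le_lt_trans r1; apply: hs; rewrite inE bs orbT.
by apply: le_trans lb; rewrite ler_piMl ?cmod_ge0 // blas_le1.
Qed.

Lemma blasp_mem s z : z \in s -> blasp s z = 0.
Proof.
elim: s => // a s IH; rewrite inE blasp_cons => /predU1P[->|/IH ->]; last by rewrite mulr0.
by rewrite /blas subrr mul0r mul0r.
Qed.

(** The dictionary between the two sides: a Blaschke product is the exponential of minus the
    discrete Green potential. *)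
Lemma pot_gker s z : {in s, forall a, cmod a < 1} -> cmod z < 1 -> z \notin s ->
  exists2 c : R, pot (@gker R) s z = c%:E & cmod (blasp s z) = expR (- c).
Proof.
move=> + z1; elim: s => [_ _|a s IH hs]; first by exists 0; rewrite /pot ?big_nil // /blasp big_nil cmod1 oppr0 expR0.
rewrite inE negb_or => /andP[za /IH]; case; first by move=> b bs; apply: hs; rewrite inE bs orbT.
have a1 : cmod a < 1 by apply: hs; rewrite inE eqxx.
move=> c pc bc; exists (gr z a + c); first by rewrite pot_cons pc /gker z1 a1 /= greenE (negPf za).
by rewrite blasp_cons cmodM bc gr_blas // opprD expRD.
Qed.

Lemma pot_gker_mem s z : cmod z < 1 -> z \in s -> pot (@gker R) s z = +oo%E.
Proof.
move=> z1 zs; have e : gker z z = +oo%E by rewrite /gker z1 /= greenE eqxx.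
rewrite /pot (big_rem z) //= e addye //.
by rewrite gt_eqF // (lt_le_trans (@ltNyr R 0)) // sume_ge0 // => w _; exact: gker_ge0.
Qed.

Lemma blasp_le_pot s z (c : R) : {in s, forall a, cmod a < 1} -> cmod z < 1 ->
  (c%:E <= pot (@gker R) s z)%E -> cmod (blasp s z) <= expR (- c).
Proof.
move=> hs z1 cp; have [zs|zs] := boolP (z \in s); first by rewrite blasp_mem // cmod0 expR_ge0.
have [c' pE ->] := pot_gker hs z1 zs; rewrite ler_expR lerN2; by move: cp; rewrite pE lee_fin.
Qed.

Lemma blasp_ge_pot s z (c : R) : {in s, forall a, cmod a < 1} -> cmod z < 1 ->
  (pot (@gker R) s z <= c%:E)%E -> expR (- c) <= cmod (blasp s z).
Proof.
move=> hs z1 cp; have [zs|zs] := boolP (z \in s); first by move: cp; rewrite pot_gker_mem.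
have [c' pE ->] := pot_gker hs z1 zs; rewrite ler_expR lerN2; by move: cp; rewrite pE lee_fin.
Qed.

End BlaschkeProducts.

(** Turns a bound on the squared norm into one on the norm without a square root of [1 + q]. *)
Lemma sqr_scale_le (R : realType) (D q : R) : 0 <= q -> D ^+ 2 + D ^+ 2 * q <= ((1 + q) * D) ^+ 2.
Proof.
move=> q0; rewrite -subr_ge0 (_ : _ - _ = D ^+ 2 * (q + q ^+ 2)); last by ring.
by rewrite mulr_ge0 ?addr_ge0 ?sqr_ge0.
Qed.

Lemma deriv_sum (R : realType) (I : Type) (r : seq I) (f : I -> cplx R -> cplx R) (z : cplx R) (B : R) :
  (forall i, exists2 l : cplx R, is_cderiv (f i) z l & cmod l <= B) ->
  exists2 l : cplx R, is_cderiv (fun w => \sum_(i <- r) f i w) z l & cmod l <= (size r)%:R * B.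
Proof.
move=> hf; elim: r => [|i r [l hl lB]].
  exists 0; last by rewrite cmod0 mul0r.
  have -> : (fun w => \sum_(i <- [::]) f i w) = (fun _ : cplx R => 0 : cplx R) by apply/funext => w; exact: big_nil.
  exact: is_cderiv_cst.
have [l' hl' lB'] := hf i; exists (l' + l).
  have -> : (fun w => \sum_(j <- i :: r) f j w) = (fun w : cplx R => f i w + \sum_(j <- r) f j w).
    by apply/funext => w; exact: big_cons.
  exact: is_cderivD.
apply: le_trans (ler_cmodD _ _) _.
rewrite [(size (i :: r))%:R](_ : _ = 1 + (size r)%:R); last by rewrite nat1r.
by rewrite mulrDl mul1r lerD.
Qed.

Lemma lower_arith (R : realType) (m C W n Q e op h : R) : 0 < m -> 0 <= C -> 0 < W -> 0 < n -> 0 <= Q -> 0 < e -> 0 <= op ->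
  m <= C * h -> h <= W * (n * (m * (n * (1 + Q) * e))) * op ->
  (1 + C * (W * (1 + Q)))^-1 / n ^+ 2 * e^-1 <= op.
Proof.
move=> m0 C0 W0 n0 Q0 e0 op0 h1 h2; have P0 : 0 <= C * (W * (1 + Q)) by rewrite !mulr_ge0 ?addr_ge0 // ltW.
have := le_trans h1 (ler_wpM2l C0 h2).
have -> : C * (W * (n * (m * (n * (1 + Q) * e))) * op) = (C * (W * (1 + Q)) * (n ^+ 2 * e * op)) * m by ring.
rewrite -{1}[m]mul1r ler_pM2r //; move: (C * (W * (1 + Q))) P0 => P P0 hh.
rewrite -!invfM -[X in X <= _]mul1r ler_pdivrMr; last by rewrite !mulr_gt0 ?exprn_gt0 ?ltr_pwDl.
have X0 : 0 <= n ^+ 2 * e * op by rewrite !mulr_ge0 ?sqr_ge0 // ltW.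
have -> : op * ((1 + P) * n ^+ 2 * e) = n ^+ 2 * e * op + P * (n ^+ 2 * e * op) by ring.
by apply: le_trans hh _; rewrite lerDr.
Qed.

(** * Lower bound for the approximation numbers *)

Section LowerBound.
Variable R : realType.
Variable omega : R -> R.
Hypothesis omc : {within `[0, 1[, continuous omega}.
Hypothesis om0 : forall r : R, 0 <= r < 1 -> 0 < omega r.
Hypothesis omi : (@lebesgue_measure R).-integrable `[0, 1[ (EFin \o omega).
Variable phi : cplx R -> cplx R.
Hypothesis hT : bounded_op omega (Comp phi).

Lemma Hnorm_bounded : exists2 W : R, 0 < W & forall (f : cplx R -> cplx R) (D : R), 0 <= D -> analytic_on_disk f ->
  (forall z : cplx R, disk z -> cmod (cderiv f z) <= D) -> cmod (f 0) <= D ->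
  in_H omega f /\ Hnorm omega f <= W * D.
Proof.
pose q := fine (Dirichlet_integral omega id) / pi.
have q0 : 0 <= q by rewrite divr_ge0 ?pi_ge0 // (fDir_ge0 om0).
exists (1 + q); first by rewrite ltr_pwDl.
move=> f D D0 af fD f0; have [hf hD] := in_H_bounded omc om0 omi D0 af fD; split => //.
apply: (Hnorm_le om0); first by rewrite mulr_ge0 // addr_ge0.
rewrite /Hnorm2.
have h1 : cmod (f 0) ^+ 2 <= D ^+ 2 by rewrite ler_pXn2r ?nnegrE ?cmod_ge0.
have h2 : fine (Dirichlet_integral omega f) / pi <= D ^+ 2 * q.
  by rewrite /q mulrA ler_wpM2r // invr_ge0 pi_ge0.
exact: le_trans (lerD h1 h2) (sqr_scale_le D q0).
Qed.

Lemma nth_mem_drop_nth (T : eqType) (x0 : T) (s : seq T) i j : j != i -> (j < size s)%N ->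
  nth x0 s j \in take i s ++ drop i.+1 s.
Proof.
move=> + js; rewrite mem_cat; case: (ltngtP j i) => // ji _; apply/orP.
  by left; rewrite -(nth_take _ ji) mem_nth // size_take_min leq_min ji.
right; have -> : nth x0 s j = nth x0 (drop i.+1 s) (j - i.+1) by rewrite nth_drop subnKC.
by rewrite mem_nth // size_drop ltn_sub2r // (leq_ltn_trans ji).
Qed.

Lemma kernel_row (F : fieldType) (N k : nat) (M : 'M[F]_(N, k)) : (k < N)%N -> exists2 v : 'rV[F]_N, v != 0 & v *m M = 0.
Proof.
move=> kN; have : kermx M != 0.
  rewrite kermx_eq0; apply: contraL kN; rewrite -leqNgt => /eqP <-; exact: rank_leq_col.
by case/rowV0Pn => v /sub_kermxP vM v0; exists v.
Qed.

(** One power of [N] comes from the derivative of a Blaschke product, the other from summing [N]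
    Lagrange functions. The exponential bounds their normalizing factors. *)
Lemma approx_lower (rho r : R) : 0 <= rho -> rho < 1 -> r < 1 -> (forall z, cmod z < 1 -> cmod (phi z) <= r) ->
  exists2 c : R, 0 < c & forall N (s : seq (R * R)) (A : R), (0 < N)%N -> size s = N ->
    {in s, forall x, phi_ball phi rho x} ->
    (forall i, (i < N)%N -> (pot (@gker R) (drop_nth i s) (nth point s i) <= A%:E)%E) ->
    c / N%:R ^+ 2 * expR (- A) <= approx_number omega (Comp phi) N.
Proof.
move=> rho0 rho1 r1 phir.
have rr : 0 <= rho < 1 by rewrite rho0 rho1.
have [C C0 hC] := eval_bound omc om0 rr.
have [W W0 hW] := Hnorm_bounded.
pose Q := (1 - r) ^- 2; have Q0 : 0 <= Q by rewrite invr_ge0 sqr_ge0.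
exists (1 + C * (W * (1 + Q)))^-1; first by rewrite invr_gt0 ltr_pwDl // !mulr_ge0 ?addr_ge0 // ltW.
move=> N s A N0 sN sB sp.
have sr a : a \in s -> cmod a <= r.
  by move=> /sB[u ur <-]; apply: phir; exact: le_lt_trans ur rho1.
have s1 a : a \in s -> cmod a < 1 by move=> /sr h; exact: le_lt_trans h r1.
have dr i a : a \in drop_nth i s -> cmod a <= r by move=> /mem_drop_nth/sr.
have d1 i a : a \in drop_nth i s -> cmod a < 1 by move=> /mem_drop_nth/s1.
pose y (i : 'I_N) : cplx R := nth point s i.
have ys i : y i \in s by apply: mem_nth; rewrite sN.
pose D (i : 'I_N) : cplx R := blasp (drop_nth i s) (y i).
have Dge i : expR (- A) <= cmod (D i).
  by apply: blasp_ge_pot; [exact: d1|exact: s1|exact: sp].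
have D0 i : D i != 0 by rewrite -cmod_gt0; apply: lt_le_trans (Dge i); exact: expR_gt0.
have DV i : cmod (D i)^-1 <= expR A.
  by rewrite cmodV -[expR A]invrK -expRN lef_pV2 ?posrE ?expR_gt0 // cmod_gt0.
pose F (i : 'I_N) : cplx R -> cplx R := fun z => (D i)^-1 * blasp (drop_nth i s) z.
have Fyy i : F i (y i) = 1 by rewrite /F mulVf.
have Fyj i j : i != j -> F i (y j) = 0.
  by move=> ij; rewrite /F blasp_mem ?mulr0 // nth_mem_drop_nth ?sN // eq_sym.
pose B := N%:R * (1 + Q) * expR A.
have B0 : 0 <= B by rewrite !mulr_ge0 ?addr_ge0 ?expR_ge0.
have Fd (i : 'I_N) (z : cplx R) : cmod z < 1 -> exists2 l : cplx R, is_cderiv (F i) z l & cmod l <= B.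
  move=> z1; have [l hl lB] := blasp_deriv (dr i) r1 (ltW z1); exists ((D i)^-1 * l); first exact: is_cderivZ.
  rewrite cmodM /B mulrC; apply: ler_pM; rewrite ?cmod_ge0 //; apply: le_trans lB _.
  by apply: ler_pM; rewrite ?lerDr // ler_nat size_drop_nth ?sN // leq_pred.
have F0 (i : 'I_N) : cmod (F i 0) <= B.
  rewrite /F cmodM /B mulrC; apply: ler_pM; rewrite ?cmod_ge0 //.
  apply: le_trans (_ : 1 <= _); first by apply: blasp_le1; rewrite ?cmod0 //; exact: d1.
  by rewrite -[leLHS](mulr1 1); apply: ler_pM; rewrite ?lerDl // ler1n.
have Fan i : analytic_on_disk (F i) by move=> z /(Fd i)[l hl _]; exists l.
have FH i : in_H omega (F i).
  by apply: (hW (F i) B B0 (Fan i) _ (F0 i)).1 => z /(Fd i)[l hl lB]; rewrite (cderivE hl).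
apply: approx_number_ge => // S hS [k [kN [g [gH gS]]]].
have /choice[m hm] i : exists c : 'I_k -> R * R, eq_on_disk (S (F i)) (fun z => \sum_(j < k) cmul (c j) (g j z)).
  exact: gS.
pose M : 'M[cplx R]_(N, k) := \matrix_(i, j) (m i j : cplx R).
have [v v0 vM] := kernel_row M kN.
pose f : cplx R -> cplx R := fun z => \sum_(i < N) v 0 i * F i z.
have Sf : eq_on_disk (S f) (fun=> 0).
  move=> z z1; have -> : S f z = \sum_(i < N) v 0 i * (S (F i) z : cplx R) := op_sum omc om0 _ (v 0) hS FH z1.
  have e i : (S (F i) z : cplx R) = \sum_(j < k) M i j * (g j z : cplx R).
    by rewrite hm //; apply: eq_bigr => j _; rewrite mxE.
  under eq_bigr do rewrite e mulr_sumr.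
  rewrite exchange_big /= big1 // => j _; under eq_bigr do rewrite mulrA.
  rewrite -mulr_suml; have /rowP/(_ j) := vM; rewrite !mxE => ->.
  by rewrite mul0r.
(* At the point with the largest coefficient, [f] takes that coefficient as value, while its norm is
   at most a multiple of it; the coefficient then cancels. *)
have [im him] : exists im, forall i, cmod (v 0 i) <= cmod (v 0 im).
  by case: (@arg_maxP _ _ _ (Ordinal N0) xpredT (fun i => cmod (v 0 i))) => // im _ h; exists im => i; exact: h.
set mx := cmod (v 0 im) in him.
have mx0 : 0 < mx.
  rewrite lt_def cmod_ge0 andbT; apply: contra v0 => /eqP mE; apply/eqP/rowP => i; rewrite mxE.
  by apply/eqP; rewrite -cmod_eq0 eq_le cmod_ge0 andbT -mE.
have sz : size (index_enum 'I_N) = N by rewrite -[RHS]card_ord cardE enumT.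
pose K := W * (N%:R * (mx * B)).
have Bp : 0 < B by rewrite !mulr_gt0 ?expR_gt0 ?ltr_pwDl ?ltr0n.
have NR : 0 < N%:R :> R by rewrite ltr0n.
have K0 : 0 < K := mulr_gt0 W0 (mulr_gt0 NR (mulr_gt0 mx0 Bp)).
have fd (z : cplx R) : cmod z < 1 -> exists2 l : cplx R, is_cderiv f z l & cmod l <= N%:R * (mx * B).
  move=> z1; rewrite -[in N%:R]sz; apply: deriv_sum => i; have [l hl lB] := Fd i z z1.
  exists (v 0 i * l); first exact: is_cderivZ.
  by rewrite cmodM; apply: ler_pM; rewrite ?cmod_ge0.
have fan : analytic_on_disk f by move=> z /fd[l hl _]; exists l.
have f0 : cmod (f 0) <= N%:R * (mx * B).
  apply: le_trans (cmod_sum _ _ _) _.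
  apply: le_trans (_ : \sum_(i < N) mx * B <= _); last by rewrite sumr_const card_ord mulr_natl.
  by apply: ler_sum => i _; rewrite cmodM; apply: ler_pM; rewrite ?cmod_ge0.
have [fH fK] := hW f _ (mulr_ge0 (ler0n _ N) (mulr_ge0 (ltW mx0) B0)) fan
  (fun z z1 => let: ex_intro2 l hl lB := fd z z1 in eq_ind_r (fun d => cmod d <= _) lB (cderivE hl)) f0.
have := op_norm_ub omc om0 hT hS fH K0 fK.
set op := op_norm _ _ => hop.
have op0 : 0 <= op by exact: op_norm_ge0.
have [u ur uy] := sB _ (ys im).
have [T1 _ _ _] := hT; have [S1 _ _ _] := hS; have hd := (in_H_sub omc om0 (T1 _ fH) (S1 _ fH)).1.
have := hC _ u hd ur; have -> : (Comp phi f - S f) u = f (phi u) - S f u by [].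
rewrite Sf ?subr0; last exact: le_lt_trans ur rho1.
have -> : f (phi u) = v 0 im.
  rewrite uy -/(y im) /f (bigD1 im) //= Fyy mulr1 big1 ?addr0 // => i ine.
  by rewrite Fyj ?mulr0.
move=> h1; rewrite expRN; apply: lower_arith h1 hop => //; exact: expR_gt0.
Qed.

End LowerBound.

(** * Interpolation at the zeros of a Blaschke product *)

Section Interpolation.
Variable R : realType.
Implicit Types (a z w : cplx R) (s : seq (R * R)).

(** The disc is rescaled to the unit disk and [cauchy_estimate0] is used at radius [1 / 2], whence
    the 4. *)
Lemma cauchy_scaled (f : cplx R -> cplx R) (a : cplx R) (delta M : R) : analytic_on_disk f -> 0 < delta ->
  (forall z, cmod (z - a) < delta -> cmod z < 1 /\ cmod (f z) <= M) -> cmod (cderiv f a) <= 4 * M / delta.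
Proof.
move=> hf d0 hz; pose g (u : cplx R) : cplx R := f (a + rc delta * u).
have in_ball (u : cplx R) : cmod u < 1 -> cmod ((a + rc delta * u) - a) < delta.
  by move=> u1; rewrite addrC addKr cmodM cmod_rc gtr0_norm // gtr_pMr.
have hg (u : cplx R) : cmod u < 1 -> is_cderiv g u ((cderiv f (a + rc delta * u) : cplx R) * rc delta).
  move=> u1; have h1 : is_cderiv (fun u : cplx R => a + rc delta * u) u (rc delta).
    by have := is_cderivD (is_cderiv_cst a u) (is_cderivZ (rc delta) (is_cderiv_id u)); rewrite add0r mulr1.
  by apply: (is_cderiv_comp h1); apply: analytic_is_cderiv => //; exact: (hz _ (in_ball u u1)).1.
have ga : analytic_on_disk g by move=> u /hg h; eexists; exact: h.
have h2 : 0 < (1 / 2 : R) < 1 by apply/andP; split; lra.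
have := cauchy_estimate0 ga h2 (M := M).
have -> : cderiv g 0 = (cderiv f a : cplx R) * rc delta.
  have c0 : cmod (0 : cplx R) < 1 by rewrite cmod0.
  by have := cderivE (hg 0 c0); rewrite mulr0 addr0.
rewrite cmodM cmod_rc gtr0_norm // => h.
have {}h : cmod (cderiv f a) * delta <= 2 * M / (1 / 2).
  by apply: h => u uE; apply: (hz _ (in_ball u _)).2; rewrite uE; lra.
by rewrite ler_pdivlMr //; apply: le_trans h _; rewrite le_eqVlt; apply/orP; left; apply/eqP; field.
Qed.

Lemma circle_radius (r eta : R) : 0 <= r -> r < 1 -> 0 < eta -> exists rho : R, [/\ r < rho, rho < 1 &
  forall a w, cmod a <= r -> cmod w = rho -> expR (- eta) <= cmod (blas a w)].
Proof.
move=> r0 r1 eta0; have e1 : expR (- eta) < 1 by rewrite -expR0 ltr_expR oppr_lt0.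
(* On the circle [1 - rho ^+ 2 <= 2 * (1 - rho) <= 2 * k], so the defect in [blas_lower] is at most
   [1 - expR (- eta)]. *)
pose k := (1 - expR (- eta)) * (1 - r) ^+ 2 / 2.
have k0 : 0 < k by rewrite divr_gt0 // mulr_gt0 ?exprn_gt0 ?subr_gt0.
pose rho := Num.max (1 - k) ((1 + r) / 2).
have rr : r < rho by rewrite lt_max; apply/orP; right; lra.
have rho1 : rho < 1 by rewrite gt_max; apply/andP; split; lra.
have rhok : 1 - k <= rho by rewrite le_max lexx.
exists rho; split => // a w ar wE; apply: le_trans (blas_lower ar r1 _); last by rewrite wE ltW.
rewrite lerBrDr addrC -lerBrDr ler_pdivrMr ?exprn_gt0 ?subr_gt0 // wE.
apply: le_trans (_ : 2 * k <= _); last by rewrite /k mulrC divfK.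
have h := mulr_ge0 (_ : 0 <= 1 - rho) (_ : 0 <= 1 - rho); rewrite subr_ge0 (ltW rho1) in h.
by have := h isT isT; rewrite expr2; lra.
Qed.

Lemma blasp_lower s w (eta : R) : {in s, forall a, expR (- eta) <= cmod (blas a w)} ->
  expR (- ((size s)%:R * eta)) <= cmod (blasp s w).
Proof.
elim: s => [_|a s IH hs]; first by rewrite mul0r oppr0 expR0 /blasp big_nil cmod1.
rewrite blasp_cons cmodM [(size (a :: s))%:R](_ : _ = 1 + (size s)%:R); last by rewrite nat1r.
rewrite mulrDl mul1r opprD expRD; apply: ler_pM; rewrite ?expR_ge0 ?hs ?inE ?eqxx //.
by apply: IH => b bs; apply: hs; rewrite inE bs orbT.
Qed.

(* [(1 - B z / B w) / (w - z) = \sum_i interp_coef s i w * interp_fun s i z] for the Blaschke product [B] of [s]. *)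
Fixpoint interp_fun s (i : nat) z : cplx R :=
  if s is a :: s' then
    if i is i'.+1 then blas a z * interp_fun s' i' z else (bden a z)^-1
  else 0.

Fixpoint interp_coef s (i : nat) w : cplx R :=
  if s is a :: s' then
    if i is i'.+1 then interp_coef s' i' w / blas a w else rc (1 - cmod (a : cplx R) ^+ 2) / (bden a w * blas a w)
  else 0.

(** Peel off one factor [b] with quotient [q = b z / b w]: [1 - q * Q = (1 - q) + q * (1 - Q)]. The
    first summand, divided by [w - z], separates into a function of [w] times a function of [z];
    this is [key]. *)
Lemma interp_sum s z w : {in s, forall a, cmod a < 1} -> cmod z <= 1 -> cmod w <= 1 ->
  {in s, forall a, blas a w != 0} -> w != z ->
  \sum_(i < size s) interp_coef s i w * interp_fun s i z = (1 - blasp s z / blasp s w) / (w - z).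
Proof.
move=> hs z1 w1 bw wz; have wz0 : w - z != 0 by rewrite subr_eq0.
elim: s hs bw => [_ _|a s IH hs bw].
  by rewrite big_ord0 /blasp !big_nil divr1 subrr mul0r.
have a1 : cmod a < 1 by apply: hs; rewrite inE eqxx.
have dz := bden_neq0 a1 z1; have dw := bden_neq0 a1 w1.
have ba : blas a w != 0 by apply: bw; rewrite inE eqxx.
have Bs : blasp s w != 0.
  rewrite /blasp prodf_seq_neq0; apply/allP => b bs /=; apply: bw; by rewrite inE bs orbT.
rewrite big_ord_recl /= !blasp_cons.
under eq_bigr => i _.
  rewrite add0n (_ : _ / _ * _ = (blas a z / blas a w) * (interp_coef s i w * interp_fun s i z)); last by ring.
  over.
rewrite -mulr_sumr IH; last 2 first.
- by move=> b bs; apply: hs; rewrite inE bs orbT.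
- by move=> b bs; apply: bw; rewrite inE bs orbT.
have key : rc (1 - cmod a ^+ 2) * (w - z) = (blas a w - blas a z) * (bden a w * bden a z).
  have -> : (blas a w - blas a z) * (bden a w * bden a z) = (w - a) * bden a z - (z - a) * bden a w.
    by rewrite /blas; field; rewrite dz dw.
  by rewrite rcB -cmul_conj (_ : rc 1 = 1) // /bden; ring.
have e1 : rc (1 - cmod a ^+ 2) = (blas a w - blas a z) * (bden a w * bden a z) / (w - z) by rewrite -key mulfK.
rewrite e1; field; rewrite wz0 dz dw ba Bs //.
Qed.

(** The bound may grow fast with [s]: it serves only to place the functions in the space, not to
    estimate the error. *)
Lemma interp_fun_deriv s i (r : R) : {in s, forall a, cmod a <= r} -> r < 1 ->
  exists2 B : R, 0 <= B & forall z, cmod z < 1 -> cmod (interp_fun s i z) <= B /\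
    exists2 l : cplx R, is_cderiv (interp_fun s i) z l & cmod l <= B.
Proof.
move=> + r1; elim: s i => [|a s IH] i hs.
  exists 0 => // z z1 /=; rewrite cmod0; split => //; exists 0; last by rewrite cmod0.
  exact: is_cderiv_cst.
have ar : cmod a <= r by apply: hs; rewrite inE eqxx.
have a1 := le_lt_trans ar r1; have r0 : 0 < 1 - r by rewrite subr_gt0.
have hs' : {in s, forall a, cmod a <= r} by move=> b bs; apply: hs; rewrite inE bs orbT.
case: i => [|i].
  exists ((1 - r)^-1 + (1 - r) ^- 2); first by rewrite addr_ge0 ?invr_ge0 ?sqr_ge0 // ltW.
  move=> z /ltW z1; have b1 := bden_ge1 ar z1; have b0 := bden_gt0 a1 z1; have bn := bden_neq0 a1 z1.
  have V : (cmod (bden a z))^-1 <= (1 - r)^-1 by rewrite lef_pV2 ?posrE.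
  split; first by rewrite /= cmodV; apply: le_trans V _; rewrite lerDl invr_ge0 sqr_ge0.
  exists (- bden a z ^- 2 * - (cconj a : cplx R)); first exact: (is_cderiv_inv bn (bden_deriv a z)).
  rewrite mulrNN cmodM cmod_conj cmodV cmodX; apply: le_trans (_ : (1 - r) ^- 2 <= _); last by rewrite lerDr invr_ge0 ltW.
  rewrite -[leRHS]mulr1; apply: ler_pM; rewrite ?invr_ge0 ?sqr_ge0 ?cmod_ge0 // ?(ltW a1) //.
  by rewrite -!exprVn ler_pXn2r ?nnegrE ?invr_ge0 ?cmod_ge0 // ltW.
have [B B0 hB] := IH i hs'; exists ((1 - r) ^- 2 * B + B); first by rewrite addr_ge0 // mulr_ge0 ?invr_ge0 ?sqr_ge0.
move=> z z1; have [h1 [l hl lB]] := hB z z1; have bl := blas_le1 a1 (ltW z1).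
have Q0 : 0 <= (1 - r) ^- 2 * B by rewrite mulr_ge0 ?invr_ge0 ?sqr_ge0.
split.
  rewrite /= cmodM; apply: le_trans (_ : B <= _); last by rewrite lerDr.
  by apply: le_trans h1; rewrite ler_piMl ?cmod_ge0.
exists (rc (1 - cmod a ^+ 2) / bden a z ^+ 2 * interp_fun s i z + blas a z * l).
  exact: (is_cderivM (blas_deriv a1 (ltW z1)) hl).
apply: le_trans (ler_cmodD _ _) _; rewrite (cmodM (_ / _)) (cmodM (blas a z)).
apply: lerD; first by apply: ler_pM; rewrite ?cmod_ge0 // blas_deriv_le // ltW.
by apply: le_trans lB; rewrite ler_piMl ?cmod_ge0.
Qed.

Lemma interp_coef_ccont s i (rho : R) : {in s, forall a, cmod a < rho} -> 0 <= rho < 1 ->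
  ccont 0 (2 * pi) (fun t => interp_coef s i (circ rho t)).
Proof.
move=> + r01; have /andP[r0 r1] := r01; elim: s i => [|a s IH] i hs; first exact: ccont_cst.
have ar : cmod a < rho by apply: hs; rewrite inE eqxx.
have a1 := lt_trans ar r1.
have cm t : cmod (circ rho t) <= 1 by rewrite cmod_circ // ltW.
have bc : ccont 0 (2 * pi) (fun t => blas a (circ rho t)).
  by apply: analytic_circ_ccont => // z /ltW z1; eexists; exact: blas_deriv.
have bn t : blas a (circ rho t) != 0.
  by rewrite /blas mulf_neq0 ?invr_eq0 ?bden_neq0 // circ_neq.
have hs' : {in s, forall a, cmod a < rho} by move=> b bs; apply: hs; rewrite inE bs orbT.
case: i => [|i] /=.
  apply: ccontM; first exact: ccont_cst.
  apply: ccontV => [t _|]; first by rewrite mulf_neq0 ?bden_neq0.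
  apply: ccontM => //; apply: analytic_circ_ccont => // z _; eexists; exact: bden_deriv.
by apply: ccontM; [exact: IH|apply: ccontV].
Qed.

End Interpolation.

(** * Upper bound for the approximation numbers *)

Section UpperBound.
Variable R : realType.
Variable omega : R -> R.
Hypothesis omc : {within `[0, 1[, continuous omega}.
Hypothesis om0 : forall r : R, 0 <= r < 1 -> 0 < omega r.
Hypothesis omi : (@lebesgue_measure R).-integrable `[0, 1[ (EFin \o omega).
Variable phi : cplx R -> cplx R.
Hypothesis hphi : analytic_on_disk phi.
Hypothesis phiD : forall z, disk z -> disk (phi z).
Hypothesis hT : bounded_op omega (Comp phi).

Lemma Hnorm2_sum_le (I : Type) (l : seq I) (G : I -> cplx R -> cplx R) : (forall i, in_H omega (G i)) ->
  exists2 P : R, 0 <= P & forall (c : I -> cplx R) (X : R), (forall i, cmod (c i) <= X) ->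
    Hnorm2 omega (fun z => \sum_(i <- l) c i * G i z) <= P * X ^+ 2.
Proof.
move=> hG; elim: l => [|i l [P P0 hP]].
  exists 0 => // c X _; rewrite mul0r; rewrite -(Hnorm_sqr om0).
  have -> : Hnorm omega (fun z => \sum_(i <- [::]) c i * G i z) = Hnorm omega (fun=> 0).
    by apply: Hnorm_eq => z _; rewrite big_nil.
  have -> : Hnorm omega (fun=> 0) = 0 by apply/le_anti; rewrite (Hnorm_zero omc om0) Hnorm_ge0.
  by rewrite expr0n.
exists (2 * Hnorm2 omega (G i) + 2 * P).
  by rewrite addr_ge0 // mulr_ge0 // (Hnorm2_ge0 om0).
move=> c X cX; have [_] := in_H_comb omc om0 (c i) (hG i) (in_H_sum omc om0 l c hG).
have -> : Hnorm2 omega (fun z => c i * G i z + \sum_(j <- l) c j * G j z) =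
    Hnorm2 omega (fun z => \sum_(j <- i :: l) c j * G j z).
  by congr (Hnorm2 omega _); apply/funext => z; rewrite big_cons.
move/le_trans; apply; have := hP c X cX; have := Hnorm2_ge0 om0 (G i).
move: (Hnorm2 omega (G i)) => p p0; move: (Hnorm2 omega _) => q hq.
rewrite (mulrDl (2 * p)); apply: lerD; last by rewrite -mulrA ler_wpM2l.
rewrite mulrAC ler_wpM2l ?mulr_ge0 // ler_pXn2r ?nnegrE ?cmod_ge0 //.
exact: le_trans (cmod_ge0 _) (cX i).
Qed.

Section Interpolant.
Variables (s : seq (R * R)) (r rho : R).
Hypothesis r0 : 0 <= r.
Hypothesis rrho : r < rho.
Hypothesis rho1 : rho < 1.
Hypothesis sr : {in s, forall a, cmod a <= r}.

Let rho01 : 0 <= rho < 1. Proof. by rewrite rho1 andbT (le_trans r0) // ltW. Qed.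

Let rho0 : 0 <= rho. Proof. by case/andP: rho01. Qed.

Let circ1 t : disk (circ rho t). Proof. by rewrite /disk /= cmod_circ. Qed.

Let pi2 : 0 <= 2 * pi :> R. Proof. by rewrite mulr_ge0 ?pi_ge0. Qed.

Definition interp_int (f : cplx R -> cplx R) (i : nat) (t : R) : cplx R :=
  f (circ rho t) * circ rho t * interp_coef s i (circ rho t).

Definition interp_func (f : cplx R -> cplx R) (i : nat) : cplx R := rc (2 * pi)^-1 * cint 0 (2 * pi) (interp_int f i).

Definition interp_op (f : R * R -> R * R) : R * R -> R * R :=
  fun z => \sum_(i < size s) interp_func f i * interp_fun s i (phi z).

Lemma interp_int_ccont f i : in_H omega f -> ccont 0 (2 * pi) (interp_int f i).
Proof.
move=> [fa _]; apply: ccontM; last by apply: interp_coef_ccont => // a /sr h; exact: le_lt_trans h rrho.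
by apply: ccontM; [exact: analytic_circ_ccont|exact: circ_ccont].
Qed.

Lemma interp_func_lin (c : cplx R) f g i : in_H omega f -> in_H omega g ->
  interp_func (fun z => c * f z + g z) i = c * interp_func f i + interp_func g i.
Proof.
move=> hf hg; have cf := interp_int_ccont i hf; have cg := interp_int_ccont i hg.
have cc : ccont 0 (2 * pi) (fun t => c * interp_int f i t) by apply: ccontM => //; exact: ccont_cst.
rewrite /interp_func mulrCA -mulrDr -(cintZ c pi2 cf) -(cintD pi2 cc cg).
by congr (_ * _); apply: cint_ext => // t _; rewrite /interp_int; ring.
Qed.

Lemma interp_func_eq f g i : eq_on_disk f g -> interp_func f i = interp_func g i.
Proof. by move=> fg; congr (_ * _); apply: cint_ext => // t _; rewrite /interp_int fg. Qed.

Lemma interp_func_le : exists2 P : R, 0 <= P & forall f (i : 'I_(size s)), in_H omega f ->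
  cmod (interp_func f i) <= P * Hnorm omega f.
Proof.
have [C C0 hC] := eval_bound omc om0 rho01.
have /choice[p hp] (i : 'I_(size s)) : exists p : R, 0 <= p /\ forall f, in_H omega f ->
    cmod (interp_func f i) <= p * Hnorm omega f.
  have cc : ccont 0 (2 * pi) (fun t => interp_coef s i (circ rho t)).
    by apply: interp_coef_ccont => // a /sr h; exact: le_lt_trans h rrho.
  have [M M0 hM] := ccont_bounded pi2 cc.
  exists (`|(2 * pi)^-1| * (2 * (C * M) * (2 * pi))); split; first by rewrite !mulr_ge0 ?pi_ge0.
  move=> f hf; rewrite /interp_func cmodM cmod_rc -[leRHS]mulrA; apply: ler_wpM2l => //.
  have := @cint_bound R 0 (2 * pi) (interp_int f i) (C * Hnorm omega f * M) pi2 (interp_int_ccont i hf).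
  rewrite subr0 => h; apply: le_trans (h _) _.
    move=> t t01; rewrite /interp_int !cmodM; apply: ler_pM; rewrite ?mulr_ge0 ?cmod_ge0 // ?hM //.
    rewrite -[leRHS]mulr1; apply: ler_pM; rewrite ?cmod_ge0 //; last by rewrite cmod_circ // ltW.
    by apply: hC => //; rewrite cmod_circ.
  by rewrite le_eqVlt; apply/orP; left; apply/eqP; ring.
exists (\sum_i p i); first by apply: sumr_ge0 => i _; case: (hp i).
move=> f i hf; apply: le_trans ((hp i).2 f hf) _; rewrite ler_wpM2r ?Hnorm_ge0 //.
by rewrite (bigD1 i) //= lerDl; apply: sumr_ge0 => j _; case: (hp j).
Qed.

Lemma interp_fun_H i : in_H omega (interp_fun s i).
Proof.
have r1 := lt_trans rrho rho1; have [B B0 hB] := interp_fun_deriv i sr r1.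
apply: (in_H_bounded omc om0 omi B0 _ _).1.
  by move=> z /hB[_ [l hl _]]; exists l.
by move=> z /hB[_ [l hl lB]]; rewrite (cderivE hl).
Qed.

Let G (i : 'I_(size s)) : cplx R -> cplx R := fun z => interp_fun s i (phi z).

Let GH i : in_H omega (G i).
Proof. by have [T1 _ _ _] := hT; apply: (T1 (interp_fun s i)); exact: interp_fun_H. Qed.

Lemma interp_op_bounded : bounded_op omega interp_op.
Proof.
have [P P0 hP] := interp_func_le.
have [P' P'0 hP'] := @Hnorm2_sum_le _ (index_enum 'I_(size s)) G GH.
split.
- by move=> f _; exact: (in_H_sum omc om0 _ _ GH).
- by move=> f g _ _ fg z _; apply: eq_bigr => i _; rewrite (interp_func_eq i fg).
- move=> c f g hf hg z _; rewrite cmulE /interp_op mulr_sumr -big_split /=; apply: eq_bigr => i _.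
  by rewrite (interp_func_lin c i hf hg) mulrDl mulrA.
exists ((1 + P') * P) => f hf.
have X0 : 0 <= P * Hnorm omega f by rewrite mulr_ge0 ?Hnorm_ge0.
rewrite -mulrA; apply: (Hnorm_le om0); first by rewrite mulr_ge0 // addr_ge0.
apply: le_trans (hP' (fun i => interp_func f i) (P * Hnorm omega f) (fun i => hP f i hf)) _.
apply: le_trans (sqr_scale_le _ P'0); rewrite mulrC lerDr sqr_ge0 //.
Qed.

Lemma interp_op_rank : rank_lt omega interp_op (size s).+1.
Proof.
exists (size s); split => //; exists G; split; first exact: GH.
by move=> f hf; exists (fun i => interp_func f i) => z _.
Qed.

Definition interp_err (f : cplx R -> cplx R) : cplx R -> cplx R :=
  fun z => f z - \sum_(i < size s) interp_func f i * interp_fun s i z.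

Lemma interp_err_analytic f : in_H omega f -> analytic_on_disk (interp_err f).
Proof.
move=> hf; have hS := in_H_sum omc om0 (index_enum 'I_(size s)) (interp_func f) interp_fun_H.
have [ha _] := (in_H_sub omc om0 hf hS).1; exact: ha.
Qed.

(** Hermite's remainder: subtracting the separated kernel of [interp_sum] from the Cauchy kernel
    leaves the quotient of the Blaschke product at [z] and on the circle. *)
Lemma interp_errE (f : cplx R -> cplx R) (z : cplx R) : in_H omega f -> cmod z <= r ->
  rc (2 * pi) * interp_err f z = cint 0 (2 * pi) (fun t => f (circ rho t) * circ rho t / (circ rho t - z) *
    (blasp s z / blasp s (circ rho t))).
Proof.
move=> hf zr; have [fa _] := hf; have zrho : cmod z < rho := le_lt_trans zr rrho.
have pn : rc (2 * pi) != 0 :> cplx R by rewrite rc_eq0 mulf_neq0 // ?gt_eqF ?pi_gt0.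
have cs : ccont 0 (2 * pi) (fun t => f (circ rho t) * circ rho t / (circ rho t - z)).
  apply: ccontM; first by apply: ccontM; [exact: analytic_circ_ccont|exact: circ_ccont].
  by apply: ccontV => [t _|]; [exact: circ_neq|apply: ccontB; [exact: circ_ccont|exact: ccont_cst]].
have sumE (l : seq 'I_(size s)) : ccont 0 (2 * pi) (fun t => \sum_(i <- l) interp_fun s i z * interp_int f i t) /\
    rc (2 * pi) * \sum_(i <- l) interp_func f i * interp_fun s i z =
    cint 0 (2 * pi) (fun t => \sum_(i <- l) interp_fun s i z * interp_int f i t).
  elim: l => [|i l [c1 e1]].
    have -> : (fun t => \sum_(i <- ([::] : seq 'I_(size s))) interp_fun s i z * interp_int f i t) = (fun _ : R => (0 : cplx R) * 0).
      by apply/funext => t; rewrite big_nil mulr0.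
    split; first exact: ccont_cst.
    by rewrite big_nil mulr0 cintZ ?mul0r //; exact: ccont_cst.
  have c2 : ccont 0 (2 * pi) (fun t => interp_fun s i z * interp_int f i t).
    by apply: ccontM; [exact: ccont_cst|exact: interp_int_ccont].
  have -> : (fun t => \sum_(j <- i :: l) interp_fun s j z * interp_int f j t) =
      (fun t => interp_fun s i z * interp_int f i t + \sum_(j <- l) interp_fun s j z * interp_int f j t).
    by apply/funext => t; rewrite big_cons.
  split; first exact: ccontD.
  rewrite (cintD pi2 c2 c1) -e1 big_cons mulrDr (cintZ _ pi2 (interp_int_ccont i hf)).
  congr (_ + _); rewrite /interp_func mulrA [RHS]mulrC; congr (_ * _).
  by rewrite rcV; exact: (mulVKf pn).
have [c1 e1] := sumE (index_enum 'I_(size s)).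
rewrite /interp_err mulrBr e1 (cauchy_formula fa rho1 zrho) -cintB //; apply: cint_ext => // t _.
have wz : circ rho t != z by rewrite -subr_eq0; exact: circ_neq.
have K := @interp_sum R s z (circ rho t) _ _ _ _ wz.
have -> : \sum_(i < size s) interp_fun s i z * interp_int f i t =
    f (circ rho t) * circ rho t * ((1 - blasp s z / blasp s (circ rho t)) / (circ rho t - z)).
  rewrite -K.
  - by rewrite mulr_sumr; apply: eq_bigr => i _; rewrite /interp_int; ring.
  - by move=> a /sr h; exact: le_lt_trans h (lt_trans rrho rho1).
  - by apply: ltW; apply: lt_trans rho1.
  - by rewrite cmod_circ // ltW.
  - move=> a /sr h; rewrite /blas mulf_neq0 ?invr_eq0 ?bden_neq0 //.
    + by rewrite circ_neq // (le_lt_trans h).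
    + exact: le_lt_trans h (lt_trans rrho rho1).
    + by rewrite cmod_circ // ltW.
by ring.
Qed.

End Interpolant.

Lemma interp_err_le (s : seq (R * R)) (r rho eta C b : R) (f : cplx R -> cplx R) (z : cplx R) :
  0 <= r -> r < rho -> rho < 1 -> {in s, forall a, cmod a <= r} ->
  (forall a w : cplx R, cmod a <= r -> cmod w = rho -> expR (- eta) <= cmod (blas a w)) ->
  in_H omega f -> 0 <= C -> (forall w : cplx R, cmod w <= rho -> cmod (f w) <= C) ->
  cmod z <= r -> cmod (blasp s z) <= b ->
  cmod (interp_err s rho f z) <= 2 * (C / (rho - r) * (b * expR ((size s)%:R * eta))).
Proof.
move=> r0 rrho rho1 sr hb hf C0 hC zr zb; have [fa _] := hf.
have rho0 : 0 <= rho by rewrite (le_trans r0) // ltW.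
have rho01 : 0 <= rho < 1 by rewrite rho0 rho1.
have pi2 : 0 < 2 * pi :> R by rewrite mulr_gt0 // pi_gt0.
have cm t : cmod (circ rho t) = rho by rewrite cmod_circ.
have zrho : cmod z < rho := le_lt_trans zr rrho.
have bw t : expR (- ((size s)%:R * eta)) <= cmod (blasp s (circ rho t)).
  by apply: blasp_lower => a /sr ar; apply: hb.
have bn t : blasp s (circ rho t) != 0.
  by rewrite -cmod_gt0; apply: lt_le_trans (bw t); exact: expR_gt0.
have cc : ccont 0 (2 * pi) (fun t => f (circ rho t) * circ rho t / (circ rho t - z) * (blasp s z / blasp s (circ rho t))).
  apply: ccontM; first apply: ccontM.
  - by apply: ccontM; [exact: analytic_circ_ccont|exact: circ_ccont].
  - by apply: ccontV => [t _|]; [exact: circ_neq|apply: ccontB; [exact: circ_ccont|exact: ccont_cst]].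
  apply: ccontM; [exact: ccont_cst|apply: ccontV => [t _ //|]].
  apply: analytic_circ_ccont => // w w1.
  by have [l hl _] := blasp_deriv sr (lt_trans rrho rho1) (ltW w1); exists l.
have hM t : cmod (f (circ rho t) * circ rho t / (circ rho t - z) * (blasp s z / blasp s (circ rho t))) <=
    C / (rho - r) * (b * expR ((size s)%:R * eta)).
  rewrite cmodM; apply: ler_pM; rewrite ?cmod_ge0 //.
    rewrite cmod_div; apply: ler_pM; rewrite ?invr_ge0 ?cmod_ge0 //.
      by rewrite cmodM -[leRHS]mulr1; apply: ler_pM; rewrite ?cmod_ge0 ?hC ?cm // (ltW rho1).
    rewrite lef_pV2 ?posrE ?subr_gt0 //; last by rewrite cmod_gt0 circ_neq.
    by apply: le_trans (ler_cmodB _ _); rewrite cm; lra.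
  rewrite cmod_div; apply: ler_pM; rewrite ?invr_ge0 ?cmod_ge0 //.
  by rewrite -[expR _]invrK -expRN lef_pV2 ?posrE ?expR_gt0 // cmod_gt0.
have := cint_bound (ltW pi2) cc (fun t _ => hM t).
rewrite -(interp_errE r0 rrho rho1 sr hf zr) cmodM cmod_rc gtr0_norm // subr0 mulrC ler_pM2r //.
Qed.

(** [phi] is the image of the identity function, so its Dirichlet integral is finite; [approx_upper]
    depends on this. *)
Lemma phi_H : in_H omega phi.
Proof. by have [T1 _ _ _] := hT; exact: (T1 _ (in_H_id omc om0 omi)). Qed.

(** The error of the operator is the interpolation error composed with [phi]. Its outer derivative
    at [phi z] is at most [4 * X / delta], since the disc of radius [delta] there lies in the
    neighbourhood; the inner derivative yields the Dirichlet integral of [phi]. *)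
Lemma approx_upper (r delta eta : R) : 0 <= r -> r < 1 -> 0 < delta -> 0 < eta ->
  phi_nbhd phi delta `<=` [set z | cmod z <= r] ->
  exists2 C : R, 0 <= C & forall (s : seq (R * R)) (b : R), {in s, forall a, cmod a <= r} -> 0 <= b ->
    (forall w, phi_nbhd phi delta w -> cmod (blasp s w) <= b) ->
    approx_number omega (Comp phi) (size s).+1 <= C * (b * expR ((size s)%:R * eta)).
Proof.
move=> r0 r1 d0 eta0 Nr; have [rho [rrho rho1 hb]] := circle_radius r0 r1 eta0.
have rho01 : 0 <= rho < 1 by rewrite rho1 andbT (le_trans r0) // ltW.
have [C C0 hC] := eval_bound omc om0 rho01.
pose q := (4 / delta) ^+ 2 * (fine (Dirichlet_integral omega phi) / pi).
have q0 : 0 <= q by rewrite mulr_ge0 ?sqr_ge0 // divr_ge0 ?pi_ge0 // (fDir_ge0 om0).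
pose k := 2 * (C / (rho - r)); have k0 : 0 <= k by rewrite mulr_ge0 // divr_ge0 // subr_ge0 ltW.
exists ((1 + q) * k); first by rewrite mulr_ge0 // addr_ge0.
move=> s b sr b0 sb; pose S := interp_op s rho.
have hS : bounded_op omega S := interp_op_bounded r0 rrho rho1 sr.
have rS : rank_lt omega S (size s).+1  by apply: interp_op_rank rrho rho1 sr.
apply: le_trans (approx_number_le (Comp phi) hS rS) _; apply: (op_norm_le omc om0) => f hf f1.
pose X := k * (b * expR ((size s)%:R * eta)).
have X0 : 0 <= X by rewrite mulr_ge0 // mulr_ge0 ?expR_ge0.
have fC (w : cplx R) : cmod w <= rho -> cmod (f w) <= C.
  by move=> wr; apply: le_trans (hC f w hf wr) _; rewrite ler_piMr.
have errX (w : cplx R) : phi_nbhd phi delta w -> cmod (interp_err s rho f w) <= X.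
  move=> Nw; have := interp_err_le r0 rrho rho1 sr hb hf C0 fC (Nr _ Nw) (sb _ Nw).
  by rewrite /X /k [X in _ <= X -> _]mulrA.
pose e : cplx R -> cplx R := fun z => interp_err s rho f (phi z).
have ea : analytic_on_disk (interp_err s rho f) by exact: (interp_err_analytic rrho rho1 sr hf).
have ed (z : cplx R) : cmod z < 1 -> is_cderiv e z ((cderiv (interp_err s rho f) (phi z) : cplx R) * (cderiv phi z : cplx R)).
  move=> z1; apply: (@is_cderiv_comp R phi (interp_err s rho f)); first exact: analytic_is_cderiv.
  by apply: analytic_is_cderiv => //; exact: phiD.
have -> : Hnorm omega (Comp phi f - S f) = Hnorm omega e by apply: Hnorm_eq => z z1.
have ean : analytic_on_disk e by move=> z /ed h; eexists; exact: h.
have eX (z : cplx R) : disk z -> cmod (cderiv e z) <= 4 * X / delta * cmod (cderiv phi z).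
  move=> z1; rewrite (cderivE (ed z z1)) cmodM ler_wpM2r ?cmod_ge0 //.
  apply: cauchy_scaled => // w wz; have Nw : phi_nbhd phi delta w by exists z.
  by split; [exact: le_lt_trans (Nr _ Nw) r1|exact: errX].
have c0 : 0 <= 4 * X / delta by rewrite (divr_ge0 (mulr_ge0 _ X0) (ltW d0)).
have [_ hD] := Dir_le omc om0 c0 ean phi_H eX.
rewrite -mulrA -/X; apply: (Hnorm_le om0); first by rewrite mulr_ge0 // addr_ge0.
apply: le_trans (sqr_scale_le X q0); rewrite /Hnorm2; apply: lerD.
  rewrite ler_pXn2r ?nnegrE ?cmod_ge0 //; apply: errX; exists 0; rewrite ?subrr ?cmod0 //.
have -> : X ^+ 2 * q = (4 * X / delta) ^+ 2 * fine (Dirichlet_integral omega phi) / pi.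
  by rewrite /q !exprMn; ring.
by rewrite ler_wpM2r // invr_ge0 pi_ge0.
Qed.

End UpperBound.

(** * Limits of n-th roots *)

Section Roots.
Variable R : realType.

Lemma powR_of_expR (y p : R) : expR y `^ p = expR (y * p).
Proof. by rewrite /powR gt_eqF ?expR_gt0 // expRK mulrC. Qed.

Lemma root_le (a y : R) (n : nat) : 0 <= a -> a <= expR y -> a `^ n.+1%:R^-1 <= expR (y / n.+1%:R).
Proof.
by move=> a0 ay; rewrite -powR_of_expR ge0_ler_powR ?nnegrE ?invr_ge0 ?expR_ge0.
Qed.

Lemma root_ge (a y : R) (n : nat) : 0 <= a -> expR y <= a -> expR (y / n.+1%:R) <= a `^ n.+1%:R^-1.
Proof.
by move=> a0 ay; rewrite -powR_of_expR ge0_ler_powR ?nnegrE ?invr_ge0 ?expR_ge0.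
Qed.

Lemma eventually_ge (A : R) : \forall n \near \oo, A <= n.+1%:R.
Proof.
exists (Num.truncn A) => // n /= An; apply: le_trans (ltW (truncnS_gt A)) _.
by rewrite ler_nat.
Qed.

Lemma root_limsup (a : nat -> R) (C v w : R) : w < v -> (forall n, 0 <= a n) ->
  (forall n, a n <= C * expR (- (n%:R * v))) -> \forall n \near \oo, a n `^ n.+1%:R^-1 <= expR (- w).
Proof.
move=> wv a0 aC; pose C' := `|C| + 1; have C'0 : 0 < C' by rewrite ltr_wpDl.
apply: filterS (eventually_ge ((ln C' + v) / (v - w))) => n.
rewrite ler_pdivrMr ?subr_gt0 // => hn.
have : a n <= expR (ln C' - n%:R * v).
  rewrite expRD lnK ?posrE //; apply: le_trans (aC n) _; rewrite ler_wpM2r ?expR_ge0 //.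
  by apply: le_trans (ler_norm _) _; rewrite lerDl.
move=> h; apply: le_trans (root_le n (a0 n) h) _; rewrite ler_expR ler_pdivrMr //.
by move: hn; rewrite -natr1; lra.
Qed.

Lemma root_liminf (a : nat -> R) (c C v w : R) : 0 < c -> v < w -> (forall n, 0 <= a n) ->
  (forall n, c / n.+1%:R ^+ 2 * expR (- (n.+1%:R * v + C)) <= a n) ->
  \forall n \near \oo, expR (- w) <= a n `^ n.+1%:R^-1.
Proof.
(* The gap [w - v] is [4 * k]: half of it absorbs twice the logarithm of [n.+1], half the
   constants. *)
move=> c0 vw a0 ac; pose k := (w - v) / 4; have k0 : 0 < k by rewrite divr_gt0 // subr_gt0.
apply: filterS (eventually_ge ((C - ln c - 2 - 2 * ln k) / (2 * k))) => n.
rewrite ler_pdivrMr ?(mulr_gt0 _ k0) // => hn.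
have n0 : 0 < n.+1%:R :> R by [].
have ln_le : ln (n.+1%:R) <= k * n.+1%:R - 1 - ln k.
  have := @le_ln1Dx R (k * n.+1%:R - 1); rewrite (addrC 1) subrK lnM ?posrE // => h.
  by have := h ltac:(by rewrite ltrBrDr addNr mulr_gt0); lra.
have : expR (ln c - 2 * ln n.+1%:R - (n.+1%:R * v + C)) <= a n.
  have e2 : expR (2 * ln n.+1%:R) = n.+1%:R ^+ 2 :> R.
    by have -> : 2 * ln n.+1%:R = ln n.+1%:R + ln n.+1%:R :> R; [ring|rewrite expRD lnK ?posrE // expr2].
  by apply: le_trans (ac n); rewrite expRD expRD lnK ?posrE // [expR (- (2 * _))]expRN e2.
move=> h; apply: le_trans (root_ge n (a0 n) h); rewrite ler_expR ler_pdivlMr //.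
have wE : w = v + 4 * k by rewrite /k; lra.
by move: hn ln_le; rewrite wE; set L := ln _; set K := ln _; set M := ln _; set N := n.+1%:R; lra.
Qed.

(** For infinite [V] the limit is 0: every real [v] is allowed in the upper bound, and the lower one
    is just nonnegativity of the roots. *)
Lemma root_cvg (a : nat -> R) (V : \bar R) : (0 <= V)%E -> (forall n, 0 <= a n) ->
  (forall v : R, (v%:E < V)%E -> exists C : R, forall n, a n <= C * expR (- (n%:R * v))) ->
  (forall v : R, (V < v%:E)%E -> exists c C : R, 0 < c /\ forall n, c / n.+1%:R ^+ 2 * expR (- (n.+1%:R * v + C)) <= a n) ->
  (fun n => (a n `^ n.+1%:R^-1)%:E) @ \oo --> expeR (- V)%E.
Proof.
move=> V0 a0 up low.
have [L LE L0] : exists2 L : R, expeR (- V)%E = L%:E & 0 <= L.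
  by case: (V) V0 => [v||] // _; [exists (expR (- v)); rewrite ?expR_ge0|exists 0].
rewrite LE; apply/fine_cvgP; split; first by apply: nearW.
apply/cvgrPdist_le => e e0 /=.
have ups : \forall n \near \oo, a n `^ n.+1%:R^-1 <= L + e.
  have p0 : 0 < L + e by rewrite ltr_wpDl.
  pose w := - ln (L + e); have wV : (w%:E < V)%E.
    move: V0 LE; rewrite /w; case: (V) => [v||] // _ LE; last by rewrite ltry.
    have {}LE : expR (- v) = L by case: LE.
    by rewrite lte_fin ltrNl -ltr_expR lnK ?posrE // LE ltrDl.
  have [v wv vV] : exists2 v : R, w < v & (v%:E < V)%E.
    case: (V) wV => [x||] //; rewrite ?lte_fin => wx.
    - by exists ((w + x) / 2); rewrite ?lte_fin; lra.
    - by exists (w + 1); rewrite ?ltry //; lra.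
  have [C hC] := up v vV.
  by apply: filterS (root_limsup wv a0 hC) => n; rewrite /w opprK lnK ?posrE.
have lows : \forall n \near \oo, L - e <= a n `^ n.+1%:R^-1.
  have [le|le] := leP (L - e) 0; first by apply: nearW => n; apply: le_trans le _; exact: powR_ge0.
  pose w := - ln (L - e).
  have Vw : (V < w%:E)%E.
    move: V0 LE; rewrite /w; case: (V) => [v||] // _ LE.
    - have {}LE : expR (- v) = L by case: LE.
      by rewrite lte_fin ltrNr -ltr_expR lnK ?posrE // LE gtrBl.
    - have {}LE : 0 = L by case: LE.
      by move: le; rewrite -LE sub0r oppr_gt0 ltNge (ltW e0).
  have [v Vv vw] : exists2 v : R, (V < v%:E)%E & v < w.
    case: (V) V0 Vw => [x||] // _; rewrite ?lte_fin => wx.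
    by exists ((w + x) / 2); rewrite ?lte_fin; lra.
  have [c [C [c0 hc]]] := low v Vv.
  by apply: filterS (root_liminf c0 vw a0 hc) => n; rewrite /w opprK lnK ?posrE.
by apply: filterS2 ups lows => n h1 h2; rewrite distrC ler_norml; apply/andP; split; lra.
Qed.

End Roots.

(** * Constant maps *)

Section ConstantMap.
Variable R : realType.
Variable omega : R -> R.
Hypothesis omc : {within `[0, 1[, continuous omega}.
Hypothesis om0 : forall r : R, 0 <= r < 1 -> 0 < omega r.
Variables (phi : cplx R -> cplx R) (p : cplx R).
Hypothesis hT : bounded_op omega (Comp phi).
Hypothesis p1 : cmod p < 1.
Hypothesis phip : forall z, cmod z < 1 -> phi z = p.

(** Every admissible measure is concentrated at [p], where the kernel is infinite. *)
Lemma green_V_constant : green_V (phi @` (@disk R)) = +oo%E.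
Proof.
apply/eqP; rewrite -leye_eq; apply: le_ereal_inf_tmp => _ [mu [K [cK KE muK]] <-].
have Kp x : K x -> x = p by move=> /KE[z /phip -> <-].
have mK : measurable K by exact: compact_measurable2.
rewrite (green_energyE mK _ muK); last by move=> x /Kp ->.
have a0 := @avg_pot_ge0 _ _ _ _ (@gker_ge0 R) mu.
apply: (le_avg mK muK) => // [|x Kx]; first exact: (measurable_avg_pot (@gker_ge0 R) (@measurable_gker R)).
apply: (le_avg mK muK) => //; [by move=> y; exact: gker_ge0|exact: (kernel_measurable (@measurable_gker R))|].
by move=> y Ky; rewrite (Kp x Kx) (Kp y Ky) /gker p1 /= greenE eqxx.
Qed.

Lemma approx_number_constant n : approx_number omega (Comp phi) n.+2 = 0.
Proof.
apply/le_anti; rewrite approx_number_ge0 andbT.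
have rT : rank_lt omega (Comp phi) n.+2.
  exists 1%N; split => //; exists (fun _ _ => 1 : cplx R); split; first by move=> i; exact: in_H_cst.
  move=> f _; exists (fun=> f p) => z z1; rewrite big_ord_recl big_ord0 addr0 cmulE mulr1.
  by rewrite /Comp /= phip.
apply: le_trans (approx_number_le _ hT rT) _; apply: (op_norm_le omc om0) => f _ _.
by rewrite subrr; exact: (Hnorm_zero omc om0).
Qed.

End ConstantMap.

Theorem theorem3p1 (R : realType) (omega : R -> R) (phi : R * R -> R * R) :
  {within `[0, 1[, continuous omega} ->
  (forall r : R, 0 <= r < 1 -> 0 < omega r) ->
  (@lebesgue_measure R).-integrable `[0, 1[ (EFin \o omega) ->
  analytic_on_disk phi ->
  (forall z, disk z -> disk (phi z)) ->
  bounded_op omega (Comp phi) ->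
  closure (phi @` (@disk R)) `<=` disk ->
  (fun n : nat =>
     ((approx_number omega (Comp phi) n.+1) `^ (n.+1%:R)^-1)%:E)
    @ \oo --> expeR (- (green_cap (phi @` disk))^-1)%E.
Proof.
move=> omc om0 omi hphi phiD hT phicl; rewrite /green_cap inveK.
have V0 : (0 <= green_V (phi @` (@disk R)))%E.
  apply: le_ereal_inf_tmp => _ [mu [K [cK KE muK]] <-].
  rewrite (green_energyE (compact_measurable2 cK) _ muK).
    by apply: integral_ge0 => x _; apply: avg_pot_ge0; exact: gker_ge0.
  by move=> x /KE[z /phiD + <-].
apply: root_cvg => // [n|v vV|v Vv]; first exact: approx_number_ge0.
- have [[a [b [a1 b1 ab]]]|cst] := pselect (exists a b : R * R, [/\ cmod a < 1, cmod b < 1 & phi a != phi b]).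
    have [v' vv' v'V] : exists2 v' : R, v < v' & (v'%:E < green_V (phi @` (@disk R)))%E.
      case: (green_V _) vV => [x||] //; rewrite ?lte_fin => vx.
      - by exists ((v + x) / 2); rewrite ?lte_fin; lra.
      - by exists (v + 1); rewrite ?ltry //; lra.
    have [delta [C1 [r [d0 r0 r1 Nr hs]]]] := high_potential_points hphi phiD phicl a1 b1 ab v'V.
    (* The loss [expR (n%:R * (v' - v))] on the circle turns the rate [v'] of the Blaschke product
       into [v]. *)
    have eta0 : 0 < v' - v by rewrite subr_gt0.
    have [C C0 hC] := approx_upper omc om0 omi hphi phiD hT r0 r1 d0 eta0 Nr.
    exists (C * expR C1) => n; have [s [sn sr sp]] := hs n.
    have := hC s (expR (- (n%:R * v' - C1))) sr (expR_ge0 _); rewrite sn => h.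
    apply: le_trans (h _) _.
      move=> w Nw; apply: blasp_le_pot; [|exact: le_lt_trans (Nr _ Nw) r1|exact: sp].
      by move=> x /sr xr; exact: le_lt_trans xr r1.
    rewrite -expRD -mulrA -expRD ler_wpM2l // ler_expR; lra.
  have phip z : cmod z < 1 -> phi z = phi 0.
    move=> z1; apply/eqP; apply: contrapT => /negP zn; apply: cst; exists z, 0; split => //.
    by rewrite (@cmod0 R).
  (* For a constant map only the first approximation number can be nonzero, and at index 0 the
     exponential equals 1. *)
  exists (approx_number omega (Comp phi) 1) => -[|n].
    by rewrite mul0r oppr0 expR0 mulr1.
  rewrite (approx_number_constant omc om0 hT phip) mulr_ge0 ?expR_ge0 //; exact: approx_number_ge0.
have [[a [b [a1 b1 ab]]]|cst] := pselect (exists a b : R * R, [/\ cmod a < 1, cmod b < 1 & phi a != phi b]).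
  have [rho [C [rho0 rho1 hs]]] := low_potential_points hphi phiD phicl a1 b1 ab Vv.
  have [r [r0 r1 phir]] := phi_bound phicl.
  have [c c0 hc] := approx_lower omc om0 omi hT rho0 rho1 r1 phir.
  exists c, C; split => // n; have [s [sN sB sp]] := hs n.+1 isT.
  exact: hc sN sB sp.
have phip z : cmod z < 1 -> phi z = phi 0.
  move=> z1; apply/eqP; apply: contrapT => /negP zn; apply: cst; exists z, 0; split => //.
  by rewrite (@cmod0 R).
have p1 : cmod (phi 0) < 1 by apply: phiD; exact: disk0.
by move: Vv; rewrite (green_V_constant p1 phip).
Qed.
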